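(* Let $\alpha>0$, $\lambda=\pm1$, $N\ge1$. For all sufficiently small $\tau>0$, the solution $(u_N^k)_{k\in\mathbb{N}}$ of the fully discrete scheme $$u_N^{k}-e^{-\alpha\tau}u_N^{k-1}=\Big(\mathbf{i}\Delta u_N^{k}+\mathbf{i}\lambda\pi_N\Big(\tfrac{|u_N^{k}|^2+|e^{-\alpha\tau}u_N^{k-1}|^2}{2}u_N^{k}\Big)\Big)\tau+\pi_NQ^{\frac12}\delta W_{k},\qquad u_N^0=\pi_Nu_0,$$ has a unique invariant measure $\mu_N^\tau$. Thus it is ergodic.
   Context: Functions are complex valued on $[0,1]$ with homogeneous Dirichlet boundary conditions; $\Delta$ is the Dirichlet Laplacian, $e_m(x)=\sqrt2\sin(m\pi x)$, $m\ge1$, its orthonormal eigenbasis in $L^2=L^2(0,1)$ with $(u,v)=\int_0^1u\bar v\,dx$. $V_N=\mathrm{span}_{\mathbb{C}}\{e_1,\dots,e_N\}$, $\pi_Nu=\sum_{m=1}^N(u,e_m)e_m$. The initial value $u_0\in L^2$ is deterministic. Noise: $\pi_NQ^{\frac12}\delta W_k=\sum_{m=1}^N\sqrt{\eta_m}\,e_m(\beta_m(t_k)-\beta_m(t_{k-1}))$, $t_k=k\tau$, with $\eta_m>0$, $\sum_{m\ge1}\eta_m<\infty$, $\beta_m=\beta_m^1+\mathbf{i}\beta_m^2$, $\{\beta_m^i\}$ independent real standard Brownian motions with filtration $\{\mathcal F_t\}$. The uniform time step $\tau$ satisfies $\alpha\tau\le1$. For sufficiently small $\tau$ the scheme has a unique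 $V_N$-valued $\{\mathcal F_{t_k}\}$-adapted solution, which is a time-homogeneous Markov chain on $V_N$. A chain with transition operators $P_k\phi(y)=E[\phi(u_N^k)\mid u_N^0=y]$ and invariant measure $\mu$ is ergodic if $\lim_{M\to\infty}\frac1M\sum_{k=0}^{M-1}P_k\phi=\int_{V_N}\phi\,d\mu$ in $L^2(V_N,\mu)$ for all $\phi\in L^2(V_N,\mu)$. *)

(* Defs.v *)
From HB Require Import structures.
From mathcomp Require Import all_boot all_order all_algebra complex.
From mathcomp Require Import all_classical all_reals all_analysis.

Set Implicit Arguments.
Unset Strict Implicit.
Unset Printing Implicit Defensive.

Import Order.TTheory GRing.Theory Num.Theory.
Import numFieldNormedType.Exports.

Local Open Scope classical_set_scope.
Local Open Scope ring_scope.
Local Open Scope complex_scope.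

Section functions_on_the_unit_interval.
Context {R : realType}.
Implicit Types f g : R -> R[i].

Definition square_integrable f :=
  [/\ measurable_fun `[0 : R, 1] (fun x => complex.Re (f x)),
      measurable_fun `[0 : R, 1] (fun x => complex.Im (f x)) &
      (\int[lebesgue_measure]_(x in `[0%R : R, 1%R])
         (complex.Re (f x) ^+ 2 + complex.Im (f x) ^+ 2)%R%:E < +oo)%E].

Definition inner f g : R[i] :=
  let h x := f x * (g x)^*%C in
  (\int[lebesgue_measure]_(x in `[0 : R, 1]) complex.Re (h x)) +i*
  (\int[lebesgue_measure]_(x in `[0 : R, 1]) complex.Im (h x)).

Definition sine_mode (m : nat) (x : R) : R[i] :=
  (Num.sqrt 2 * sin (m%:R * pi * x))%:C.

(* It is only applied to elements of V_N, which are smooth on the whole line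
   and vanish at 0 and 1, hence lie in the domain of the Dirichlet Laplacian. *)
Definition laplacian f (x : R) : R[i] :=
  derive1n 2 (fun y => complex.Re (f y)) x +i*
  derive1n 2 (fun y => complex.Im (f y)) x.

Definition projection (N : nat) f (x : R) : R[i] :=
  \sum_(1 <= m < N.+1) inner f (sine_mode m) * sine_mode m x.

End functions_on_the_unit_interval.

(* V_N = span_C {e_1, ..., e_N}, carried by the coordinates in this basis: the
   m-th entry (m < N) holds the real and imaginary parts of the coefficient of
   e_(m+1).  The product sigma-algebra is the Borel sigma-algebra of V_N. *)
Notation VN R N := (N.-tuple (R * R)%type).

Definition VN_fun {R : realType} {N : nat} (a : VN R N) (x : R) : R[i] :=
  \sum_(m < N) ((tnth a m).1 +i* (tnth a m).2) * sine_mode m.+1 x.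

Section probability_notions.
Context {d : measure_display} {Omega : measurableType d} {R : realType}.
Variable P : probability Omega R.

Definition generated_sigma {I : Type} (D : set I) (X : I -> Omega -> R) :
    set (set Omega) :=
  <<s [set A | exists2 j, D j & exists2 B, measurable B & A = X j @^-1` B] >>.

Definition independent (G H : set (set Omega)) :=
  forall A B, G A -> H B -> P (A `&` B) = (P A * P B)%E.

Definition mutually_independent {I : eqType} (G : I -> set (set Omega)) :=
  forall (J : seq I) (A : I -> set Omega), uniq J ->
    (forall j, j \in J -> G j (A j)) ->
    P (\big[setI/setT]_(j <- J) A j) = (\prod_(j <- J) P (A j))%E.

Definition filtration (F : R -> set (set Omega)) :=
  (forall t : R, 0 <= t -> sigma_algebra setT (F t) /\ F t `<=` measurable) /\
  (forall s t : R, 0 <= s -> s <= t -> F s `<=` F t).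

(* Adaptedness and brownian_indep_past make each W j a standard Brownian motion
   relative to F; F may be larger than the natural filtration. *)
Record brownian_family {I : eqType} (F : R -> set (set Omega))
    (W : I -> R -> {RV P >-> R}) : Prop := BrownianFamily {
  brownian_filtration : filtration F ;
  brownian_adapted : forall j (t : R) B, 0 <= t -> measurable B ->
    F t (W j t @^-1` B) ;
  brownian_start : forall j, {ae P, forall w, W j 0 w = 0} ;
  brownian_continuous : forall j,
    {ae P, forall w, {within `[0 : R, +oo[, continuous (fun t => W j t w)}} ;
  brownian_increment : forall j (s t : R) B, 0 <= s -> s < t -> measurable B ->
    P [set w | B (W j t w - W j s w)] = normal_prob 0 (Num.sqrt (t - s)) B ;
  brownian_independent : mutually_independent
    (fun j => generated_sigma [set t : R | 0 <= t] (fun t => W j t : Omega -> R)) ;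
  brownian_indep_past : forall s t : R, 0 <= s -> s <= t ->
    independent (F s) (generated_sigma setT (fun j w => W j t w - W j s w))
}.

End probability_notions.

Section scheme.
Context {d : measure_display} {Omega : measurableType d} {R : realType}.
Variable P : probability Omega R.
Variables (F : R -> set (set Omega)) (W : nat * bool -> R -> {RV P >-> R}).
Variables (eta : nat -> R) (alpha lambda tau : R) (N : nat).

(* beta_m = beta_m^1 + i beta_m^2 for m >= 1, the two real motions being
   W (m.-1, false) and W (m.-1, true), so that W has no unused component. *)
Definition complex_brownian (m : nat) (t : R) (w : Omega) : R[i] :=
  W (m.-1, false) t w +i* W (m.-1, true) t w.

Definition noise_increment (k : nat) (w : Omega) (x : R) : R[i] :=
  \sum_(1 <= m < N.+1) (Num.sqrt (eta m))%:C * sine_mode m x *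
    (complex_brownian m (k%:R * tau) w - complex_brownian m (k.-1%:R * tau) w).

Definition scheme_step (k : nat) (w : Omega) (v u : VN R N) :=
  let uk := VN_fun u in
  let vk := fun x => (expR (- (alpha * tau)))%:C * VN_fun v x in
  forall x : R, 0 <= x <= 1 ->
    uk x - vk x =
      ('i * laplacian uk x +
       'i * lambda%:C *
         projection N (fun y => (`|uk y| ^+ 2 + `|vk y| ^+ 2) / 2 * uk y) x)
      * tau%:C
      + noise_increment k w x.

Definition scheme_solution (u0 : R -> R[i]) (u : nat -> Omega -> VN R N) :=
  [/\ forall k B, measurable B -> F (k%:R * tau) (u k @^-1` B),
      {ae P, forall w, forall x : R, 0 <= x <= 1 ->
         VN_fun (u 0%N w) x = projection N u0 x} &
      forall k, (0 < k)%N ->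
        {ae P, forall w, scheme_step k w (u k.-1 w) (u k w)}].

End scheme.

(* U u0 is a process started from the projection of u0, so that
   P_k phi (y) = E [phi (u^k) | u^0 = y] is computed along U (VN_fun y). *)
Section transition_operators.
Context {d : measure_display} {Omega : measurableType d} {R : realType}.
Variables (P : probability Omega R) (N : nat).
Variable U : (R -> R[i]) -> nat -> Omega -> VN R N.

Definition transition (k : nat) (phi : VN R N -> R) (y : VN R N) : R :=
  fine ('E_P[fun w => phi (U (VN_fun y) k w)]).

Definition invariant_measure (mu : probability (VN R N) R) :=
  forall (k : nat) (phi : VN R N -> R),
    measurable_fun setT phi -> (exists C : R, forall y, `|phi y| <= C) ->
    (\int[mu]_y (transition k phi y)%:E = \int[mu]_y (phi y)%:E)%E.

Definition ergodic (mu : probability (VN R N) R) :=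
  forall phi : VN R N -> R, phi \in Lfun mu 2%:E ->
    let deviation (M : nat) (y : VN R N) : R :=
      M%:R^-1 * (\sum_(k < M) transition k phi y) - \int[mu]_z phi z in
    ('N[mu]_2%:E[EFin \o deviation M])%E @[M --> \oo] --> 0%E.

End transition_operators.

(* Main.v *)
(* In the coordinates of V_N one step of the scheme reads Psi_v(u) = xi, with v
   the old state, u the new one and xi a nondegenerate Gaussian vector whose
   law does not depend on the step.
   - If tau (N pi)^2 < 1, the pointwise inequality |Im (D conj h)| <= Re (D conj h)
     for D = G(u) - G(u'), h = u - u' and the cubic term G makes the inverse of
     Psi_v Lipschitz uniformly in v.  Pairing the equation with u and using
     int |u|^4 >= (int |u|^2)^2 bounds u in terms of xi only, whatever v is.
   - The range of Psi_v is closed by the Lipschitz bound and dense because the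
     scheme is solvable for almost every xi, and xi charges every cube; hence
     u = Phi(v, xi) with Phi measurable.
   - Phi(v, .) maps the cube of radius r / L about Psi_v(p) into the cube of
     radius r about p, so the transition kernel charges small cubes at least
     proportionally to the noise law, uniformly over bounded v; comparing two
     measures on all fine dyadic cells compares them on all Borel sets, so no
     change of variables formula is needed.
   - Since one step enters a fixed bounded set with probability bounded below
     from any state, two steps satisfy Doeblin's condition.  Iterates of the
     kernel then contract oscillations, which yields a unique invariant measure
     with uniform convergence for bounded functions; truncation and Jensen's
     inequality extend the Cesaro convergence to L^2. *)
Require Import Defs.
From HB Require Import structures.
From mathcomp Require Import all_boot all_order all_algebra complex.
From mathcomp Require Import all_classical all_reals all_analysis.
From mathcomp Require Import measurable_realfun ring lra zify.

Set Implicit Arguments.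
Unset Strict Implicit.
Unset Printing Implicit Defensive.

Import Order.TTheory GRing.Theory Num.Theory.
Import numFieldNormedType.Exports.

Local Open Scope classical_set_scope.
Local Open Scope ring_scope.
Local Open Scope complex_scope.

(** * Doeblin chains *)

(** Both signs of [lambda] are treated at once. Pair the difference of two implicit equations with
    h: the real part carries |h|^2 and tau lambda Im of the cubic pairing, the imaginary part
    carries the Laplacian and - tau lambda Re. Subtracting lambda times the imaginary part from the
    real part, lambda^2 = 1 leaves tau (Re + lambda Im) >= 0, so only the Laplacian can compete with
    |h|^2, by at most tau (N pi)^2 |h|^2. This is the origin of the smallness condition on tau. A
    second obstacle is that [U] supplies one process for each initial value and says nothing about
    the dependence on that value, so [transition] is not known to be measurable in [y]. The remedy
    is to identify the law of the chain started at [y] with the iterates of a single kernel v -> law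
    of Phi(v, xi), built from a jointly measurable Phi. The invariant measure is not obtained by
    compactness. Uniform contraction makes the limit of the iterates a positive functional that is
    continuous under bounded pointwise convergence, and such a functional is integration against a
    probability. *)

Lemma limr_norm_le (R : realType) (u : nat -> R) (l C : R) :
  (forall n, `|u n| <= C) -> u n @[n --> \oo] --> l -> `|l| <= C.
Proof.
move=> uC ul; have nul : `|u n| @[n --> \oo] --> `|l| by exact: cvg_norm.
by rewrite -(cvg_lim _ nul)//; apply: limr_le; [apply/cvg_ex; exists `|l| | exact: nearW].
Qed.

Section bounded_measurable.
Context d (X : measurableType d) (R : realType).
Implicit Types f g : X -> R.

(** The test functions of [invariant_measure]. They have real integrals against every finite measure
    and [markov_op] preserves them, so operators can be iterated without extended reals. *)
Definition bddm f := measurable_fun setT f /\ exists C, forall x, `|f x| <= C.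

Lemma bddm_cst (c : R) : bddm (cst c).
Proof. by split => //; exists `|c| => x /=. Qed.

Lemma bddmD f g : bddm f -> bddm g -> bddm (f \+ g).
Proof.
move=> [mf [C fC]] [mg [D gD]]; split; first exact: measurable_funD.
by exists (C + D) => x /=; rewrite (le_trans (ler_normD _ _))// lerD.
Qed.

Lemma bddmZ (c : R) f : bddm f -> bddm (fun x => c * f x).
Proof.
move=> [mf [C fC]]; split.
  exact: measurable_funM.
by exists (`|c| * C) => x; rewrite normrM ler_wpM2l.
Qed.

Lemma bddm_indic A : measurable A -> bddm (\1_A : X -> R).
Proof.
move=> mA; split; first exact: measurable_indic.
by exists 1 => x; rewrite indicE; case: (_ \in _); rewrite ?normr1 ?normr0.
Qed.

Lemma bddm_sum (I : Type) (s : seq I) (F : I -> X -> R) :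
  (forall i, bddm (F i)) -> bddm (fun x => \sum_(i <- s) F i x).
Proof.
move=> bF; elim: s => [|i s ih].
  by under eq_fun do rewrite big_nil; exact: bddm_cst.
by under eq_fun do rewrite big_cons; exact: bddmD.
Qed.

Lemma bddm_integrable (m : {measure set X -> \bar R}) f :
  (m setT < +oo)%E -> bddm f -> m.-integrable setT (EFin \o f).
Proof.
move=> moo [mf [C fC]]; apply: measurable_bounded_integrable => //.
exists C; split; first exact: num_real.
by move=> M CM x _; exact: le_trans (fC x) (ltW CM).
Qed.

Lemma probability_ltoo (P : probability X R) : (P setT < +oo)%E.
Proof. by rewrite probability_setT ltry. Qed.

Lemma Rintegral_probability_cst (P : probability X R) (c : R) : \int[P]_x cst c x = c.
Proof. by rewrite Rintegral_cst//= (probability_setT P) mulr1. Qed.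

Lemma bddm_fine (m : {measure set X -> \bar R}) f :
  (m setT < +oo)%E -> bddm f ->
  (\int[m]_x f x)%:E = (\int[m]_x (f x)%:E)%E.
Proof.
by move=> moo bf; rewrite fineK//; apply: integrable_fin_num => //; exact: bddm_integrable.
Qed.

Lemma bddm_Rint_bounded_cvg (m : {measure set X -> \bar R}) (F : nat -> X -> R) f
    (C : R) : (m setT < +oo)%E ->
  (forall n, measurable_fun setT (F n)) -> measurable_fun setT f ->
  (forall n x, `|F n x| <= C) ->
  (forall x, F n x @[n --> \oo] --> f x) ->
  \int[m]_x F n x @[n --> \oo] --> \int[m]_x f x.
Proof.
move=> moo mF mf FC Ff.
have fC x : `|f x| <= C by apply: limr_norm_le (Ff x) => n.
have bf : bddm f by split => //; exists C.
apply: fine_cvg; rewrite -/(Rintegral _ _ _) bddm_fine//.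
apply: (@dominated_cvg _ _ _ m setT measurableT (fun n => EFin \o F n) (EFin \o f) (cst C%:E)) => //.
- by move=> n; apply/measurable_EFinP.
- by move=> x _; apply: cvg_EFin; [exact: nearW|exact: Ff].
- have H : m.-integrable setT (EFin \o cst C) by apply: (bddm_integrable moo); exact: bddm_cst.
  exact: H.
- by move=> n x _; rewrite /= lee_fin.
Qed.

End bounded_measurable.

(** * Markov operators on bounded measurable functions *)

Section markov_operator.
Context d (X : measurableType d) (R : realType).
Variable K : X -> probability X R.
Hypothesis mK : forall A, measurable A -> measurable_fun setT (fun x => K x A).
Implicit Types f g : X -> R.

Definition markov_op f x := \int[K x]_y f y.

Let op := markov_op.

Lemma markov_op_cst (c : R) x : op (cst c) x = c.
Proof. exact: Rintegral_probability_cst. Qed.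

Lemma markov_integrable f x : bddm f -> (K x).-integrable setT (EFin \o f).
Proof. by move=> bf; apply: bddm_integrable (probability_ltoo (K x)) _. Qed.

Lemma markov_opD f g x : bddm f -> bddm g -> op (f \+ g) x = op f x + op g x.
Proof. by move=> bf bg; rewrite /op /markov_op RintegralD//; exact: markov_integrable. Qed.

Lemma markov_opZ (c : R) f x : bddm f -> op (fun y => c * f y) x = c * op f x.
Proof. by move=> bf; rewrite /op /markov_op RintegralZl//; exact: markov_integrable. Qed.

Lemma markov_op_le f g x : bddm f -> bddm g -> (forall y, f y <= g y) ->
  op f x <= op g x.
Proof. by move=> bf bg fg; apply: le_Rintegral => //; exact: markov_integrable. Qed.

Lemma markov_op_itv f (a b : R) x : bddm f -> (forall y, a <= f y <= b) ->
  a <= op f x <= b.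
Proof.
move=> bf ab; apply/andP; split.
  rewrite -[leLHS](markov_op_cst a x); apply: markov_op_le => //; first exact: bddm_cst.
  by move=> y; have /andP[] := ab y.
rewrite -[leRHS](markov_op_cst b x); apply: markov_op_le => //; first exact: bddm_cst.
by move=> y; have /andP[] := ab y.
Qed.

Lemma markov_op_bddm f : bddm f -> bddm (op f).
Proof.
move=> bf; have [mf [C fC]] := bf; split; last first.
  by exists C => x; rewrite ler_norml; apply: markov_op_itv => // y; rewrite -ler_norml.
(* Kernel integrals of nonnegative functions are measurable. Adding the bound [C] makes the
   integrand nonnegative, and subtracting it again is exact because [K x] has mass 1. *)
have -> : op f = (fun x => fine (\int[K x]_y (f y + C)%:E)%E - C).
  apply/funext => x; have := markov_opD x bf (bddm_cst _ C).
  by rewrite markov_op_cst => /eqP; rewrite -subr_eq => /eqP <-.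
apply: measurable_funB => //; apply: measurableT_comp => //.
apply: measurable_fun_integral_kernel => //.
  by move=> y; rewrite lee_fin -lerBlDr sub0r; have := fC y; rewrite ler_norml => /andP[].
by apply/measurable_EFinP; exact: measurable_funD.
Qed.

Lemma iter_markov_op_bddm k f : bddm f -> bddm (iter k op f).
Proof. by move=> bf; elim: k => //= k; exact: markov_op_bddm. Qed.

Lemma iter_markov_opD k f g x : bddm f -> bddm g ->
  iter k op (f \+ g) x = iter k op f x + iter k op g x.
Proof.
move=> bf bg; suff -> : iter k op (f \+ g) = iter k op f \+ iter k op g by [].
elim: k => //= k ->; apply/funext => y /=.
by rewrite markov_opD//; exact: iter_markov_op_bddm.
Qed.

Lemma iter_markov_opZ k (c : R) f x : bddm f ->
  iter k op (fun y => c * f y) x = c * iter k op f x.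
Proof.
move=> bf; suff -> : iter k op (fun y => c * f y) = (fun y => c * iter k op f y) by [].
elim: k => //= k ->; apply/funext => y /=.
by rewrite markov_opZ//; exact: iter_markov_op_bddm.
Qed.

Lemma iter_markov_op_cst k (c : R) : iter k op (cst c) = cst c.
Proof. by elim: k => //= k ->; apply/funext => y; exact: markov_op_cst. Qed.

Lemma iter_markov_op_le k f g x : bddm f -> bddm g -> (forall y, f y <= g y) ->
  iter k op f x <= iter k op g x.
Proof.
move=> bf bg fg; elim: k x => //= k ih x.
by apply: markov_op_le => //; exact: iter_markov_op_bddm.
Qed.

Lemma iter_markov_op_leP k f (b : R) x : bddm f -> (forall y, f y <= b) ->
  iter k op f x <= b.
Proof.
move=> bf fb; have := iter_markov_op_le k x bf (bddm_cst _ b) fb.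
by rewrite iter_markov_op_cst.
Qed.

Lemma iter_markov_op_geP k f (a : R) x : bddm f -> (forall y, a <= f y) ->
  a <= iter k op f x.
Proof.
move=> bf fa; have := iter_markov_op_le k x (bddm_cst _ a) bf fa.
by rewrite iter_markov_op_cst.
Qed.

Lemma iter_markov_op_bounded_cvg k (F : nat -> X -> R) f (C : R) x :
  (forall n, measurable_fun setT (F n)) -> measurable_fun setT f ->
  (forall n x, `|F n x| <= C) -> (forall x, F n x @[n --> \oo] --> f x) ->
  iter k op (F n) x @[n --> \oo] --> iter k op f x.
Proof.
move=> mF mf FC Ff.
have fC y : `|f y| <= C by apply: limr_norm_le (Ff y) => n.
have bF n : bddm (F n) by split => //; exists C.
have bf : bddm f by split => //; exists C.
elim: k x => [|k ih] x /=; first exact: Ff.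
apply: (@bddm_Rint_bounded_cvg _ _ _ _ _ _ C) => //.
- exact: probability_ltoo (K x).
- by move=> n; have [] := iter_markov_op_bddm k (bF n).
- by have [] := iter_markov_op_bddm k bf.
- move=> n y; rewrite ler_norml; apply/andP; split.
    by apply: iter_markov_op_geP => // z; have := FC n z; rewrite ler_norml => /andP[].
  by apply: iter_markov_op_leP => // z; have := FC n z; rewrite ler_norml => /andP[].
Qed.

(** One-sided, since [x] and [y] may be exchanged; it bounds sup f - inf f without forming
    either. *)
Definition osc_le f (D : R) := forall x y, f x - f y <= D.

Lemma osc_le_iter k f D : bddm f -> osc_le f D -> osc_le (iter k op f) D.
Proof.
move=> bf fD x y; rewrite lerBlDr addrC; apply: iter_markov_op_leP => // z.
rewrite -lerBlDr; apply: iter_markov_op_geP => // t.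
by rewrite lerBlDl addrC -lerBlDl.
Qed.

Lemma osc_le_iter_dist k f D x y : bddm f -> osc_le f D ->
  `|iter k op f x - f y| <= D.
Proof.
move=> bf fD; rewrite ler_norml lerBlDr lerBrDl; apply/andP; split.
  by apply: iter_markov_op_geP => // z; rewrite lerBlDl addrC -lerBlDl.
by apply: iter_markov_op_leP => // z; rewrite -lerBlDr.
Qed.

(** * Two-step minorization: contraction and invariant measure *)

Section doeblin.
Variables (eta : {measure set X -> \bar R}) (e : R).
Hypothesis eta_e : eta setT = e%:E.
Hypothesis e_gt0 : 0 < e.
Hypothesis doeblin : forall f x, bddm f -> (forall y, 0 <= f y) ->
  \int[eta]_y f y <= iter 2 op f x.

Lemma doeblin_le1 (x0 : X) : e <= 1.
Proof.
have := doeblin x0 (bddm_cst _ 1) (fun=> ler01).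
by rewrite iter_markov_op_cst Rintegral_cst// eta_e mul1r.
Qed.

(** Minorize [f - a] at [y] and [a + D - f] at [x], where [a] is the infimum of [f], and add: the
    integrals of [f] against [eta] cancel, and [e * D] remains as the gain over the trivial bound
    [D]. *)
Lemma doeblin_osc f D : bddm f -> osc_le f D -> osc_le (iter 2 op f) ((1 - e) * D).
Proof.
move=> bf fD x y.
have eoo : (eta setT < +oo)%E by rewrite eta_e ltry.
pose a := inf (range f).
have [_ [C fC]] := bf.
have inff : has_inf (range f).
  split; first by exists (f x), x.
  by exists (- C) => _ [z _ <-]; have := fC z; rewrite ler_norml => /andP[].
have af z : a <= f z by apply: ge_inf; [case: inff|exists z].
have fa z : f z <= a + D.
  rewrite -lerBlDr; apply: lb_le_inf; first by case: inff.
  by move=> _ [t _ <-]; rewrite lerBlDr addrC -lerBlDr.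
have bN : bddm (fun z => (-1) * f z) by exact: bddmZ.
have bNf : bddm (cst (a + D) \+ (fun z => (-1) * f z)) by apply: bddmD => //; exact: bddm_cst.
have bfa : bddm (f \+ cst (- a)) by apply: bddmD => //; exact: bddm_cst.
have h1 := doeblin y bfa (fun z => ltac:(rewrite /= subr_ge0; exact: af)).
have h2 := doeblin x bNf
  (fun z => ltac:(rewrite /= mulN1r subr_ge0; exact: fa)).
rewrite (iter_markov_opD 2 _ bf (bddm_cst _ _)) in h1.
rewrite (iter_markov_opD 2 _ (bddm_cst _ _) bN) (iter_markov_opZ 2 _ _ bf) in h2.
move: h1 h2; rewrite !iter_markov_op_cst /=.
rewrite !RintegralD//; try exact: bddm_integrable => //; try exact/bddm_integrable/bddm_cst.
rewrite RintegralZl//; last exact: bddm_integrable.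
rewrite !Rintegral_cst// eta_e /=.
set I := Rintegral _ _ _; set u := op _ x; set v := op _ y.
nra.
Qed.

(** Contraction is gained only every second step; a remaining odd step is absorbed by
    [osc_le_iter]. *)
Definition doeblin_rate k := (1 - e) ^+ k./2.

Lemma doeblin_rate_cvg (x0 : X) : doeblin_rate k @[k --> \oo] --> 0.
Proof.
apply: (cvg_comp half (fun n => (1 - e) ^+ n)).
  apply/cvgnyPge => A; exists A.*2 => //= n /= An.
  by rewrite -(doubleK A) half_leq.
by apply: cvg_expr; have := doeblin_le1 x0; rewrite ltr_norml; move: e_gt0; lra.
Qed.

Lemma doeblin_osc_iter k f D : bddm f -> osc_le f D ->
  osc_le (iter k op f) (doeblin_rate k * D).
Proof.
move=> bf fD; rewrite /doeblin_rate -{1}(odd_double_half k) addnC iterD.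
set g := iter _ op f.
have bg : bddm g by exact: iter_markov_op_bddm.
have gD : osc_le g D by exact: osc_le_iter.
elim: (k./2) => [|n ih]; first by rewrite expr0 mul1r.
rewrite doubleS exprS -mulrA -addn2 addnC iterD; apply: doeblin_osc => //.
exact: iter_markov_op_bddm.
Qed.

Lemma doeblin_limit f D (x0 : X) : bddm f -> osc_le f D -> exists l, forall k x,
  `|iter k op f x - l| <= doeblin_rate k * D.
Proof.
move=> bf fD.
(* The limit is the supremum of the numbers lying under a whole iterate. Each iterate minus its
   oscillation bound belongs to [E], and no element of [E] exceeds a value of the k-th iterate by
   more than that bound. *)
pose E := [set c | exists k, forall x, c <= iter k op f x].
have ub c k y : E c -> c <= iter k op f y + doeblin_rate k * D.
  move=> [m cm]; apply: (@le_trans _ _ (iter (k + m) op f y)).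
    by rewrite iterD; apply: iter_markov_op_geP => //; exact: iter_markov_op_bddm.
  rewrite addnC iterD -lerBlDl; apply: le_trans (ler_norm _) _.
  apply: osc_le_iter_dist; first exact: iter_markov_op_bddm.
  exact: doeblin_osc_iter.
have inE k y : E (iter k op f y - doeblin_rate k * D).
  exists k => x; rewrite lerBlDl -lerBlDr.
  exact: doeblin_osc_iter.
have supE : has_sup E.
  by split; [eexists; exact: inE 0%N x0|eexists => c; exact: ub c 0%N x0].
exists (sup E) => k x; rewrite ler_distlC; apply/andP; split.
  by apply: ub_le_sup (inE _ _); case: supE.
by apply: ge_sup => [|c]; [case: supE|exact: ub].
Qed.

Lemma osc_le_norm f C : (forall x, `|f x| <= C) -> osc_le f (C + C).
Proof.
by move=> fC x y; apply: le_trans (ler_norm _) _; rewrite (le_trans (ler_normB _ _))// lerD.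
Qed.

Variable x0 : X.

(** The future integral against the invariant measure. The base point only makes the limit a number:
    [doeblin_lim_dist] shows that it is the same along every starting point. *)
Definition doeblin_lim f : R := lim (iter k op f x0 @[k --> \oo]).

Let ell := doeblin_lim.

Lemma doeblin_lim_dist f D k x : bddm f -> osc_le f D ->
  `|iter k op f x - ell f| <= doeblin_rate k * D.
Proof.
move=> bf fD; have [l lP] := doeblin_limit x0 bf fD.
suff -> : ell f = l by [].
apply: cvg_lim => //; apply/cvgrPdist_le => eps eps0.
have : doeblin_rate k * D @[k --> \oo] --> 0.
  by rewrite -(mul0r D); apply: cvgMl; exact: doeblin_rate_cvg.
move/cvgrPdist_le => /(_ eps eps0); apply: filterS => n; rewrite sub0r normrN => h.
by rewrite distrC (le_trans (lP n x0))// (le_trans (ler_norm _)).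
Qed.

Lemma doeblin_lim_cvg f x : bddm f -> iter k op f x @[k --> \oo] --> ell f.
Proof.
move=> bf; have [_ [C fC]] := bf; have fD := osc_le_norm fC.
apply/cvgrPdist_le => eps eps0.
have : doeblin_rate k * (C + C) @[k --> \oo] --> 0.
  by rewrite -(mul0r (C + C)); apply: cvgMl; exact: doeblin_rate_cvg.
move/cvgrPdist_le => /(_ eps eps0); apply: filterS => n; rewrite sub0r normrN => h.
by rewrite distrC (le_trans (doeblin_lim_dist _ _ bf fD))// (le_trans (ler_norm _)).
Qed.

Lemma doeblin_limD f g : bddm f -> bddm g -> ell (f \+ g) = ell f + ell g.
Proof.
move=> bf bg; apply: cvg_lim => //.
under eq_cvg do rewrite iter_markov_opD//.
by apply: cvgD; exact: doeblin_lim_cvg.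
Qed.

Lemma doeblin_limZ (c : R) f : bddm f -> ell (fun x => c * f x) = c * ell f.
Proof.
move=> bf; apply: cvg_lim => //.
under eq_cvg do rewrite iter_markov_opZ//.
by apply: cvgMr; exact: doeblin_lim_cvg.
Qed.

Lemma doeblin_lim_cst (c : R) : ell (cst c) = c.
Proof.
apply: cvg_lim => //; under eq_cvg do rewrite iter_markov_op_cst.
exact: cvg_cst.
Qed.

Lemma doeblin_lim_ge0 f : bddm f -> (forall x, 0 <= f x) -> 0 <= ell f.
Proof.
move=> bf f0; apply: limr_ge; first by apply/cvg_ex; exists (ell f); exact: doeblin_lim_cvg.
by apply: nearW => k; exact: iter_markov_op_geP.
Qed.

Lemma doeblin_lim_op f : bddm f -> ell (op f) = ell f.
Proof.
move=> bf; apply: cvg_lim => //.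
under eq_cvg do rewrite -iterSr.
have := doeblin_lim_cvg x0 bf.
by rewrite -(cvg_shiftS (fun k => iter k op f x0)).
Qed.

Lemma doeblin_lim_sum (I : Type) (s : seq I) (F : I -> X -> R) :
  (forall i, bddm (F i)) ->
  ell (fun x => \sum_(i <- s) F i x) = \sum_(i <- s) ell (F i).
Proof.
move=> bF; elim: s => [|i s ih].
  by under eq_fun do rewrite big_nil; rewrite big_nil doeblin_lim_cst.
under eq_fun do rewrite big_cons.
by rewrite big_cons -ih -doeblin_limD//; exact: bddm_sum.
Qed.

(** The distance from [ell] to the k-th iterate is uniform over functions bounded by [C]. Fixing one
    large [k] therefore reduces the claim to dominated convergence for that iterate at [x0]. *)
Lemma doeblin_lim_bounded_cvg (F : nat -> X -> R) f (C : R) :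
  (forall n, measurable_fun setT (F n)) -> measurable_fun setT f ->
  (forall n x, `|F n x| <= C) -> (forall x, F n x @[n --> \oo] --> f x) ->
  ell (F n) @[n --> \oo] --> ell f.
Proof.
move=> mF mf FC Ff.
have fC y : `|f y| <= C by apply: limr_norm_le (Ff y) => n.
have bF n : bddm (F n) by split => //; exists C.
have bf : bddm f by split => //; exists C.
apply/cvgrPdist_le => eps eps0.
have : doeblin_rate k * (C + C) @[k --> \oo] --> 0.
  by rewrite -(mul0r (C + C)); apply: cvgMl; exact: doeblin_rate_cvg.
have e3 : 0 < eps / 3 by rewrite divr_gt0.
move/cvgrPdist_le => /(_ _ e3)[k _ /(_ k (leqnn k))]; rewrite /= sub0r normrN => h.
have /cvgrPdist_le/(_ _ e3) := @iter_markov_op_bounded_cvg k F f C x0 mF mf FC Ff.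
apply: filterS => n hn.
have h1 := doeblin_lim_dist k x0 bf (osc_le_norm fC).
have h2 := doeblin_lim_dist k x0 (bF n) (osc_le_norm (FC n)).
move: h hn h1 h2; rewrite !ler_norml; set r := doeblin_rate k * _; set a := ell _; set b := ell _.
set c := iter k op f x0; set c' := iter k op (F n) x0.
by move=> /andP[_ h] /andP[? ?] /andP[? ?] /andP[? ?]; apply/andP; split; lra.
Qed.

(** A measure must be nonnegative on all sets, and for nonmeasurable [A] the value of [ell] has no
    known sign; hence the absolute value. *)
Definition doeblin_measure A : \bar R := `|ell \1_A|%:E.

Lemma doeblin_measureE A : measurable A -> doeblin_measure A = (ell \1_A)%:E.
Proof.
move=> mA; rewrite /doeblin_measure ger0_norm//; apply: doeblin_lim_ge0.
  exact: bddm_indic.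
by move=> x; rewrite indicE.
Qed.

Let doeblin_measure0 : doeblin_measure set0 = 0%E.
Proof. by rewrite doeblin_measureE// indic0 (doeblin_lim_cst 0). Qed.

Let doeblin_measure_ge0 A : (0 <= doeblin_measure A)%E.
Proof. by rewrite lee_fin. Qed.

Let doeblin_measure_sigma_additive : semi_sigma_additive doeblin_measure.
Proof.
move=> F mF tF mUF.
have sumE n : (\sum_(0 <= i < n) doeblin_measure (F i))%E =
    (ell (fun x => \sum_(0 <= i < n) \1_(F i) x))%:E.
  rewrite doeblin_lim_sum; last by move=> i; exact: bddm_indic.
  by rewrite -sumEFin; apply: eq_bigr => i _; rewrite doeblin_measureE.
under eq_fun do rewrite sumE.
rewrite doeblin_measureE//; apply: cvg_EFin; first exact: nearW.
(* At a fixed [x] the partial sums are those of the Dirac measure at [x]; its additivity gives both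
   the bound 1 and the pointwise convergence. *)
have dE n x : (\sum_(0 <= i < n) \1_(F i) x : R)%:E = (\sum_(0 <= i < n) \d_x (F i))%E.
  by rewrite -sumEFin; apply: eq_bigr => i _; rewrite diracE indicE.
apply: (@doeblin_lim_bounded_cvg _ _ 1).
- by move=> n; have [] := @bddm_sum _ _ _ _ (index_iota 0 n) (fun i => \1_(F i) : X -> R) (fun i => bddm_indic _ (mF i)).
- exact: measurable_indic.
- move=> n x; rewrite ger0_norm; last by apply: sumr_ge0 => i _; rewrite indicE.
  rewrite -lee_fin dE.
  rewrite big_mkord -(@measure_bigsetU _ _ _ (\d_x : {measure set X -> \bar R}))//.
  by apply: probability_le1; apply: bigsetU_measurable.
- move=> x; have := @measure_semi_sigma_additive _ _ _ (\d_x : {measure set X -> \bar R}) F mF tF mUF.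
  under eq_fun do rewrite -dE.
  by move=> H; have /fine_cvgP[_] : (\sum_(0 <= i < n) \1_(F i) x : R)%:E @[n --> \oo] -->
    (\1_(\bigcup_n F n) x : R)%:E by exact: H.
Qed.

HB.instance Definition _ := isMeasure.Build _ _ _ doeblin_measure
  doeblin_measure0 doeblin_measure_ge0 doeblin_measure_sigma_additive.

Let doeblin_measure_setT : doeblin_measure setT = 1%E.
Proof. by rewrite doeblin_measureE// indicT doeblin_lim_cst. Qed.

HB.instance Definition _ := Measure_isProbability.Build _ _ _
  doeblin_measure doeblin_measure_setT.

Import HBNNSimple.

Lemma doeblin_measure_nnsfun (h : {nnsfun X >-> R}) :
  \int[doeblin_measure]_y h y = ell h.
Proof.
have -> : (h : X -> R) =
    (fun x => \sum_(y <- finmap.enum_fset (fset_set (range h))) y * \1_(h @^-1` [set y]) x).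
  by apply/funext => x; rewrite [LHS]fimfunE fsbig_finite.
have bi y : bddm (\1_(h @^-1` [set y]) : X -> R) by apply: bddm_indic.
rewrite doeblin_lim_sum; last by move=> y; exact: bddmZ.
elim: (finmap.enum_fset _) => [|y s ih].
  by under eq_Rintegral do rewrite big_nil; rewrite big_nil Rintegral_cst// mul0r.
under eq_Rintegral do rewrite big_cons.
rewrite big_cons RintegralD//; last 2 first.
- by apply: bddm_integrable; [exact: probability_ltoo|exact: bddmZ].
- by apply: bddm_integrable; [exact: probability_ltoo|apply: bddm_sum => z; exact: bddmZ].
rewrite ih RintegralZl//; last by apply: bddm_integrable => //; exact: probability_ltoo.
congr (_ + _); rewrite doeblin_limZ//; congr (_ * _).
have mh : measurable (h @^-1` [set y]) by [].
by rewrite /Rintegral integral_indic// setIT -[ell _]/(fine (ell _)%:E) -doeblin_measureE.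
Qed.

Lemma Rintegral_doeblin_measure f : bddm f -> \int[doeblin_measure]_y f y = ell f.
Proof.
move=> bf; have [mf [C fC]] := bf.
wlog f0 : f bf mf C fC / forall x, 0 <= f x.
  move=> wl.
  have bC : bddm (f \+ cst C) by apply: bddmD => //; exact: bddm_cst.
  have [_ [C' C'P]] := bC.
  have := wl _ bC (proj1 bC) _ C'P.
  rewrite RintegralD//; last 2 first.
  - by apply: bddm_integrable => //; exact: probability_ltoo.
  - by apply: bddm_integrable; [exact: probability_ltoo|exact: bddm_cst].
  rewrite doeblin_limD//; last exact: bddm_cst.
  rewrite doeblin_lim_cst (Rintegral_probability_cst doeblin_measure).
  move=> h; apply: (addIr C); apply: h => x /=.
  by have := fC x; rewrite ler_norml => /andP[+ _]; rewrite -subr_ge0 opprK.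
have mE : measurable_fun setT (EFin \o f) by exact/measurable_EFinP.
pose h := nnsfun_approx measurableT mE.
have hf n x : h n x <= f x.
  by rewrite -lee_fin /h nnsfun_approxE; apply: le_approx => //= y _; rewrite lee_fin.
have hcvg x : h n x @[n --> \oo] --> f x.
  have : EFin \o h^~ x @ \oo --> (EFin \o f) x by apply: cvg_nnsfun_approx => // y _; rewrite lee_fin.
  by move/fine_cvgP => [_].
have hC n x : `|h n x| <= C.
  by rewrite ger0_norm// (le_trans (hf n x))// (le_trans (ler_norm _)).
have h1 : \int[doeblin_measure]_y h n y @[n --> \oo] --> \int[doeblin_measure]_y f y.
  by apply: (@bddm_Rint_bounded_cvg _ _ _ _ _ _ C) => //; exact: probability_ltoo.
have h2 : \int[doeblin_measure]_y h n y @[n --> \oo] --> ell f.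
  under eq_cvg do rewrite doeblin_measure_nnsfun.
  exact: (@doeblin_lim_bounded_cvg _ _ C).
by rewrite -(cvg_lim _ h1)// (cvg_lim _ h2).
Qed.

Theorem doeblin_invariant : exists mu : probability X R,
  (forall f D k x, bddm f -> osc_le f D ->
     `|iter k op f x - \int[mu]_y f y| <= doeblin_rate k * D) /\
  (forall f, bddm f -> \int[mu]_y op f y = \int[mu]_y f y).
Proof.
exists doeblin_measure; split => [f D k x bf fD|f bf].
  by rewrite Rintegral_doeblin_measure//; exact: doeblin_lim_dist.
by rewrite !Rintegral_doeblin_measure//; [exact: doeblin_lim_op|exact: markov_op_bddm].
Qed.

End doeblin.
End markov_operator.

(** * Mean ergodic theorem in L^2 *)

Lemma ge0_monotone_cvg d (X : measurableType d) (R : realType)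
    (P : {measure set X -> \bar R}) (u : nat -> X -> \bar R) (v : X -> \bar R) :
  (forall n, measurable_fun setT (u n)) -> (forall n x, 0 <= u n x)%E ->
  (forall x, nondecreasing_seq (u^~ x)) -> (forall x, u n x @[n --> \oo] --> v x) ->
  (\int[P]_x u n x @[n --> \oo] --> \int[P]_x v x)%E.
Proof.
move=> mu u0 ndu uv.
have -> : v = fun x => limn (u^~ x) by apply/funext => x; rewrite (cvg_lim _ (uv x)).
by apply: cvg_monotone_convergence => // x _; exact: ndu.
Qed.

Section square_integrable.
Context d (X : measurableType d) (R : realType) (P : probability X R).
Variable f : X -> R.
Hypothesis mf : measurable_fun setT f.
Hypothesis f2 : (\int[P]_x (f x ^+ 2)%:E < +oo)%E.

Lemma sqr_integrable : P.-integrable setT (fun x => (f x ^+ 2)%:E).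
Proof.
apply/integrableP; split; first by apply/measurable_EFinP; exact: measurable_funX.
by under eq_integral do rewrite gee0_abs ?lee_fin ?sqr_ge0//.
Qed.

Lemma integrable_of_sqr : P.-integrable setT (EFin \o f).
Proof.
apply: (@le_integrable _ _ _ P setT measurableT _ (fun x => (1 + f x ^+ 2)%:E)) => //.
- exact/measurable_EFinP.
- move=> x _ /=; rewrite lee_fin [leRHS]ger0_norm ?addr_ge0 ?sqr_ge0// ler_norml.
  by apply/andP; split; nra.
- under eq_fun do rewrite EFinD.
  apply: integrableD => //; last exact: sqr_integrable.
  have H : P.-integrable setT (EFin \o cst 1%R).
    by apply: bddm_integrable; [exact: probability_ltoo|exact: bddm_cst].
  exact: H.
Qed.

(** Jensen by the tangent line at the mean [c]: f^2 >= 2 c f - c^2, and the right-hand side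
    integrates to c^2. *)
Lemma sqr_Rintegral_le : (((\int[P]_x f x) ^+ 2)%R%:E <= \int[P]_x (f x ^+ 2)%:E)%E.
Proof.
set c := Rintegral _ _ _.
have -> : (\int[P]_x (f x ^+ 2)%:E)%E = (\int[P]_x (f x ^+ 2))%:E.
  by rewrite fineK//; apply: integrable_fin_num => //; exact: sqr_integrable.
have ic : P.-integrable setT (EFin \o cst (- c ^+ 2)).
  by apply: bddm_integrable; [exact: probability_ltoo|exact: bddm_cst].
have icf : P.-integrable setT (EFin \o (fun x => 2 * c * f x)).
  exact: (integrableZl measurableT (2 * c) integrable_of_sqr).
rewrite lee_fin.
have : \int[P]_x (2 * c * f x + cst (- c ^+ 2) x) <= \int[P]_x (f x ^+ 2).
  apply: le_Rintegral => //.
  - have := integrableD measurableT icf ic; exact.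
  - exact: sqr_integrable.
  - by move=> x _ /=; have := sqr_ge0 (f x - c); nra.
rewrite RintegralD// RintegralZl//; last exact: integrable_of_sqr.
rewrite Rintegral_probability_cst -/c; nra.
Qed.

End square_integrable.

Lemma Rintegral_norm_le d (X : measurableType d) (R : realType) (P : probability X R)
    (f : X -> R) (C : R) :
  measurable_fun setT f -> (forall x, `|f x| <= C) -> `|\int[P]_x f x| <= C.
Proof.
move=> mf fC; have bf : bddm f by split => //; exists C.
have i1 (g : X -> R) : bddm g -> P.-integrable setT (EFin \o g).
  by apply: bddm_integrable; exact: probability_ltoo.
rewrite ler_norml -[in leLHS](Rintegral_probability_cst P (- C)).
rewrite -[in X in _ && (_ <= X)](Rintegral_probability_cst P C).
apply/andP; split; apply: le_Rintegral => //; try exact/i1/bddm_cst; try exact: i1;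
  by move=> x _ /=; have := fC x; rewrite ler_norml => /andP[].
Qed.

Section cesaro_L2.
Context d (X : measurableType d) (R : realType).
Variables (m : nat -> X -> probability X R) (mu : probability X R) (rate : nat -> R).
Hypothesis mm : forall k A, measurable A -> measurable_fun setT (fun y => m k y A).
Hypothesis m_inv : forall k (f : X -> R), bddm f ->
  \int[mu]_y (\int[m k y]_z f z) = \int[mu]_y f y.
Hypothesis m_rate : forall (f : X -> R) D k y, bddm f -> osc_le f D ->
  `|\int[m k y]_z f z - \int[mu]_z f z| <= rate k * D.
Hypothesis rate_cvg : rate k @[k --> \oo] --> 0.

(** Squared tails of an L^2 function are unbounded, so invariance has to leave the class [bddm]; the
    truncations [h n] increase to [g], and monotone convergence applies on both sides. *)
Lemma invariant_ge0 k (g : X -> R) : measurable_fun setT g -> (forall x, 0 <= g x) ->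
  (\int[mu]_y \int[m k y]_z (g z)%:E = \int[mu]_y (g y)%:E)%E.
Proof.
move=> mg g0.
pose h n x := Num.min (g x) n%:R.
have h0 n x : 0 <= h n x by rewrite le_min g0 ler0n.
have mh n : measurable_fun setT (h n) by apply: measurable_minr.
have bh n : bddm (h n).
  by split => //; exists n%:R => x; rewrite ger0_norm// ge_min lexx orbT.
have mEh n : measurable_fun setT (fun x => (h n x)%:E) by apply/measurable_EFinP.
have ndh x : nondecreasing_seq (fun n => (h n x)%:E).
  move=> a b ab; rewrite lee_fin le_min ge_min lexx /= ge_min ler_nat ab orbT//.
have hg x : (h n x)%:E @[n --> \oo] --> (g x)%:E.
  apply: cvg_near_cst; exists (Num.bound (g x)) => // n /= bn.
  have -> // : h n x = g x; apply/min_idPl.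
  rewrite (le_trans (ltW (archi_boundP (g0 x))))// ler_nat//.
have c1 y : (\int[m k y]_z (h n z)%:E @[n --> \oo] --> \int[m k y]_z (g z)%:E)%E.
  by apply: ge0_monotone_cvg => // n x; rewrite lee_fin.
have c2 : (\int[mu]_z (h n z)%:E @[n --> \oo] --> \int[mu]_z (g z)%:E)%E.
  by apply: ge0_monotone_cvg => // n x; rewrite lee_fin.
have c3 : (\int[mu]_y \int[m k y]_z (h n z)%:E @[n --> \oo] -->
    \int[mu]_y \int[m k y]_z (g z)%:E)%E.
  apply: ge0_monotone_cvg => //.
  - move=> n; apply: measurable_fun_integral_kernel => //; first exact: mm.
    by move=> z; rewrite lee_fin.
  - by move=> n x; apply: integral_ge0 => z _; rewrite lee_fin.
  - move=> x a b ab; apply: ge0_le_integral => // z _; rewrite ?lee_fin//.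
    by have := ndh z _ _ ab; rewrite lee_fin.
have E n : (\int[mu]_y \int[m k y]_z (h n z)%:E = \int[mu]_z (h n z)%:E)%E.
  rewrite -[RHS](bddm_fine _ (bh n)) ?probability_ltoo// -(m_inv k (bh n)).
  have [_ [C hC]] := bh n.
  rewrite bddm_fine ?probability_ltoo//; last first.
    split; last by exists C => y; apply: Rintegral_norm_le.
    by apply: measurableT_comp => //; apply: measurable_fun_integral_kernel => //;
      [exact: mm|move=> z; rewrite lee_fin].
  by apply: eq_integral => y _; rewrite bddm_fine ?probability_ltoo.
rewrite -(cvg_lim _ c3)//; under eq_fun do rewrite E.
by rewrite (cvg_lim _ c2).
Qed.

Lemma measurable_transition k (f : X -> R) : measurable_fun setT f ->
  measurable_fun setT (fun y => \int[m k y]_z f z).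
Proof.
move=> mf; apply: measurableT_comp => //.
have mE : measurable_fun setT (EFin \o f) by exact/measurable_EFinP.
have -> : (fun y => \int[m k y]_z (f z)%:E)%E =
    (fun y => \int[m k y]_z (EFin \o f)^\+ z - \int[m k y]_z (EFin \o f)^\- z)%E.
  by apply/funext => y; rewrite [LHS]integralE.
by apply: emeasurable_funB; apply: measurable_fun_integral_kernel => //;
  [exact: mm|exact: measurable_funepos|exact: mm|exact: measurable_funeneg].
Qed.

Lemma sqr_mean_le (M : nat) (x : nat -> R) : (0 < M)%N ->
  (M%:R^-1 * \sum_(k < M) x k) ^+ 2 <= M%:R^-1 * \sum_(k < M) x k ^+ 2.
Proof.
move=> M0; have M1 : 0 < M%:R :> R by rewrite ltr0n.
set c := M%:R^-1 * _.
have Mc : \sum_(k < M) x k = M%:R * c by rewrite /c mulVKf// gt_eqF.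
have : 0 <= \sum_(k < M) (x k - c) ^+ 2 by apply: sumr_ge0 => k _; exact: sqr_ge0.
rewrite (eq_bigr (fun k : 'I_M => x k ^+ 2 + - (2 * c) * x k + c ^+ 2)); last first.
  by move=> k _; ring.
rewrite !big_split /= -mulr_sumr sumr_const card_ord -mulr_natl Mc => h.
rewrite ler_pdivlMl//; move: h; nra.
Qed.

Variable phi : X -> R.
Hypothesis mphi : measurable_fun setT phi.
Hypothesis phi2 : (\int[mu]_x (phi x ^+ 2)%:E < +oo)%E.

Let tail (n : nat) x := if n%:R < `|phi x| then phi x else 0.

Let measurable_tail n : measurable_fun setT (tail n).
Proof.
apply: measurable_fun_ifT => //; apply: measurable_fun_ltr => //.
exact: measurableT_comp.
Qed.

Let tail_le n x : tail n x ^+ 2 <= phi x ^+ 2.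
Proof. by rewrite /tail; case: ifP => // _; rewrite expr0n sqr_ge0. Qed.

Lemma sqr_tail_small (eps : R) : 0 < eps ->
  exists n, (\int[mu]_x (tail n x ^+ 2)%:E <= eps%:E)%E.
Proof.
move=> eps0.
have : (\int[mu]_x (tail n x ^+ 2)%:E @[n --> \oo] --> \int[mu]_x (cst 0%R x)%:E)%E.
  apply: (@dominated_cvg _ _ _ mu setT measurableT _ _ (fun x => (phi x ^+ 2)%:E)) => //.
  - by move=> n; apply/measurable_EFinP; exact: measurable_funX.
  - move=> x _; apply: cvg_near_cst; exists (Num.bound `|phi x|) => // n /= bn.
    have -> : tail n x = 0; last by rewrite expr0n.
    rewrite /tail ltNge (le_trans (ltW (archi_boundP (normr_ge0 _))))// ler_nat//.
  - exact: sqr_integrable.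
  - by move=> n x _; rewrite gee0_abs lee_fin ?sqr_ge0.
rewrite integral0 => /fine_cvgP[fin /cvgrPdist_le/(_ _ eps0) le].
case: fin => n1 _ fin; case: le => n2 _ le.
have nf := fin (maxn n1 n2) (leq_maxl _ _); have ne := le (maxn n1 n2) (leq_maxr _ _).
move: (maxn n1 n2) nf ne => n /= nf ne.
exists n; rewrite -(fineK nf) lee_fin; apply: le_trans ne.
by rewrite sub0r normrN ler_norm.
Qed.

Let dev M y := M%:R^-1 * (\sum_(k < M) \int[m k y]_z phi z) - \int[mu]_z phi z.

Lemma measurable_dev M : measurable_fun setT (dev M).
Proof.
apply: measurable_funB => //; apply: measurable_funM => //.
by apply: measurable_sum => k; exact: measurable_transition.
Qed.

(** The part of [phi] bounded by [n] has oscillation at most 2n and obeys the uniform rate. The tail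
    obeys no rate: Jensen leaves its square under the kernels. Using (a + b)^2 <= 2 a^2 + 2 b^2 for
    [A + B] and again inside [B] produces the factors 2 and 4. *)
Lemma sqr_dev_le n (eps : R) M y : (0 < M)%N ->
  (\int[mu]_x (tail n x ^+ 2)%:E <= eps%:E)%E ->
  ((dev M y ^+ 2)%:E <=
   (2 * (M%:R^-1 * \sum_(k < M) rate k * (n%:R + n%:R)) ^+ 2 + 4 * eps)%:E +
   (4 / M%:R)%:E * \sum_(k < M) \int[m k y]_z (tail n z ^+ 2)%:E)%E.
Proof.
move=> M0 he; have M1 : 0 < M%:R :> R by rewrite ltr0n.
set S := fun k => (\int[m k y]_z (tail n z ^+ 2)%:E)%E.
have S0 k : (0 <= S k)%E by apply: integral_ge0 => z _; rewrite lee_fin sqr_ge0.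
(* If some [S k] is infinite, [phi] need not be integrable under [m k y] and its [Rintegral] says
   nothing; but then the right-hand side is infinite. *)
have [Sfin|] := pselect (forall k, (k < M)%N -> (S k < +oo)%E); last first.
  move=> /existsNP[k /not_implyP[kM /negP]]; rewrite -leNgt leye_eq => /eqP Sk.
  have Soo : (\sum_(k < M) S k = +oo)%E.
    rewrite (bigD1 (Ordinal kM)) //= Sk addye// gt_eqF//.
    by rewrite (@lt_le_trans _ _ 0%E)// sume_ge0.
  have -> : (\sum_(k < M) \int[m k y]_z (tail n z ^+ 2)%:E = +oo)%E by exact: Soo.
  by rewrite gt0_muley ?addey ?leey// lte_fin divr_gt0.
pose g x := phi x - tail n x.
have mg : measurable_fun setT g by exact: measurable_funB.
have gn x : `|g x| <= n%:R.
  by rewrite /g /tail; case: ltP => [_|//]; rewrite ?subrr ?normr0 ?subr0.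
have bg : bddm g by split => //; exists n%:R.
have phiE : phi = g \+ tail n by apply/funext => x; rewrite /g /= subrK.
have splitP (P : probability X R) : (\int[P]_x (tail n x ^+ 2)%:E < +oo)%E ->
    \int[P]_x phi x = \int[P]_x g x + \int[P]_x tail n x.
  move=> fin; rewrite {1}phiE RintegralD//; last exact: integrable_of_sqr.
  by apply: bddm_integrable => //; exact: probability_ltoo.
have epsoo : (\int[mu]_x (tail n x ^+ 2)%:E < +oo)%E by rewrite (le_lt_trans he) ?ltry.
have mt := sqr_Rintegral_le (measurable_tail n) epsoo.
have {}mt : (\int[mu]_x tail n x) ^+ 2 <= eps by rewrite -lee_fin (le_trans mt).
pose s k := fine (S k).
have SE k : (k < M)%N -> S k = (s k)%:E.
  by move=> kM; rewrite fineK// ge0_fin_numE// Sfin.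
have ht k : (k < M)%N -> (\int[m k y]_z tail n z) ^+ 2 <= s k.
  by move=> kM; rewrite -lee_fin -SE//; apply: sqr_Rintegral_le => //; exact: Sfin.
have -> : (\sum_(k < M) \int[m k y]_z (tail n z ^+ 2)%:E = (\sum_(k < M) s k)%:E)%E.
  by rewrite -sumEFin; apply: eq_bigr => k _; exact: SE.
rewrite -EFinM -EFinD lee_fin.
set a := M%:R^-1 * _.
pose A := M%:R^-1 * \sum_(k < M) (\int[m k y]_z g z - \int[mu]_z g z).
pose B := M%:R^-1 * \sum_(k < M) (\int[m k y]_z tail n z - \int[mu]_z tail n z).
have mean_cst (c : R) : M%:R^-1 * \sum_(k < M) c = c.
  by rewrite sumr_const card_ord -[c *+ M]mulr_natl mulKf// gt_eqF.
have devE : dev M y = A + B.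
  rewrite /dev /A /B !sumrB !mulrBr !mean_cst splitP//.
  under eq_bigr => k _ do rewrite splitP ?Sfin//.
  by rewrite big_split /= mulrDr; ring.
have Aa : `|A| <= a.
  rewrite normrM ger0_norm ?invr_ge0// ler_wpM2l ?invr_ge0//.
  apply: le_trans (ler_norm_sum _ _ _) _; apply: ler_sum => k _.
  by apply: m_rate => //; exact: osc_le_norm.
have BB : B ^+ 2 <= 2 * eps + 2 * (M%:R^-1 * \sum_(k < M) s k).
  apply: le_trans (sqr_mean_le (fun k => \int[m k y]_z tail n z - \int[mu]_z tail n z) M0) _.
  rewrite -{1}(mean_cst (2 * eps)) mulrCA -mulrDr ler_wpM2l ?invr_ge0//.
  rewrite mulr_sumr -big_split /=; apply: ler_sum => k _.
  move: (ht k (ltn_ord k)) mt; set p := Rintegral _ _ _; set q := Rintegral _ _ _.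
  by have := sqr_ge0 (p + q); nra.
have A2 : A ^+ 2 <= a ^+ 2.
  by move: Aa; rewrite ler_norml => /andP[]; nra.
rewrite devE -mulrA; move: A2 BB; have := sqr_ge0 (A - B).
by set r := M%:R^-1 * _; nra.
Qed.

Theorem cesaro_L2 : ('N[mu]_2%:E[EFin \o dev M] @[M --> \oo] --> 0)%E.
Proof.
have key (eps : R) : 0 < eps -> \forall M \near \oo,
    (\int[mu]_y (dev M y ^+ 2)%:E <= (eps ^+ 2)%:E)%E.
  move=> eps0.
  (* Budget: with |a| <= eps / 10, the three contributions are 2 a^2 <= eps^2 / 50 and twice 4 eps^2
     / 10, in total less than eps^2. *)
  have e10 : 0 < eps ^+ 2 / 10 by rewrite divr_gt0 ?exprn_gt0.
  have [n hn] := sqr_tail_small e10.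
  have cr : rate k * (n%:R + n%:R) @[k --> \oo] --> 0.
    by rewrite -(mul0r (n%:R + n%:R)); apply: cvgMl.
  have := cesaro cr.
  have e4 : 0 < eps / 10 by rewrite divr_gt0.
  move=> /cvgrPdist_le/(_ _ e4)[M0 _ hM].
  (* [arithmetic_mean] at index [M] averages [M.+1] terms, hence the shift, which also excludes the
     empty mean. *)
  exists M0.+1 => // -[//|M] /= MM.
  have {hM} := hM M MM; rewrite sub0r normrN /arithmetic_mean /series /=.
  rewrite big_mkord; set a := _ * _ => ha.
  have S0 k y : (0 <= \int[m k y]_z (tail n z ^+ 2)%:E)%E.
    by apply: integral_ge0 => z _; rewrite lee_fin sqr_ge0.
  have mS1 k : measurable_fun setT (fun y => \int[m k y]_z (tail n z ^+ 2)%:E)%E.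
    apply: measurable_fun_integral_kernel; first exact: mm.
      by move=> z; rewrite lee_fin sqr_ge0.
    by apply/measurable_EFinP; exact: measurable_funX.
  have mS : measurable_fun setT
      (fun y => \sum_(k < M.+1) \int[m k y]_z (tail n z ^+ 2)%:E)%E.
    by apply: emeasurable_sum.
  apply: (@le_trans _ _ (\int[mu]_y ((2 * a ^+ 2 + 4 * (eps ^+ 2 / 10))%:E +
     (4 / M.+1%:R)%:E * \sum_(k < M.+1) \int[m k y]_z (tail n z ^+ 2)%:E))%E).
    apply: ge0_le_integral => //.
    - by move=> y _; rewrite lee_fin sqr_ge0.
    - by apply/measurable_EFinP; apply: measurable_funX; exact: measurable_dev.
    - by apply: emeasurable_funD => //; apply: measurable_funeM; exact: mS.
    - by move=> y _; exact: sqr_dev_le.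
  rewrite ge0_integralD//; last 3 first.
  - by move=> y _; rewrite lee_fin; have := sqr_ge0 a; move: e10; lra.
  - by move=> y _; rewrite mule_ge0 ?lee_fin ?divr_ge0// sume_ge0.
  - by apply: measurable_funeM; exact: mS.
  have -> : (\int[mu]__ (2 * a ^+ 2 + 4 * (eps ^+ 2 / 10))%:E =
      (2 * a ^+ 2 + 4 * (eps ^+ 2 / 10))%:E)%E.
    by rewrite -[RHS]mule1 -(probability_setT mu) -integral_cst.
  rewrite ge0_integralZl_EFin//; last first.
    by move=> y _; rewrite sume_ge0.
  rewrite ge0_integral_sum//.
  (* Integration against [mu] turns every kernel average of the squared tail into the same integral,
     whatever [k], so the tails are small without any rate. *)
  rewrite (eq_bigr (fun=> \int[mu]_x (tail n x ^+ 2)%:E)%E); last first.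
    move=> k _; apply: invariant_ge0 => [|x]; last exact: sqr_ge0.
    exact: measurable_funX.
  apply: (@le_trans _ _ ((2 * a ^+ 2 + 4 * (eps ^+ 2 / 10))%:E +
      (4 / M.+1%:R)%:E * \sum_(k < M.+1) (eps ^+ 2 / 10)%:E)%E).
    by rewrite leeD2l// lee_wpmul2l ?lee_fin ?divr_ge0//; apply: lee_sum.
  rewrite sumEFin -EFinM -EFinD lee_fin sumr_const card_ord -[(eps ^+ 2 / 10) *+ M.+1]mulr_natl.
  have -> : 4 / M.+1%:R * (M.+1%:R * (eps ^+ 2 / 10)) = 4 * (eps ^+ 2 / 10).
    by rewrite [LHS]mulrA divfK ?pnatr_eq0.
  by move: ha; rewrite ler_norml => /andP[]; nra.
have sqrtE (eps : R) : 0 < eps -> ((eps ^+ 2)%:E `^ 2^-1 = eps%:E)%E.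
  move=> e0; rewrite poweR_EFin powR12_sqrt ?sqr_ge0//.
  by rewrite sqrtr_sqr gtr0_norm.
have normE M : ('N[mu]_2%:E[EFin \o dev M] = (\int[mu]_y (dev M y ^+ 2)%:E) `^ 2^-1)%E.
  rewrite unlock; congr (_ `^ _)%E; apply: eq_integral => y _.
  by rewrite /= (@powR_mulrn _ _ 2)// real_normK ?num_real.
have small (eps : R) : 0 < eps -> \forall M \near \oo,
    ('N[mu]_2%:E[EFin \o dev M] <= eps%:E)%E.
  move=> e0; have := key eps e0; apply: filterS => M hM.
  rewrite normE -(sqrtE eps e0); apply: gt0_ler_poweR => //.
  - by rewrite in_itv /= leey andbT integral_ge0// => y _; rewrite lee_fin sqr_ge0.
  - by rewrite in_itv /= leey andbT lee_fin sqr_ge0.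
apply/fine_cvgP; split.
  have := small 1 ltr01; apply: filterS => M hM.
  by rewrite ge0_fin_numE ?Lnorm_ge0// (le_lt_trans hM) ?ltry.
apply/cvgrPdist_le => eps e0; have := small eps e0; apply: filterS => M hM.
rewrite sub0r normrN /= ger0_norm ?fine_ge0 ?Lnorm_ge0//.
rewrite -lee_fin fineK// ge0_fin_numE ?Lnorm_ge0//.
by rewrite (le_lt_trans hM) ?ltry.
Qed.

End cesaro_L2.

(** * Sine sums on the unit interval *)

Section unit_interval_integral.
Context {R : realType}.
Implicit Types f g : R -> R.

Definition int01 f : R := \int[lebesgue_measure]_(x in `[0 : R, 1]) f x.

Lemma cont_integrable01 f : continuous f ->
  lebesgue_measure.-integrable `[0 : R, 1] (EFin \o f).
Proof.
move=> cf; apply: continuous_compact_integrable; first exact: segment_compact.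
exact: continuous_subspaceT.
Qed.

Lemma int01D f g : continuous f -> continuous g ->
  int01 (fun x => f x + g x) = int01 f + int01 g.
Proof. by move=> cf cg; rewrite /int01 RintegralD//; exact: cont_integrable01. Qed.

Lemma int01B f g : continuous f -> continuous g ->
  int01 (fun x => f x - g x) = int01 f - int01 g.
Proof. by move=> cf cg; rewrite /int01 RintegralB//; exact: cont_integrable01. Qed.

Lemma int01Z c f : continuous f -> int01 (fun x => c * f x) = c * int01 f.
Proof. by move=> cf; rewrite /int01 RintegralZl//; exact: cont_integrable01. Qed.

Lemma int01_le f g : continuous f -> continuous g -> (forall x, f x <= g x) ->
  int01 f <= int01 g.
Proof.
by move=> cf cg fg; apply: le_Rintegral => //; exact: cont_integrable01.
Qed.

Lemma int01_cst (c : R) : int01 (cst c) = c.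
Proof.
by rewrite /int01 Rintegral_cst//= lebesgue_measure_itv/= lte_fin ltr01 /= subr0 mulr1.
Qed.

Lemma cont_mul f g : continuous f -> continuous g -> continuous (fun x => f x * g x).
Proof. by move=> cf cg x; apply: cvgM; [exact: cf|exact: cg]. Qed.

Lemma cont_add f g : continuous f -> continuous g -> continuous (fun x => f x + g x).
Proof. by move=> cf cg x; apply: cvgD; [exact: cf|exact: cg]. Qed.

Lemma cont_sub f g : continuous f -> continuous g -> continuous (fun x => f x - g x).
Proof. by move=> cf cg x; apply: cvgB; [exact: cf|exact: cg]. Qed.

Lemma cont_mulc c f : continuous f -> continuous (fun x => c * f x).
Proof. by move=> cf x; apply: cvgMr; exact: cf. Qed.

Lemma cont_sqr f : continuous f -> continuous (fun x => f x ^+ 2).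
Proof. by move=> cf; under eq_fun do rewrite expr2; exact: cont_mul. Qed.

Lemma continuous_sumr (I : Type) (s : seq I) (F : I -> R -> R) :
  (forall i, continuous (F i)) -> continuous (fun x => \sum_(i <- s) F i x).
Proof.
move=> cF; elim: s => [|i s ih] x.
  by under eq_fun do rewrite big_nil; exact: cst_continuous.
by under eq_fun do rewrite big_cons; apply: continuousD; [exact: cF|exact: ih].
Qed.

Lemma int01_sum (I : Type) (s : seq I) (F : I -> R -> R) :
  (forall i, continuous (F i)) ->
  int01 (fun x => \sum_(i <- s) F i x) = \sum_(i <- s) int01 (F i).
Proof.
move=> cF; elim: s => [|i s ih].
  by under [in LHS]eq_fun do rewrite big_nil; rewrite big_nil (int01_cst 0).
under [in LHS]eq_fun do rewrite big_cons.
by rewrite big_cons int01D ?ih//; exact: continuous_sumr.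
Qed.

Lemma cont_scale_sin (c : R) : continuous (fun x => sin (c * x)).
Proof.
move=> x; apply: (@continuous_comp _ _ _ (fun y => c * y) (@sin R)).
  by apply: continuousM; [exact: cst_continuous|exact: id].
exact: continuous_sin.
Qed.

Lemma cont_scale_cos (c : R) : continuous (fun x => cos (c * x)).
Proof.
move=> x; apply: (@continuous_comp _ _ _ (fun y => c * y) (@cos R)).
  by apply: continuousM; [exact: cst_continuous|exact: id].
exact: continuous_cos.
Qed.

Lemma is_derive_mulc (c x : R) f (df : R) :
  is_derive x 1 f df -> is_derive x 1 (fun y => c * f y) (c * df).
Proof. exact: is_deriveZ. Qed.

Lemma is_derive_scale (c x : R) : is_derive x 1 (fun y : R => c * y) c.
Proof. by have := is_derive_mulc c (is_derive_id x (1 : R)); rewrite mulr1. Qed.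

Lemma is_derive_fsum n (F : 'I_n -> R -> R) (dF : 'I_n -> R) (x : R) :
  (forall i, is_derive x 1 (F i) (dF i)) ->
  is_derive x 1 (fun y => \sum_(i < n) F i y) (\sum_(i < n) dF i).
Proof.
move=> h; have -> : (fun y => \sum_(i < n) F i y) = \sum_(i < n) F i.
  by apply/funext => y; rewrite fct_sumE.
exact: is_derive_sum.
Qed.

Lemma is_derive_scale_sin (c x : R) :
  is_derive x 1 (fun y => sin (c * y)) (c * cos (c * x)).
Proof.
have := @is_derive1_comp _ (@sin R) (fun y => c * y) x _ _ (is_derive_sin (c * x)) (is_derive_scale c x).
by rewrite mulrC.
Qed.

Lemma is_derive_scale_cos (c x : R) :
  is_derive x 1 (fun y => cos (c * y)) (- (c * sin (c * x))).
Proof.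
have := @is_derive1_comp _ (@cos R) (fun y => c * y) x _ _ (is_derive_cos (c * x)) (is_derive_scale c x).
by rewrite mulNr mulrC.
Qed.

Lemma int01_cos (c : R) : c != 0 -> sin c = 0 -> int01 (fun x => cos (c * x)) = 0.
Proof.
move=> c0 sc.
have dF (x : R) : is_derive x 1 (fun y : R => c^-1 * sin (c * y)) (cos (c * x)).
  by have := is_derive_mulc c^-1 (is_derive_scale_sin c x); rewrite mulKf.
have cF : continuous (fun y : R => c^-1 * sin (c * y)).
  by apply: cont_mulc; exact: cont_scale_sin.
rewrite /int01 /Rintegral (@continuous_FTC2 _ _ (fun y => c^-1 * sin (c * y)) 0 1)//=.
- by rewrite mulr1 mulr0 sin0 sc subrr.
- by apply: continuous_subspaceT; exact: cont_scale_cos.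
- split.
  + by move=> x _; have [] := dF x.
  + by apply: cvg_at_right_filter; exact: cF.
  + by apply: cvg_at_left_filter; exact: cF.
- by move=> x _; rewrite derive1E; have [_ ->] := dF x.
Qed.

Lemma sin_natmul_pi (n : nat) : sin (n%:R * pi) = 0 :> R.
Proof.
elim: n => [|n ih]; first by rewrite mul0r sin0.
by rewrite -natr1 mulrDl mul1r sinDpi ih oppr0.
Qed.

Definition esin (m : nat) (x : R) : R := Num.sqrt 2 * sin (m%:R * pi * x).

Lemma cont_esin m : continuous (esin m).
Proof. by apply: cont_mulc; exact: cont_scale_sin. Qed.

Lemma esin_orthonormal j k : (0 < j)%N -> (0 < k)%N ->
  int01 (fun x => esin j x * esin k x) = (j == k)%:R.
Proof.
move=> j0 k0.
have E x : esin j x * esin k x =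
    cos ((j%:R * pi - k%:R * pi) * x) + (- 1) * cos ((j%:R * pi + k%:R * pi) * x).
  rewrite /esin mulrBl cosB mulrDl cosD mulrACA -expr2 sqr_sqrtr//; ring.
under [in LHS]eq_fun do rewrite E.
rewrite int01D; [|exact: cont_scale_cos|by apply: cont_mulc; exact: cont_scale_cos].
rewrite int01Z; last exact: cont_scale_cos.
have pi0 : (pi : R) != 0 by rewrite gt_eqF// pi_gt0.
rewrite (@int01_cos (j%:R * pi + k%:R * pi)); last 2 first.
- by rewrite -mulrDl mulf_neq0// -natrD pnatr_eq0 addn_eq0 negb_and -!lt0n j0.
- by rewrite -mulrDl -natrD sin_natmul_pi.
rewrite mulr0 addr0; have [->|jk] := eqVneq j k.
  rewrite subrr (_ : (fun x => cos (0 * x)) = cst 1) ?int01_cst//.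
  by apply/funext => x; rewrite mul0r cos0.
rewrite int01_cos//.
- by rewrite -mulrBl mulf_neq0// subr_eq0 eqr_nat.
- by rewrite sinB !sin_natmul_pi mul0r mulr0 subrr.
Qed.

Section sine_series.
Variable N : nat.
Implicit Types c : 'I_N -> R.

Definition sine_sum c x := \sum_(m < N) c m * esin m.+1 x.

Lemma cont_sine_sum c : continuous (sine_sum c).
Proof.
by apply: continuous_sumr => m; apply: cont_mulc; exact: cont_esin.
Qed.

Lemma sine_sumB c c' x : sine_sum (fun m => c m - c' m) x = sine_sum c x - sine_sum c' x.
Proof. by rewrite /sine_sum -sumrB; apply: eq_bigr => m _; rewrite mulrBl. Qed.

Lemma int01_mul_sine_sum g c : continuous g ->
  int01 (fun x => g x * sine_sum c x) = \sum_(m < N) c m * int01 (fun x => g x * esin m.+1 x).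
Proof.
move=> cg; under [in LHS]eq_fun do rewrite mulr_sumr.
rewrite int01_sum; last first.
  by move=> m; apply: cont_mul => //; apply: cont_mulc; exact: cont_esin.
apply: eq_bigr => m _; under [in LHS]eq_fun do rewrite mulrCA.
by rewrite int01Z//; apply: cont_mul => //; exact: cont_esin.
Qed.

Lemma int01_sine_sum_esin c (m : 'I_N) :
  int01 (fun x => esin m.+1 x * sine_sum c x) = c m.
Proof.
rewrite int01_mul_sine_sum; last exact: cont_esin.
rewrite (bigD1 m)//= esin_orthonormal// eqxx mulr1 big1 ?addr0// => i im.
by rewrite esin_orthonormal// eqSS eq_sym -[_ == _]/(i == m) (negbTE im) mulr0.
Qed.

Lemma int01_sine_sum_mul c c' :
  int01 (fun x => sine_sum c x * sine_sum c' x) = \sum_(m < N) c m * c' m.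
Proof.
rewrite int01_mul_sine_sum; last exact: cont_sine_sum.
apply: eq_bigr => m _; under [in LHS]eq_fun do rewrite mulrC.
by rewrite int01_sine_sum_esin mulrC.
Qed.

Lemma sine_sum_derive1n2 c x :
  derive1n 2 (sine_sum c) x = sine_sum (fun m => - (m.+1%:R * pi) ^+ 2 * c m) x.
Proof.
have d1 : derive1 (sine_sum c) = (fun x => \sum_(m < N)
    c m * (Num.sqrt 2 * (m.+1%:R * pi * cos (m.+1%:R * pi * x)))).
  apply/funext => y; rewrite derive1E; apply: derive_val.
  by apply: is_derive_fsum => m; do 2 apply: is_derive_mulc; exact: is_derive_scale_sin.
rewrite /derive1n /= d1 derive1E.
have dd : is_derive x 1 (fun x => \sum_(m < N)
    c m * (Num.sqrt 2 * (m.+1%:R * pi * cos (m.+1%:R * pi * x))))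
    (\sum_(m < N) c m * (Num.sqrt 2 * (m.+1%:R * pi * - (m.+1%:R * pi * sin (m.+1%:R * pi * x))))).
  by apply: is_derive_fsum => m; do 3 apply: is_derive_mulc; exact: is_derive_scale_cos.
rewrite (@derive_val _ _ _ _ _ _ _ dd); apply: eq_bigr => m _.
by rewrite /esin; ring.
Qed.

End sine_series.
End unit_interval_integral.

(** * The implicit step in coordinates *)

Section coordinate_map.
Context {R : realType}.
Variable N : nat.
Implicit Types (a u v : VN R N) (m : 'I_N) (s : bool).

Definition coord a (j : 'I_N * bool) : R :=
  if j.2 then (tnth a j.1).2 else (tnth a j.1).1.

Definition of_coord (f : 'I_N * bool -> R) : VN R N :=
  [tuple (f (m, false), f (m, true)) | m < N].

Lemma of_coordK f j : coord (of_coord f) j = f j.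
Proof. by case: j => m []; rewrite /coord /of_coord tnth_mktuple. Qed.

Lemma coord_inj a b : (forall j, coord a j = coord b j) -> a = b.
Proof.
move=> ab; apply: eq_from_tnth => m; have := ab (m, false); have := ab (m, true).
by rewrite /coord /=; case: (tnth a m) (tnth b m) => [? ?] [? ?] /= -> ->.
Qed.

Definition field a s : R -> R := sine_sum (fun m => coord a (m, s)).

Lemma cont_field a s : continuous (field a s).
Proof. exact: cont_sine_sum. Qed.

Lemma coord_sum (F : 'I_N * bool -> R) :
  \sum_j F j = \sum_(m < N) (F (m, false) + F (m, true)).
Proof.
transitivity (\sum_(m < N) \sum_(s : bool) F (m, s)).
  by rewrite pair_bigA; apply: eq_bigr => -[].
by apply: eq_bigr => m _; rewrite big_bool addrC.
Qed.

Variables (c tau lambda : R).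

(* [dens] is (|u|^2 + |c v|^2) / 2. *)
Definition dens v u x :=
  (field u false x ^+ 2 + field u true x ^+ 2 +
   ((c * field v false x) ^+ 2 + (c * field v true x) ^+ 2)) / 2.

Definition freq m : R := (m.+1%:R * pi) ^+ 2.

(** Coefficient of e_(m+1) in the real or imaginary part of the projected cubic term, without its
    factor i lambda. *)
Definition nonlin v u s m := int01 (fun x => dens v u x * field u s x * esin m.+1 x).

(* The scheme reads [psi v u = noise]; multiplication by i exchanges the real
   part (index false) and the imaginary part (index true). *)
Definition psi v u (j : 'I_N * bool) : R :=
  coord u j - c * coord v j + (-1) ^+ j.2 * tau *
    (- freq j.1 * coord u (j.1, ~~ j.2) + lambda * nonlin v u (~~ j.2) j.1).

Lemma cont_dens v u : continuous (dens v u).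
Proof.
rewrite /dens; under eq_fun do rewrite mulrC.
apply: cont_mulc; do 2 apply: cont_add; apply: cont_sqr; try exact: cont_field;
  by apply: cont_mulc; exact: cont_field.
Qed.

Lemma nonlin_pairing v u s (h : 'I_N -> R) :
  \sum_(m < N) nonlin v u s m * h m =
  int01 (fun x => dens v u x * field u s x * sine_sum h x).
Proof.
rewrite int01_mul_sine_sum; last first.
  by apply: cont_mul; [exact: cont_dens|exact: cont_field].
by apply: eq_bigr => m _; rewrite mulrC.
Qed.

Hypothesis tau_gt0 : 0 < tau.
Hypothesis lambda1 : lambda = 1 \/ lambda = -1.

(** tau times the largest eigenvalue of -Delta on V_N. In the estimates below the Laplacian has the
    unfavourable sign exactly when lambda = 1, and [kappa < 1] keeps it below the mass term. *)
Let kappa := tau * (N%:R * pi) ^+ 2.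
Hypothesis kappa_lt1 : kappa < 1.

Lemma freq_le m : tau * freq m <= kappa.
Proof.
rewrite /kappa /freq ler_wpM2l// ?(ltW tau_gt0)// !exprMn ler_wpM2r ?sqr_ge0//.
by rewrite lerXn2r ?nnegrE// ler_nat ltn_ord.
Qed.

Lemma freq_ge0 m : 0 <= freq m.
Proof. exact: sqr_ge0. Qed.

(* Pointwise |Im (D conj h)| <= Re (D conj h) for D = G(u) - G(u'), h = u - u'
   and G(u) = (|u|^2 + w) u / 2; [t] is the sign of the imaginary part. *)
Lemma cubic_difference (p q p' q' w t Dp Dq : R) : 0 <= w -> t = 1 \/ t = -1 ->
  Dp = (p ^+ 2 + q ^+ 2 + w) / 2 * p - (p' ^+ 2 + q' ^+ 2 + w) / 2 * p' ->
  Dq = (p ^+ 2 + q ^+ 2 + w) / 2 * q - (p' ^+ 2 + q' ^+ 2 + w) / 2 * q' ->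
  t * (Dq * (p - p') - Dp * (q - q')) <= Dp * (p - p') + Dq * (q - q').
Proof.
move=> w0 t1 DpE DqE.
(* Midpoint coordinates: with mid = m + i n and e + i f = mid conj h, one has D = ((a + w) h + 2 e
   mid) / 2. So the real part is (a + w) |h|^2 / 2 + e^2 and the imaginary part e f, with |e f| <=
   |mid|^2 |h|^2 / 2 <= a |h|^2 / 2. *)
pose hp := p - p'; pose hq := q - q'; pose m := (p + p') / 2; pose n := (q + q') / 2.
pose a := (p ^+ 2 + q ^+ 2 + p' ^+ 2 + q' ^+ 2) / 2.
pose e := m * hp + n * hq; pose f := n * hp - m * hq.
have ReE : Dp * hp + Dq * hq = ((a + w) * (hp ^+ 2 + hq ^+ 2) + 2 * e ^+ 2) / 2.
  by rewrite DpE DqE /a /e /hp /hq /m /n; field.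
have ImE : Dq * hp - Dp * hq = e * f.
  by rewrite DpE DqE /e /f /hp /hq /m /n; field.
have aE : a = m ^+ 2 + n ^+ 2 + (hp ^+ 2 + hq ^+ 2) / 4.
  by rewrite /a /hp /hq /m /n; field.
have efE : e ^+ 2 + f ^+ 2 = (m ^+ 2 + n ^+ 2) * (hp ^+ 2 + hq ^+ 2).
  by rewrite /e /f; ring.
rewrite -/hp -/hq ReE ImE.
have H0 : 0 <= hp ^+ 2 + hq ^+ 2 by rewrite addr_ge0 ?sqr_ge0.
have H1 : 0 <= w * (hp ^+ 2 + hq ^+ 2) by rewrite mulr_ge0.
have H2 : 0 <= (hp ^+ 2 + hq ^+ 2) / 4 * (hp ^+ 2 + hq ^+ 2).
  by rewrite mulr_ge0// mulr_ge0.
have H3 := sqr_ge0 e.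
have H4 : t * (e * f) <= (e ^+ 2 + f ^+ 2) / 2.
  by have := sqr_ge0 (e - f); have := sqr_ge0 (e + f); case: t1 => ->; nra.
apply: le_trans H4 _; rewrite efE {1}aE.
have -> : (m ^+ 2 + n ^+ 2) * (hp ^+ 2 + hq ^+ 2) =
   (a - (hp ^+ 2 + hq ^+ 2) / 4) * (hp ^+ 2 + hq ^+ 2) by rewrite aE; ring.
move: H1 H2 H3; nra.
Qed.

(** * Lipschitz bound for the inverse of the step *)

Section inverse_lipschitz.
Variables v u u' : VN R N.

Let h j := coord u j - coord u' j.
Let z j := psi v u j - psi v u' j.
Let D s x := dens v u x * field u s x - dens v u' x * field u' s x.
Let dn s m := nonlin v u s m - nonlin v u' s m.
Let hf s x := field u s x - field u' s x.

Let contD s : continuous (D s).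
Proof.
by apply: cont_sub; apply: cont_mul; [exact: cont_dens|exact: cont_field|
  exact: cont_dens|exact: cont_field].
Qed.

Let conthf s : continuous (hf s).
Proof. by apply: cont_sub; exact: cont_field. Qed.

Let zE j : z j = h j + (-1) ^+ j.2 * tau *
  (- freq j.1 * h (j.1, ~~ j.2) + lambda * dn (~~ j.2) j.1).
Proof. by rewrite /z /psi /h /dn; ring. Qed.

Let pairing s s' : \sum_(m < N) dn s m * h (m, s') = int01 (fun x => D s x * hf s' x).
Proof.
have -> : (fun x => D s x * hf s' x) = (fun x => D s x * sine_sum (fun m => h (m, s')) x).
  by apply/funext => x; rewrite sine_sumB.
rewrite int01_mul_sine_sum//; apply: eq_bigr => m _; rewrite mulrC; congr (_ * _).
rewrite /dn /nonlin -int01B; last 2 first.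
- by apply: cont_mul; [apply: cont_mul; [exact: cont_dens|exact: cont_field]|exact: cont_esin].
- by apply: cont_mul; [apply: cont_mul; [exact: cont_dens|exact: cont_field]|exact: cont_esin].
by congr int01; apply/funext => x; rewrite /D mulrBl.
Qed.

(** [cubic_difference] integrated over the interval. The old state [v] is common to both solutions
    and enters only as the weight [w], so the estimate is uniform in it. *)
Let cross_le t : t = 1 \/ t = -1 ->
  t * (\sum_(m < N) dn true m * h (m, false) - \sum_(m < N) dn false m * h (m, true)) <=
  \sum_(m < N) dn false m * h (m, false) + \sum_(m < N) dn true m * h (m, true).
Proof.
move=> t1; rewrite !pairing -int01B; try by apply: cont_mul.
rewrite -int01D; try by apply: cont_mul.
rewrite -int01Z; last by apply: cont_sub; apply: cont_mul.
apply: int01_le.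
- by apply: cont_mulc; apply: cont_sub; apply: cont_mul.
- by apply: cont_add; apply: cont_mul.
- move=> x; apply: (@cubic_difference _ _ _ _
    ((c * field v false x) ^+ 2 + (c * field v true x) ^+ 2)) => //.
  by rewrite addr_ge0 ?sqr_ge0.
Qed.

(** [X1] and [X2] are the real and imaginary parts of the pairing of [z] with [h]. In
    [X1 - lambda * X2] the cubic terms add up to tau (Re + lambda Im) >= 0 by [cross_le], and
    [(1 - kappa) * A] survives. *)
Lemma psi_inverse_lipschitz (delta : R) : (forall j, `|z j| <= delta) ->
  forall j, `|h j| <= 8 * N%:R / (1 - kappa) * delta.
Proof.
move=> zd j0.
pose A := \sum_j h j ^+ 2.
pose k := 1 - kappa; have k0 : 0 < k by rewrite subr_gt0.
pose X1 := \sum_(m < N) (z (m, false) * h (m, false) + z (m, true) * h (m, true)).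
pose X2 := \sum_(m < N) (z (m, true) * h (m, false) - z (m, false) * h (m, true)).
pose Fq := \sum_(m < N) tau * freq m * (h (m, false) ^+ 2 + h (m, true) ^+ 2).
have AE : A = \sum_(m < N) (h (m, false) ^+ 2 + h (m, true) ^+ 2) by rewrite /A coord_sum.
have FqA : Fq <= kappa * A.
  rewrite AE mulr_sumr; apply: ler_sum => m _; apply: ler_wpM2r; last exact: freq_le.
  by rewrite addr_ge0 ?sqr_ge0.
have X1E : X1 = A + tau * lambda *
    (\sum_(m < N) dn true m * h (m, false) - \sum_(m < N) dn false m * h (m, true)).
  rewrite -sumrB mulr_sumr AE -big_split; apply: eq_bigr => m _.
  by rewrite !zE /=; ring.
have X2E : X2 = Fq - tau * lambda *
    (\sum_(m < N) dn false m * h (m, false) + \sum_(m < N) dn true m * h (m, true)).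
  rewrite -big_split mulr_sumr -sumrB; apply: eq_bigr => m _.
  by rewrite !zE /=; ring.
have kA : k * A <= X1 - lambda * X2.
  have tle t : t = 1 \/ t = -1 -> tau * (t * (\sum_(m < N) dn true m * h (m, false) -
        \sum_(m < N) dn false m * h (m, true))) <=
      tau * (\sum_(m < N) dn false m * h (m, false) + \sum_(m < N) dn true m * h (m, true)).
    by move=> t1; rewrite ler_wpM2l ?(ltW tau_gt0)//; exact: cross_le.
  have Fq0 : 0 <= Fq.
    apply: sumr_ge0 => m _; rewrite mulr_ge0// ?addr_ge0 ?sqr_ge0//.
    by rewrite mulr_ge0 ?freq_ge0// ltW.
  have A0 : 0 <= A by apply: sumr_ge0 => i _; exact: sqr_ge0.
  rewrite X1E X2E /k.
  have := tle (-1) (or_intror erefl); have := tle 1 (or_introl erefl).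
  by move: FqA Fq0 A0 kappa_lt1 lambda1 => ? ? ? ? [->|->]; nra.
have d0 : 0 <= delta by apply: le_trans (zd j0).
(* Each mode contributes at most 2 delta (|h_re| + |h_im|); Young's inequality with weight [k]
   trades this for half of [k * A], which the left-hand side of [kA] absorbs. *)
have XX : X1 - lambda * X2 <= k / 2 * A + N%:R * (4 * delta ^+ 2 / k).
  rewrite AE !mulr_sumr -sumrB.
  have -> : N%:R * (4 * delta ^+ 2 / k) = \sum_(m < N) (4 * delta ^+ 2 / k).
    by rewrite sumr_const card_ord -[(4 * _ / k) *+ N]mulr_natl.
  rewrite -big_split; apply: ler_sum => m _ /=.
  have amgm (y : R) : 2 * delta * `|y| <= k / 2 * y ^+ 2 + 2 * delta ^+ 2 / k.
    have -> : k / 2 * y ^+ 2 + 2 * delta ^+ 2 / k =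
        2 * delta * `|y| + (k * `|y| - 2 * delta) ^+ 2 / (2 * k).
      by rewrite -(real_normK (num_real y)); field; rewrite gt_eqF.
    by rewrite lerDl divr_ge0 ?sqr_ge0// mulr_ge0// ltW.
  have zh i i' : `|z i * h i'| <= delta * `|h i'| by rewrite normrM ler_wpM2r.
  have := amgm (h (m, false)); have := amgm (h (m, true)).
  have := zh (m, false) (m, false); have := zh (m, true) (m, true).
  have := zh (m, true) (m, false); have := zh (m, false) (m, true).
  rewrite !ler_norml; move=> /andP[? ?] /andP[? ?] /andP[? ?] /andP[? ?] ? ?.
  by case: lambda1 => ->; lra.
have N1 : 1 <= N%:R :> R by case: (j0) => -[i /= iN] _; rewrite ler1n (leq_ltn_trans _ iN).
have hA : h j0 ^+ 2 <= A.
  by rewrite /A (bigD1 j0)//= lerDl; apply: sumr_ge0 => i _; exact: sqr_ge0.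
have A8 : A <= 8 * N%:R * delta ^+ 2 / k ^+ 2.
  rewrite ler_pdivlMr ?exprn_gt0//.
  have : k * (k * A) <= k * (k / 2 * A + N%:R * (4 * delta ^+ 2 / k)).
    by rewrite ler_wpM2l ?(ltW k0)//; lra.
  have -> : k * (k / 2 * A + N%:R * (4 * delta ^+ 2 / k)) =
      k ^+ 2 * A / 2 + N%:R * 4 * delta ^+ 2 by field; rewrite gt_eqF.
  by rewrite expr2; lra.
have y0 : 0 <= 8 * N%:R / (1 - kappa) * delta by rewrite !mulr_ge0 ?invr_ge0 ?(ltW k0).
(* [A8] would give the constant sqrt(8 N); since 8 N >= 1 the root is dropped. *)
suff : h j0 ^+ 2 <= (8 * N%:R / (1 - kappa) * delta) ^+ 2.
  by move: y0; set y := _ * delta => ? ?; rewrite ler_norml; apply/andP; split; nra.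
apply: le_trans hA _; apply: le_trans A8 _.
rewrite -/k !exprMn exprVn; set r := k ^- 2.
have r0 : 0 <= r by rewrite invr_ge0 sqr_ge0.
have : 0 <= r * delta ^+ 2 by rewrite mulr_ge0 ?sqr_ge0.
set y := r * _ => yy0.
have -> : 8 * N%:R * delta ^+ 2 * r = 8 * N%:R * y by rewrite /y; ring.
have -> : 8 ^+ 2 * N%:R ^+ 2 * r * delta ^+ 2 = (8 * N%:R) * (8 * N%:R) * y.
  by rewrite /y; ring.
by rewrite ler_wpM2r//; nra.
Qed.

End inverse_lipschitz.

(** * A bound on the new state that ignores the old one *)

Section uniform_bound.
Variables v u : VN R N.

Let w x := field u false x ^+ 2 + field u true x ^+ 2.
Let bs x := (c * field v false x) ^+ 2 + (c * field v true x) ^+ 2.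
Let cross x := c * field v false x * field u true x - c * field v true x * field u false x.
Let A := \sum_j coord u j ^+ 2.

Let cont_w : continuous w.
Proof. by apply: cont_add; apply: cont_sqr; exact: cont_field. Qed.

Let cont_cross : continuous cross.
Proof.
by apply: cont_sub; apply: cont_mul; try exact: cont_field; apply: cont_mulc; exact: cont_field.
Qed.

Let int_w : int01 w = A.
Proof.
rewrite /A coord_sum big_split /= /w int01D; try by apply: cont_sqr; exact: cont_field.
by congr (_ + _); under eq_fun do rewrite expr2; rewrite int01_sine_sum_mul;
  apply: eq_bigr => m _; rewrite expr2.
Qed.

Let int_cross : int01 cross =
  \sum_(m < N) (c * coord v (m, false) * coord u (m, true) -
                c * coord v (m, true) * coord u (m, false)).
Proof.
rewrite /cross int01B; last 2 first.
- by apply: cont_mul; [apply: cont_mulc|]; exact: cont_field.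
- by apply: cont_mul; [apply: cont_mulc|]; exact: cont_field.
rewrite sumrB; congr (_ - _); under [in LHS]eq_fun do rewrite -mulrA;
  (rewrite int01Z; last by apply: cont_mul; exact: cont_field);
  by rewrite int01_sine_sum_mul mulr_sumr; apply: eq_bigr => m _; rewrite mulrA.
Qed.

Let int_dens : int01 (fun x => dens v u x * w x) =
  \sum_(m < N) (nonlin v u false m * coord u (m, false) +
                nonlin v u true m * coord u (m, true)).
Proof.
rewrite big_split /= !nonlin_pairing -int01D; last 2 first.
- by apply: cont_mul; [apply: cont_mul; [exact: cont_dens|exact: cont_field]|exact: cont_field].
- by apply: cont_mul; [apply: cont_mul; [exact: cont_dens|exact: cont_field]|exact: cont_field].
by congr int01; apply/funext => x; rewrite /w /field; ring.
Qed.

(** Pointwise, dens * w = (w^2 + bs w) / 2. The part bs w absorbs [t * cross], since cross^2 <= bs w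
    by Cauchy-Schwarz, at the price (2 tau)^-1 of Young's inequality. The part w^2 is bounded below
    by its tangent at [A], the integral of [w], which gives A^2. *)
Let quartic_lower (t : R) : t = 1 \/ t = -1 ->
  tau / 2 * A ^+ 2 + t * int01 cross - (2 * tau)^-1 <=
  tau * int01 (fun x => dens v u x * w x).
Proof.
move=> t1; have cdw : continuous (fun x => dens v u x * w x).
  by apply: cont_mul => //; exact: cont_dens.
rewrite -(int01Z tau cdw).
have -> : tau / 2 * A ^+ 2 + t * int01 cross - (2 * tau)^-1 =
    int01 (fun x => tau * A * w x + (t * cross x + cst (- (tau / 2 * A ^+ 2) - (2 * tau)^-1) x)).
  rewrite [RHS]int01D; [|exact: cont_mulc|].
    rewrite [X in _ = _ + X]int01D; [|exact: cont_mulc|exact: cst_continuous].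
    by rewrite (int01Z _ cont_w) (int01Z _ cont_cross) int01_cst int_w; field; rewrite gt_eqF.
  by apply: cont_add; [exact: cont_mulc|exact: cst_continuous].
apply: int01_le; last 1 first.
- move=> x /=.
  have bs0 : 0 <= bs x by rewrite addr_ge0 ?sqr_ge0.
  have w0 : 0 <= w x by rewrite addr_ge0 ?sqr_ge0.
  have -> : dens v u x = (w x + bs x) / 2 by [].
  have c2 : cross x ^+ 2 <= bs x * w x.
    rewrite -subr_ge0 (_ : _ - _ = (c * field v false x * field u false x +
      c * field v true x * field u true x) ^+ 2) ?sqr_ge0// /bs /w /cross; ring.
  have h1 : t * cross x <= tau / 2 * (bs x * w x) + (2 * tau)^-1.
    have h : t * cross x <= tau / 2 * cross x ^+ 2 + (2 * tau)^-1.
      have -> : tau / 2 * cross x ^+ 2 + (2 * tau)^-1 =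
          t * cross x + (tau * cross x - t) ^+ 2 / (2 * tau).
        by case: t1 => ->; field; rewrite gt_eqF.
      by rewrite lerDl divr_ge0 ?sqr_ge0// mulr_ge0// ltW.
    apply: le_trans h _; rewrite lerD2r ler_wpM2l// divr_ge0// ltW//.
  have h2 : tau / 2 * (2 * A * w x - A ^+ 2) <= tau / 2 * (w x ^+ 2).
    have t2 : 0 <= tau / 2 by rewrite divr_ge0// ltW.
    by rewrite ler_wpM2l//; have := sqr_ge0 (w x - A); nra.
  move: h1 h2; set r := (2 * tau)^-1; nra.
- by apply: cont_add; [exact: cont_mulc|apply: cont_add; [exact: cont_mulc|exact: cst_continuous]].
- exact: cont_mulc.
Qed.

(* Uniform in the previous state [v]: the quartic part of the energy absorbs
   the cross term Im (u conj (c v)). *)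
Lemma psi_preimage_bounded (M : R) : 0 <= M -> (forall j, `|psi v u j| <= M) ->
  forall j, `|coord u j| <= 1 + 2 / tau * (1 + M + M * N%:R + (2 * tau)^-1).
Proof.
move=> M0 zM j0.
pose X := \sum_(m < N) (psi v u (m, true) * coord u (m, false) -
                        psi v u (m, false) * coord u (m, true)).
pose Fq := \sum_(m < N) tau * freq m * (coord u (m, false) ^+ 2 + coord u (m, true) ^+ 2).
have AE : A = \sum_(m < N) (coord u (m, false) ^+ 2 + coord u (m, true) ^+ 2).
  by rewrite /A coord_sum.
have A0 : 0 <= A by apply: sumr_ge0 => i _; exact: sqr_ge0.
have FqA : Fq <= kappa * A.
  rewrite AE mulr_sumr; apply: ler_sum => m _; apply: ler_wpM2r; last exact: freq_le.
  by rewrite addr_ge0 ?sqr_ge0.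
have Fq0 : 0 <= Fq.
  apply: sumr_ge0 => m _; rewrite mulr_ge0// ?addr_ge0 ?sqr_ge0//.
  by rewrite mulr_ge0 ?freq_ge0// ltW.
(* Imaginary part of the pairing of the equation with u: |u|^2 is real and drops out, so the old
   state enters only through [cross] and the density. *)
have XE : X = int01 cross + Fq - tau * lambda * int01 (fun x => dens v u x * w x).
  rewrite int_cross int_dens mulr_sumr -big_split -sumrB; apply: eq_bigr => m _.
  by rewrite /psi /=; ring.
have XA : `|X| <= M * N%:R + M / 2 * A.
  have -> : M * N%:R = \sum_(m < N) M by rewrite sumr_const card_ord mulr_natr.
  rewrite AE mulr_sumr -big_split; apply: le_trans (ler_norm_sum _ _ _) _.
  apply: ler_sum => m _ /=.
  have zu i i' : `|psi v u i * coord u i'| <= M / 2 * (1 + coord u i' ^+ 2).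
    rewrite normrM; apply: (@le_trans _ _ (M * `|coord u i'|)); first by rewrite ler_wpM2r.
    rewrite -mulrA ler_wpM2l// -(real_normK (num_real (coord u i'))).
    by have := sqr_ge0 (`|coord u i'| - 1); lra.
  apply: le_trans (ler_normB _ _) _.
  by have := zu (m, true) (m, false); have := zu (m, false) (m, true); lra.
(* For A >= 1 every constant in [main] is at most that constant times [A], and kappa < 1, so the
   right-hand side is at most [A * S]; dividing by [A] bounds it. The case A <= 1 accounts for the
   leading 1. *)
pose S := 1 + M + M * N%:R + (2 * tau)^-1.
have r0 : 0 <= (2 * tau)^-1 by rewrite invr_ge0 mulr_ge0// ltW.
have MN0 : 0 <= M * N%:R by rewrite mulr_ge0.
have S0 : 0 <= S by rewrite /S; lra.
have main : tau / 2 * A ^+ 2 <= (2 * tau)^-1 + kappa * A + (M * N%:R + M / 2 * A).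
  move: XA; rewrite ler_norml XE => /andP[].
  have := quartic_lower (or_introl erefl); have := quartic_lower (or_intror erefl).
  by move: FqA Fq0; case: lambda1 => ->; rewrite ?mulr1 ?mulrN1; nra.
have AB : A <= 1 + 2 / tau * S.
  have t20 : 0 <= 2 / tau * S by rewrite mulr_ge0// divr_ge0// ltW.
  have [A1|/ltW A1] := leP A 1; first by lra.
  suff : A <= 2 / tau * S by lra.
  have : A * (tau / 2 * A) <= A * S.
    rewrite mulrCA -expr2; apply: le_trans main _.
    by move: kappa_lt1 r0; rewrite /S; set r := (2 * tau)^-1; nra.
  rewrite ler_pM2l; last by lra.
  have -> : 2 / tau * S = (tau / 2)^-1 * S by rewrite invf_div.
  by rewrite ler_pdivlMl ?divr_gt0.
have hA : coord u j0 ^+ 2 <= A.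
  by rewrite /A (bigD1 j0)//= lerDl; apply: sumr_ge0 => i _; exact: sqr_ge0.
have t20 : 0 <= 2 / tau * S by rewrite mulr_ge0// divr_ge0// ltW.
rewrite -/S; move: (le_trans hA AB) t20; set y := 2 / tau * S => ? ?.
by rewrite ler_norml; apply/andP; split; nra.
Qed.

End uniform_bound.

End coordinate_map.

(** * The step as a cubic polynomial in the coordinates *)

Local Ltac cont01 := repeat (first [ exact: cont_esin | exact: cont_sine_sum
  | apply: cont_mulc | apply: cont_mul | apply: cont_add ]).

Section psi_polynomial.
Context {R : realType}.
Variable N : nat.
Variables (c tau lambda : R).

Local Notation psi := (@psi R N c tau lambda).

Definition quartic (i j l m : 'I_N) : R :=
  int01 (fun x => esin m.+1 x * esin i.+1 x * esin j.+1 x * esin l.+1 x).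

Definition trilinear (f g h : 'I_N -> R) m :=
  \sum_(l < N) h l * \sum_(j < N) g j * \sum_(i < N) f i * quartic i j l m.

Lemma int01_trilinear f g h (m : 'I_N) :
  int01 (fun x => sine_sum f x * sine_sum g x * sine_sum h x * esin m.+1 x) =
  trilinear f g h m.
Proof.
have -> : (fun x => sine_sum f x * sine_sum g x * sine_sum h x * esin m.+1 x) =
    (fun x => (esin m.+1 x * sine_sum f x * sine_sum g x) * sine_sum h x).
  by apply/funext => x; ring.
rewrite (@int01_mul_sine_sum _ _ (fun x => esin m.+1 x * sine_sum f x * sine_sum g x) h); last by cont01.
apply: eq_bigr => l _; congr (_ * _).
have -> : (fun x => esin m.+1 x * sine_sum f x * sine_sum g x * esin l.+1 x) =
    (fun x => (esin m.+1 x * sine_sum f x * esin l.+1 x) * sine_sum g x).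
  by apply/funext => x; ring.
rewrite (@int01_mul_sine_sum _ _ (fun x => esin m.+1 x * sine_sum f x * esin l.+1 x) g); last by cont01.
apply: eq_bigr => j _; congr (_ * _).
have -> : (fun x => esin m.+1 x * sine_sum f x * esin l.+1 x * esin j.+1 x) =
    (fun x => (esin m.+1 x * esin j.+1 x * esin l.+1 x) * sine_sum f x).
  by apply/funext => x; ring.
rewrite (@int01_mul_sine_sum _ _ (fun x => esin m.+1 x * esin j.+1 x * esin l.+1 x) f); last by cont01.
apply: eq_bigr => i _; congr (_ * _); congr int01.
by apply/funext => x; ring.
Qed.

Lemma int01_comb (a b : R) f1 f2 f3 f4 : continuous f1 -> continuous f2 ->
  continuous f3 -> continuous f4 ->
  int01 (fun x => a * (f1 x + f2 x) + b * (f3 x + f4 x)) =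
  a * (int01 f1 + int01 f2) + b * (int01 f3 + int01 f4).
Proof.
move=> c1 c2 c3 c4; have c12 := cont_add c1 c2; have c34 := cont_add c3 c4.
rewrite (int01D (cont_mulc (c := a) c12) (cont_mulc (c := b) c34)).
by rewrite (int01Z a c12) (int01Z b c34) (int01D c1 c2) (int01D c3 c4).
Qed.

(** With the constants [quartic] as coefficients, measurability, sequential continuity and bounds on
    bounded sets all reduce to finite sums; no limit has to pass under the integral over x. *)
Lemma nonlin_trilinear v u s m : nonlin c v u s m =
  2^-1 * (trilinear (fun i => coord u (i, false)) (fun i => coord u (i, false)) (fun i => coord u (i, s)) m +
          trilinear (fun i => coord u (i, true)) (fun i => coord u (i, true)) (fun i => coord u (i, s)) m) +
  c ^+ 2 / 2 *
         (trilinear (fun i => coord v (i, false)) (fun i => coord v (i, false)) (fun i => coord u (i, s)) m +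
          trilinear (fun i => coord v (i, true)) (fun i => coord v (i, true)) (fun i => coord u (i, s)) m).
Proof.
pose T (a : VN R N) s' x :=
  sine_sum (fun i => coord a (i, s')) x * sine_sum (fun i => coord a (i, s')) x *
  sine_sum (fun i => coord u (i, s)) x * esin m.+1 x.
have cT a s' : continuous (T a s') by rewrite /T; cont01.
rewrite -!int01_trilinear -!/(T _ _) -int01_comb//.
by congr int01; apply/funext => x; rewrite /dens /field /T; field.
Qed.

Lemma trilinear_measurable d (T : measurableType d) (F G H : T -> 'I_N -> R) m :
  (forall i, measurable_fun setT (F^~ i)) -> (forall i, measurable_fun setT (G^~ i)) ->
  (forall i, measurable_fun setT (H^~ i)) ->
  measurable_fun setT (fun t => trilinear (F t) (G t) (H t) m).
Proof.
move=> mF mG mH; apply: measurable_sum => l; apply: measurable_funM; first exact: mH.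
apply: measurable_sum => j; apply: measurable_funM; first exact: mG.
by apply: measurable_sum => i; apply: measurable_funM => //; exact: mF.
Qed.

Lemma psi_measurable d (T : measurableType d) (f g : T -> VN R N) j :
  (forall i, measurable_fun setT (fun t => coord (f t) i)) ->
  (forall i, measurable_fun setT (fun t => coord (g t) i)) ->
  measurable_fun setT (fun t => psi (f t) (g t) j).
Proof.
move=> mf mg; under eq_fun do rewrite /psi nonlin_trilinear.
repeat (first [ exact: mf | exact: mg | exact: measurable_cst
  | apply: trilinear_measurable => ? | apply: measurable_funB | apply: measurable_funD
  | apply: measurable_funM ]).
Qed.

Lemma cvg_sum_ord (A : nat -> 'I_N -> R) a : (forall i, A n i @[n --> \oo] --> a i) ->
  \sum_(i < N) A n i @[n --> \oo] --> \sum_(i < N) a i.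
Proof.
move=> Aa; elim: (index_enum _) => [|i s ih].
  by under eq_cvg do rewrite big_nil; rewrite big_nil; exact: cvg_cst.
by under eq_cvg do rewrite big_cons; rewrite big_cons; apply: cvgD.
Qed.

Lemma cvg_trilinear (F G H : nat -> 'I_N -> R) f g h m :
  (forall i, F n i @[n --> \oo] --> f i) -> (forall i, G n i @[n --> \oo] --> g i) ->
  (forall i, H n i @[n --> \oo] --> h i) ->
  trilinear (F n) (G n) (H n) m @[n --> \oo] --> trilinear f g h m.
Proof.
move=> Ff Gg Hh; apply: cvg_sum_ord => l; apply: cvgM; first exact: Hh.
apply: cvg_sum_ord => j; apply: cvgM; first exact: Gg.
by apply: cvg_sum_ord => i; apply: cvgMl; exact: Ff.
Qed.

Lemma psi_cvg v (U : nat -> VN R N) u j :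
  (forall i, coord (U n) i @[n --> \oo] --> coord u i) ->
  psi v (U n) j @[n --> \oo] --> psi v u j.
Proof.
move=> Uu; under eq_fun do rewrite /psi nonlin_trilinear.
rewrite /psi nonlin_trilinear.
repeat (first [ exact: Uu | exact: cvg_cst
  | apply: cvg_trilinear => ? | apply: cvgB | apply: cvgD
  | apply: cvgM ]).
Qed.

Lemma trilinear_bounded (r : R) : 0 <= r -> exists C, forall f g h m,
  (forall i, `|f i| <= r) -> (forall i, `|g i| <= r) -> (forall i, `|h i| <= r) ->
  `|trilinear f g h m| <= C.
Proof.
move=> r0.
exists (\sum_(m < N) \sum_(l < N) r * \sum_(j < N) r * \sum_(i < N) r * `|quartic i j l m|).
move=> f g h m fr gr hr.
apply: (@le_trans _ _ (\sum_(l < N) r * \sum_(j < N) r * \sum_(i < N) r * `|quartic i j l m|)).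
  apply: le_trans (ler_norm_sum _ _ _) _; apply: ler_sum => l _.
  rewrite normrM; apply: ler_pM => //; apply: le_trans (ler_norm_sum _ _ _) _.
  apply: ler_sum => j _; rewrite normrM; apply: ler_pM => //.
  apply: le_trans (ler_norm_sum _ _ _) _.
  by apply: ler_sum => i _; rewrite normrM; apply: ler_pM.
rewrite [leRHS](bigD1 m)//= lerDl; apply: sumr_ge0 => m' _; apply: sumr_ge0 => l _.
rewrite mulr_ge0//; apply: sumr_ge0 => j _; rewrite mulr_ge0//.
by apply: sumr_ge0 => i _; rewrite mulr_ge0.
Qed.

Lemma psi_bounded (r : R) : 0 <= r -> exists C, forall v u,
  (forall j, `|coord v j| <= r) -> (forall j, `|coord u j| <= r) ->
  forall j, `|psi v u j| <= C.
Proof.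
move=> r0; have [C CP] := trilinear_bounded r0.
exists (r + `|c| * r + `|tau| * ((\sum_(m < N) freq m) * r +
   `|lambda| * (2^-1 * (C + C) + c ^+ 2 / 2 * (C + C)))) => v u vr ur -[m s].
rewrite /psi /=; apply: le_trans (ler_normD _ _) _; apply: lerD.
  by apply: le_trans (ler_normB _ _) _; rewrite lerD// normrM ler_wpM2l.
rewrite !normrM normrX normrN normr1 expr1n mul1r ler_wpM2l//.
apply: le_trans (ler_normD _ _) _; apply: lerD.
  rewrite normrM normrN ler_pM// ger0_norm ?sqr_ge0//.
  by rewrite (bigD1 m)//= lerDl; apply: sumr_ge0 => i _; exact: sqr_ge0.
rewrite normrM ler_wpM2l// nonlin_trilinear.
apply: le_trans (ler_normD _ _) _; apply: lerD; rewrite normrM;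
  (rewrite [X in X * _]ger0_norm; last by rewrite ?divr_ge0 ?invr_ge0 ?sqr_ge0);
  (rewrite ler_wpM2l ?divr_ge0 ?invr_ge0 ?sqr_ge0//;
   by apply: le_trans (ler_normD _ _) _; apply: lerD; apply: CP).
Qed.

End psi_polynomial.

(** * From the scheme on functions to its coordinates *)

Section translation.
Context {R : realType}.
Variable N : nat.
Implicit Types (a u v : VN R N) (m : 'I_N) (g : R -> R[i]).

Lemma sine_modeE (n : nat) x : sine_mode n x = (esin n x)%:C :> R[i].
Proof. by []. Qed.

Lemma sum_complex (I : Type) (s : seq I) (A B : I -> R) :
  \sum_(i <- s) (A i +i* B i) = (\sum_(i <- s) A i) +i* (\sum_(i <- s) B i).
Proof.
elim: s => [|i s ih]; first by rewrite !big_nil.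
by rewrite !big_cons ih.
Qed.

Lemma complex_mulr (x y r : R) : (x +i* y) * r%:C = (x * r) +i* (y * r).
Proof. by apply/eqP; rewrite eq_complex /= !mulr0 subr0 add0r !eqxx. Qed.

Lemma VN_funE a x : VN_fun a x = field a false x +i* field a true x.
Proof.
rewrite /VN_fun /field /sine_sum -sum_complex; apply: eq_bigr => m _.
by rewrite sine_modeE complex_mulr.
Qed.

Lemma Re_VN_fun a : (fun x => complex.Re (VN_fun a x)) = field a false.
Proof. by apply/funext => x; rewrite VN_funE. Qed.

Lemma Im_VN_fun a : (fun x => complex.Im (VN_fun a x)) = field a true.
Proof. by apply/funext => x; rewrite VN_funE. Qed.

Lemma inner_sine_mode g (m : nat) :
  inner g (sine_mode m) = (int01 (fun x => complex.Re (g x) * esin m x)) +i*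
                          (int01 (fun x => complex.Im (g x) * esin m x)).
Proof.
have E x : g x * (sine_mode m x)^*%C =
    (complex.Re (g x) * esin m x) +i* (complex.Im (g x) * esin m x).
  rewrite sine_modeE; case: (g x) => p q; apply/eqP.
  by rewrite eq_complex /= oppr0 !mulr0 subr0 add0r !eqxx.
by rewrite /inner; cbv zeta; congr (_ +i* _); apply: eq_Rintegral => x _; rewrite E.
Qed.

Lemma big_modes (V : nmodType) (f : nat -> V) :
  \sum_(1 <= m < N.+1) f m = \sum_(m < N) f m.+1.
Proof. by rewrite big_add1 /= big_mkord. Qed.

Lemma projectionE g x : projection N g x =
  sine_sum (fun m : 'I_N => int01 (fun x => complex.Re (g x) * esin m.+1 x)) x +i*
  sine_sum (fun m : 'I_N => int01 (fun x => complex.Im (g x) * esin m.+1 x)) x.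
Proof.
rewrite /projection big_modes -sum_complex; apply: eq_bigr => m _.
by rewrite inner_sine_mode sine_modeE complex_mulr.
Qed.

Lemma projection_VN_fun a x : projection N (VN_fun a) x = VN_fun a x.
Proof.
rewrite projectionE VN_funE; congr (_ +i* _); apply: eq_bigr => m _; congr (_ * _).
- under [in LHS]eq_fun => y do rewrite VN_funE /= mulrC.
  exact: int01_sine_sum_esin.
- under [in LHS]eq_fun => y do rewrite VN_funE /= mulrC.
  exact: int01_sine_sum_esin.
Qed.

(** The scheme is an identity on the unit interval only, which is where orthonormality reads off the
    coefficients. *)
Lemma sine_sum_eq0 (f : 'I_N -> R) : (forall x, 0 <= x <= 1 -> sine_sum f x = 0) ->
  forall m, f m = 0.
Proof.
move=> f0 m; rewrite -(int01_sine_sum_esin f m) -(int01_cst 0).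
apply: eq_Rintegral => x; rewrite inE /= in_itv /= => x01.
by rewrite f0// mulr0.
Qed.

Lemma VN_fun_inj a b : (forall x, 0 <= x <= 1 -> VN_fun a x = VN_fun b x) -> a = b.
Proof.
move=> ab; apply: coord_inj => -[m s]; apply/eqP; rewrite -subr_eq0; apply/eqP.
apply: (@sine_sum_eq0 (fun m => coord a (m, s) - coord b (m, s))) => x /ab.
rewrite sine_sumB !VN_funE => /eqP; rewrite eq_complex /= => /andP[/eqP h0 /eqP h1].
by case: s; rewrite -/(field a _ x) -/(field b _ x) ?h0 ?h1 subrr.
Qed.

(** Makes every state an admissible initial value, so that the hypothesis on [U] covers all starting
    points in V_N. *)
Lemma square_integrable_VN_fun a : square_integrable (VN_fun a).
Proof.
have mf s : measurable_fun `[0 : R, 1] (field a s).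
  by apply: measurable_funTS; apply: continuous_measurable_fun; exact: cont_field.
split.
- by rewrite Re_VN_fun; exact: mf.
- by rewrite Im_VN_fun; exact: mf.
- have c2 : continuous (fun x => field a false x ^+ 2 + field a true x ^+ 2).
    by apply: cont_add; apply: cont_sqr; exact: cont_field.
  have /integrableP[_] := cont_integrable01 c2.
  move=> h; apply: le_lt_trans h; rewrite le_eqVlt; apply/orP; left; apply/eqP.
  by apply: eq_integral => x _; rewrite VN_funE /= ger0_norm ?addr_ge0 ?sqr_ge0.
Qed.

Lemma laplacian_VN_fun a x : laplacian (VN_fun a) x =
  sine_sum (fun m => - freq m * coord a (m, false)) x +i*
  sine_sum (fun m => - freq m * coord a (m, true)) x.
Proof.
rewrite /laplacian; congr (_ +i* _).
- rewrite Re_VN_fun; exact: sine_sum_derive1n2.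
- rewrite Im_VN_fun; exact: sine_sum_derive1n2.
Qed.

Section noise.
Context {d : measure_display} {Omega : measurableType d} (P : probability Omega R).
Variables (W : nat * bool -> R -> {RV P >-> R}) (eta : nat -> R) (alpha lambda tau : R).

Definition noise (k : nat) (w : Omega) : VN R N :=
  of_coord (fun j : 'I_N * bool => Num.sqrt (eta j.1.+1) *
    (W (nat_of_ord j.1, j.2) (k%:R * tau) w - W (nat_of_ord j.1, j.2) (k.-1%:R * tau) w)).

Lemma noise_incrementE k w x : noise_increment W eta tau N k w x =
  field (noise k w) false x +i* field (noise k w) true x.
Proof.
rewrite /noise_increment big_modes -sum_complex; apply: eq_bigr => m _.
rewrite /complex_brownian sine_modeE !of_coordK /=.
by apply/eqP; rewrite eq_complex /=; apply/andP; split; apply/eqP; ring.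
Qed.

Lemma scheme_step_psi k w v u : scheme_step W eta alpha lambda tau k w v u ->
  forall j, psi (expR (- (alpha * tau))) tau lambda v u j = coord (noise k w) j.
Proof.
set c := expR _ => H.
(* Defect of the coordinate equations. Its two sine sums are, up to reordering, the real and
   imaginary parts of the scheme, hence vanish on the interval. *)
pose E s m := psi c tau lambda v u (m, s) - coord (noise k w) (m, s).
suff E0 s m : E s m = 0 by case=> m s; apply/eqP; rewrite -subr_eq0; apply/eqP/E0.
have GE : (fun y => (`|VN_fun u y| ^+ 2 + `|c%:C * VN_fun v y| ^+ 2) / 2 * VN_fun u y) =
    (fun y => (dens c v u y * field u false y) +i* (dens c v u y * field u true y)).
  apply/funext => y; rewrite -!add_Re2_Im2 !VN_funE /= !mul0r subr0 addr0.
  have -> : (2 : R[i]) = (2 : R)%:C by rewrite rmorph_nat.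
  rewrite -raddfD -fmorphV -rmorphM /= mulrC complex_mulr -/(dens c v u y).
  by congr (_ +i* _); rewrite mulrC.
apply: sine_sum_eq0 => x x01; have := H x x01.
rewrite -/c GE !VN_funE laplacian_VN_fun projectionE noise_incrementE.
set lap1 := sine_sum (fun m => - freq m * coord u (m, false)) x.
set lap2 := sine_sum (fun m => - freq m * coord u (m, true)) x.
rewrite -[sine_sum (fun m => int01 (fun y => complex.Re _ * _)) x]/(sine_sum (nonlin c v u false) x).
rewrite -[sine_sum (fun m => int01 (fun y => complex.Im _ * _)) x]/(sine_sum (nonlin c v u true) x).
move/eqP; rewrite eq_complex /= => /andP[/eqP h1 /eqP h2].
have -> : sine_sum (E s) x = field u s x - c * field v s x + (-1) ^+ s * tau *
    ((if s then lap1 else lap2) + lambda * sine_sum (nonlin c v u (~~ s)) x) -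
    field (noise k w) s x.
  have -> : (if s then lap1 else lap2) = sine_sum (fun m => - freq m * coord u (m, ~~ s)) x.
    by case: (s).
  rewrite /field /sine_sum !mulr_sumr -big_split mulr_sumr -sumrB -big_split -sumrB.
  by apply: eq_bigr => i _; rewrite /E /psi /=; ring.
by case: s; [move: h2|move: h1]; rewrite /= ?expr0 ?expr1; lra.
Qed.


End noise.
End translation.

(** * Comparison of measures on V_N by dyadic cells *)

Section VN_measurable.
Context {R : realType}.
Variable N : nat.
Local Notation VN := (VN R N).
Local Notation idx := ('I_N * bool)%type.

Lemma measurable_coord (j : idx) : measurable_fun setT (fun a : VN => coord a j).
Proof.
case: j => m []; rewrite /coord /=.
- by apply: (measurableT_comp measurable_snd); exact: measurable_tnth.
- by apply: (measurableT_comp measurable_fst); exact: measurable_tnth.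
Qed.

Lemma measurable_VN d (T : measurableType d) (f : T -> VN) :
  (forall j, measurable_fun setT (fun t => coord (f t) j)) -> measurable_fun setT f.
Proof.
move=> mf; apply/measurable_fun_tnthP => m; apply/measurable_fun_pairP; split.
- exact: mf (m, false).
- exact: mf (m, true).
Qed.

(** Induction on Borel sets of V_N: for the sigma-algebra [S] on the source, the identity has
    measurable coordinates, hence is measurable. *)
Lemma VN_sigma_algebra (S : set (set VN)) : sigma_algebra setT S ->
  (forall j B, measurable B -> S ((fun a => coord a j) @^-1` B)) ->
  measurable `<=` S.
Proof.
move=> sS SB A mA.
have mid : measurable_fun setT (id : g_sigma_algebraType S -> VN).
  apply: measurable_VN => j _ B mB; rewrite setTI.
  by apply: sub_sigma_algebra; exact: SB.
have := mid measurableT A mA; rewrite setTI => h.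
by rewrite -(measurable_g_measurableTypeE sS).
Qed.

(** The sides are indexed like the motions [W], those beyond N being ignored, so that one family
    serves both the box and the independence statement. *)
Definition box (B : nat * bool -> set R) : set VN :=
  [set a | forall j : idx, B (nat_of_ord j.1, j.2) (coord a j)].

Lemma measurable_box B : (forall j, measurable (B j)) -> measurable (box B).
Proof.
move=> mB; have -> : box B = \bigcap_(j in [set: idx])
    ((fun a => coord a j) @^-1` B (nat_of_ord j.1, j.2)).
  by apply/seteqP; split => [a aB j _|a aB j]; [exact: aB|exact: (aB j I)].
apply: fin_bigcap_measurable; first exact: finite_finset.
by move=> j _; rewrite -[_ @^-1` _]setTI; apply: measurable_coord.
Qed.

Lemma VN_measure_ext (m1 m2 : {measure set VN -> \bar R}) :
  (m1 setT < +oo)%E ->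
  (forall B, (forall j, measurable (B j)) -> m1 (box B) = m2 (box B)) ->
  forall A, measurable A -> m1 A = m2 A.
Proof.
move=> m1oo m12 A mA.
pose G := [set A | exists2 B, (forall j, measurable (B j)) & A = box B].
have boxT : box (fun=> setT) = setT by apply/seteqP; split.
have GT : G setT by exists (fun=> setT).
apply: (@g_sigma_algebra_measure_unique _ _ _ G _ (fun=> setT)) => //.
- by move=> _ [B mB ->]; exact: measurable_box.
- by apply/seteqP; split => // x _; exists 0%N.
- move=> _ _ [B mB ->] [B' mB' ->]; exists (fun j => B j `&` B' j).
    by move=> j; exact: measurableI.
  by apply/seteqP; split => [a [h h'] j|a h]; [split|split => j; have [] := h j].
- by move=> _ [B mB ->]; exact: m12.
- apply: (VN_sigma_algebra _ _ mA); first exact: smallest_sigma_algebra.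
  move=> j B mB; apply: sub_sigma_algebra.
  exists (fun i => if i == (nat_of_ord j.1, j.2) then B else setT).
    by move=> i; case: ifP.
  apply/seteqP; split => [a aB i /=|a /(_ j)]; last by rewrite eqxx.
  case: eqP => // -[/val_inj h1 h2]; case: i j h1 h2 aB => [? ?] [? ?] /= -> -> //.
Qed.

Section dyadic.

Definition cell m (a : VN) : {ffun idx -> int} := [ffun j => Num.floor (2 ^+ m * coord a j)].

(** Unions of cells of a single level. Levels refine each other, so these sets form an algebra;
    labels are countable, so an arbitrary [S] still gives a measurable set. *)
Definition dyadic (A : set VN) := exists m S, A = cell m @^-1` S.

Lemma cellP m a k : cell m a = k <->
  forall j, (k j)%:~R <= 2 ^+ m * coord a j < (k j + 1)%:~R.
Proof.
split=> [<- j|h]; first by rewrite ffunE; apply: real_floor_itv; exact: num_real.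
by apply/ffunP => j; rewrite ffunE; apply: floor_def; exact: h.
Qed.

Lemma measurable_cell1 m k : measurable (cell m @^-1` [set k]).
Proof.
have -> : cell m @^-1` [set k] = box (fun i => if insub i.1 is Some m' then
    [set x | (k (m', i.2))%:~R <= 2 ^+ m * x < (k (m', i.2) + 1)%:~R] else setT).
  apply/seteqP; split => [a /cellP h -[i b]|a h]; first by rewrite valK; exact: h.
  by apply/cellP => -[i b]; have := h (i, b); rewrite /= valK.
apply: measurable_box => i; case: insubP => // m' _ _.
have mf : measurable_fun setT (fun x : R => 2 ^+ m * x) by apply: measurable_funM.
have := mf measurableT `[(k (m', i.2))%:~R, (k (m', i.2) + 1)%:~R[%classic.
rewrite setTI => /(_ _); rewrite (_ : _ @^-1` _ = [set x | (k (m', i.2))%:~R <= 2 ^+ m * x < (k (m', i.2) + 1)%:~R]).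
  by apply; exact: measurable_itv.
by apply/seteqP; split => x; rewrite /= in_itv.
Qed.

Lemma cell_bigcup m S : cell m @^-1` S = \bigcup_n (if pickle_inv n is Some k then
  if `[< S k >] then cell m @^-1` [set k] else set0 else set0).
Proof.
apply/seteqP; split => [a Sa|a [n _]]; last first.
  by case: (pickle_inv n) => [k|//]; case: asboolP => // Sk /= ->.
by exists (pickle (cell m a)) => //; rewrite pickleK_inv asboolT.
Qed.

Lemma measurable_dyadic A : dyadic A -> measurable A.
Proof.
move=> [m [S ->]]; rewrite cell_bigcup; apply: bigcupT_measurable => n.
case: (pickle_inv n) => [k|//]; case: ifP => // _; exact: measurable_cell1.
Qed.

Lemma cell_refine m a :
  cell m a = [ffun j => Num.floor ((cell m.+1 a j)%:~R / 2 : R)].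
Proof.
apply/cellP => j; rewrite ffunE.
have /cellP/(_ j) : cell m.+1 a = cell m.+1 a by [].
set k := cell m.+1 a j; rewrite exprS -mulrA => /andP[k1 k2].
have := real_floor_itv (num_real (k%:~R / 2 : R)).
set q := Num.floor _ => /andP[q1 q2].
have kq : k < 2 * q + 2.
  rewrite -(ltr_int R) rmorphD rmorphM /= -[2%:~R]/(2%:R).
  by move: q2; rewrite rmorphD /=; lra.
(* Integrality: the strict bound on [k] is improved to one on [k + 1], the upper end of the finer
   cell. *)
have kq1 : k + 1 <= 2 * q + 2 by lia.
move: kq1; rewrite -(ler_int R) !rmorphD rmorphM /= -[2%:~R]/(2%:R) => kq1.
by move: k1 k2; rewrite !rmorphD /= => k1 k2; apply/andP; split; lra.
Qed.

Lemma cell_refine_le m m' : (m <= m')%N -> exists g, forall a, cell m a = g (cell m' a).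
Proof.
elim: m' => [|m' ih]; first by rewrite leqn0 => /eqP ->; exists id.
rewrite leq_eqVlt ltnS => /predU1P[->|/ih[g gP]]; first by exists id.
exists (fun k => g [ffun j => Num.floor ((k j)%:~R / 2 : R)]) => a.
by rewrite gP cell_refine.
Qed.

Lemma dyadic_level m0 A : dyadic A -> exists m S, (m0 <= m)%N /\ A = cell m @^-1` S.
Proof.
move=> [m [S ->]]; have [g gP] := cell_refine_le (leq_maxl m m0).
exists (maxn m m0), (g @^-1` S); split; first exact: leq_maxr.
by apply/seteqP; split => a /=; rewrite gP.
Qed.

Lemma dyadicC A : dyadic A -> dyadic (~` A).
Proof. by move=> [m [S ->]]; exists m, (~` S); rewrite preimage_setC. Qed.

Lemma dyadicU A B : dyadic A -> dyadic B -> dyadic (A `|` B).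
Proof.
move=> [m [S ->]] /(dyadic_level m)[m' [S' [mm' ->]]].
have [g gP] := cell_refine_le mm'.
exists m', (g @^-1` S `|` S'); apply/seteqP; split => a /=; rewrite gP//.
Qed.

Lemma dyadic0 : dyadic set0.
Proof. by exists 0%N, set0; rewrite preimage_set0. Qed.

Lemma dyadic_bigU n (F : nat -> set VN) : (forall i, dyadic (F i)) ->
  dyadic (\big[setU/set0]_(i < n) F i).
Proof.
move=> dF; elim: n => [|n ih]; first by rewrite big_ord0; exact: dyadic0.
by rewrite big_ord_recr /=; exact: dyadicU.
Qed.

(** * Approximation of Borel sets by unions of dyadic cells *)

Section approximation.
Variable mu : {measure set VN -> \bar R}.
Hypothesis muoo : (mu setT < +oo)%E.

Let mu_fin A : measurable A -> mu A \is a fin_num.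
Proof.
move=> mA; rewrite ge0_fin_numE//; apply: le_lt_trans muoo.
by apply: le_measure; rewrite ?inE.
Qed.

(** The halves of the symmetric difference are kept apart: when two measures are compared, A minus B
    is charged to the smaller measure and B minus A to the larger one. *)
Definition dyadic_approx (A : set VN) := measurable A /\ forall eps : R, 0 < eps ->
  exists B, [/\ dyadic B, (mu (A `\` B) <= eps%:E)%E & (mu (B `\` A) <= eps%:E)%E].

Lemma dyadic_approx_dyadic A : dyadic A -> dyadic_approx A.
Proof.
move=> dA; split; first exact: measurable_dyadic.
by move=> eps e0; exists A; rewrite !setDv !measure0 !lee_fin !ltW.
Qed.

Lemma dyadic_approxC A : dyadic_approx A -> dyadic_approx (~` A).
Proof.
move=> [mA hA]; split; first exact: measurableC.
move=> eps /hA[B [dB h1 h2]]; exists (~` B); split; first exact: dyadicC.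
  by rewrite setDE setCK setIC -setDE.
by rewrite setDE setCK setIC -setDE.
Qed.

Lemma dyadic_approx_bigcup (F : nat -> set VN) : (forall i, dyadic_approx (F i)) ->
  dyadic_approx (\bigcup_i F i).
Proof.
move=> hF; have mF i : measurable (F i) by have [] := hF i.
have mUF : measurable (\bigcup_i F i) by exact: bigcupT_measurable.
split => // eps e0.
have mbU n : measurable (\big[setU/set0]_(i < n) F i) by exact: bigsetU_measurable.
have cv : mu (\bigcup_i F i `\` \big[setU/set0]_(i < n) F i) @[n --> \oo] --> 0%E.
  have -> : 0%E = mu (\bigcap_n (\bigcup_i F i `\` \big[setU/set0]_(i < n) F i)).
    rewrite (_ : \bigcap_n _ = set0) ?measure0//; apply/seteqP; split => // a h.
    have [[i _ Fia] _] := h 0%N I; have [_ []] := h i.+1 I.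
    by rewrite big_ord_recr /=; right.
  apply: nonincreasing_cvg_mu => //.
  - by rewrite ltey_eq mu_fin//; exact: measurableD.
  - by move=> n; exact: measurableD.
  - by apply: bigcapT_measurable => n; exact: measurableD.
  - move=> n n' nn'; apply/subsetPset; apply: setDS.
    by apply: subset_bigsetU.
have e2 : 0 < eps / 2 by rewrite divr_gt0.
have [n hn] : exists n, (mu (\bigcup_i F i `\` \big[setU/set0]_(i < n) F i) <= (eps / 2)%:E)%E.
  move/fine_cvgP : cv => [_ /cvgrPdist_le/(_ _ e2)[n _ /(_ n (leqnn n))]].
  rewrite /= sub0r normrN => h; exists n.
  have f : mu (\bigcup_i F i `\` \big[setU/set0]_(i < n) F i) \is a fin_num.
    by apply: mu_fin; exact: measurableD.
  by rewrite -(fineK f) lee_fin; apply: le_trans h; exact: ler_norm.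
(* Half of [eps] pays for cutting the union at [n], the other half is shared among the [n] sets;
   [n.+1] keeps the share positive when [n] is 0. *)
have en : 0 < eps / 2 / n.+1%:R by rewrite divr_gt0.
have /choice[B hB] : forall i, exists B, [/\ dyadic B,
    (mu (F i `\` B) <= (eps / 2 / n.+1%:R)%:E)%E & (mu (B `\` F i) <= (eps / 2 / n.+1%:R)%:E)%E].
  by move=> i; have [_ /(_ _ en)] := hF i.
have mB i : measurable (B i) by have [/measurable_dyadic] := hB i.
have small (G : nat -> set VN) : (forall i, measurable (G i)) ->
    (forall i, mu (G i) <= (eps / 2 / n.+1%:R)%:E)%E ->
    (mu (\big[setU/set0]_(i < n) G i) <= (eps / 2)%:E)%E.
  move=> mG hG; apply: (@le_trans _ _ (\sum_(i < n) (eps / 2 / n.+1%:R)%:E)%E).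
    apply: (@le_trans _ _ (\sum_(i < n) mu (G i))%E); last by apply: lee_sum.
    by apply: (@content_subadditive _ _ _ mu) => //; exact: bigsetU_measurable.
  rewrite sumEFin lee_fin sumr_const card_ord -[(_ / n.+1%:R) *+ n]mulr_natl.
  rewrite mulrCA -[leRHS]mulr1 ler_wpM2l ?(ltW e2)//.
  by rewrite ler_pdivrMr// mul1r ler_nat.
exists (\big[setU/set0]_(i < n) B i); split.
- by apply: dyadic_bigU => i; have [] := hB i.
- apply: (@le_trans _ _ (mu ((\bigcup_i F i `\` \big[setU/set0]_(i < n) F i) `|`
      \big[setU/set0]_(i < n) (F i `\` B i)))).
    apply: le_measure; rewrite ?inE.
    + by apply: measurableD => //; exact: bigsetU_measurable.
    + apply: measurableU; first exact: measurableD.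
      by apply: bigsetU_measurable => i _; exact: measurableD.
    + move=> a [Fa nBa]; have [|nF] := pselect ((\big[setU/set0]_(i < n) F i) a); last by left.
      move: nBa; rewrite -!bigcup_mkord => nBa [i /= iN Fia]; right.
      rewrite -(bigcup_mkord n (fun i => F i `\` B i)).
      by exists i => //; split => // Bia; apply: nBa; exists i.
  apply: le_trans (measureU2 _ _ _) _.
  + exact: measurableD.
  + by apply: bigsetU_measurable => i _; exact: measurableD.
  rewrite (splitr eps) EFinD leeD//; apply: (small (fun i => F i `\` B i)).
  + by move=> i; exact: measurableD.
  + by move=> i; have [] := hB i.
- apply: (@le_trans _ _ (mu (\big[setU/set0]_(i < n) (B i `\` F i)))).
    apply: le_measure; rewrite ?inE.
    + by apply: measurableD => //; exact: bigsetU_measurable.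
    + by apply: bigsetU_measurable => i _; exact: measurableD.
    + move=> a [+ nFa]; rewrite -(bigcup_mkord n (fun i => B i `\` F i)) -bigcup_mkord.
      move=> -[i /= iN Bia].
      by exists i => //; split => // Fia; apply: nFa; exists i.
  apply: (@le_trans _ _ (eps / 2)%:E); last by rewrite lee_fin; lra.
  apply: (small (fun i => B i `\` F i)).
  + by move=> i; exact: measurableD.
  + by move=> i; have [] := hB i.
Qed.

Lemma dyadic_approx_measurable A : measurable A -> dyadic_approx A.
Proof.
have sD : sigma_algebra setT dyadic_approx.
  split; first by apply: dyadic_approx_dyadic; exact: dyadic0.
    by move=> B; rewrite setTD; exact: dyadic_approxC.
  exact: dyadic_approx_bigcup.
apply: VN_sigma_algebra => // j B mB.
pose S := [set B : set R | dyadic_approx ((fun a => coord a j) @^-1` B)].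
have mB' : (@RGenOInfty.G R).-sigma.-measurable B by rewrite -RGenOInfty.measurableE.
suff H : <<s (@RGenOInfty.G R) >> `<=` S by exact: H mB'.
apply: smallest_sub.
  split; rewrite /S /=.
  - by rewrite preimage_set0; case: sD.
  - by move=> C hC; rewrite setTD preimage_setC; exact: dyadic_approxC.
  - by move=> F hF; rewrite preimage_bigcup; exact: dyadic_approx_bigcup.
move=> _ [t ->]; rewrite /S /=.
(* An open half-space is the union over all levels of the cells whose lower end already exceeds [t];
   a level with 2^m (a_j - t) >= 1 suffices for the point [a]. *)
have -> : (fun a : VN => coord a j) @^-1` `]t, +oo[%classic =
    \bigcup_m (cell m @^-1` [set k | 2 ^+ m * t < (k j)%:~R]).
  apply/seteqP; split => [a /=|a [m _ /=]].
    rewrite in_itv /= andbT => ta.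
    have ta0 : 0 < coord a j - t by rewrite subr_gt0.
    pose m := Num.bound (coord a j - t)^-1; exists m => //=.
    rewrite ffunE.
    have := real_floor_itv (num_real (2 ^+ m * coord a j)) => /andP[_].
    rewrite rmorphD /=; set q := Num.floor _ => hq.
    have m1 : 1 <= 2 ^+ m * (coord a j - t).
      rewrite -ler_pdivrMr// mul1r.
      have inv0 : 0 <= (coord a j - t)^-1 by rewrite invr_ge0 ltW.
      apply: le_trans (ltW (archi_boundP inv0)) _.
      by rewrite -natrX ler_nat; apply: ltnW; exact: ltn_expl.
    by move: m1; rewrite mulrBr; lra.
  rewrite in_itv /= andbT; move: (cellP m a (cell m a)) => [/(_ erefl)/(_ j)/andP[h _] _] h'.
  have := lt_le_trans h' h; rewrite ltr_pM2l// exprn_gt0//.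
apply: dyadic_approx_bigcup => m; apply: dyadic_approx_dyadic.
by exists m; eexists.
Qed.

End approximation.

Section comparison.
Variables m1 m2 : {measure set VN -> \bar R}.
Hypotheses (m1oo : (m1 setT < +oo)%E) (m2oo : (m2 setT < +oo)%E).
Variables (C : R) (m0 : nat).
Hypothesis C_ge0 : 0 <= C.
Hypothesis cell_le : forall m k, (m0 <= m)%N ->
  (m1 (cell m @^-1` [set k]) <= C%:E * m2 (cell m @^-1` [set k]))%E.

Let dyadic_le B : dyadic B -> (m1 B <= C%:E * m2 B)%E.
Proof.
move=> /(dyadic_level m0)[m [S [mm0 ->]]].
have mS : measurable (cell m @^-1` S) by apply: measurable_dyadic; exists m, S.
rewrite cell_bigcup in mS *; set G := fun n => if pickle_inv n is Some k then _ else _.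
have mG n : measurable (G n).
  by rewrite /G; case: (pickle_inv n) => // k; case: ifP => // _; exact: measurable_cell1.
have tG : trivIset setT G.
  apply/trivIsetP => i j _ _ ij; apply/seteqP; split => // a [].
  have pi i' (k : {ffun idx -> int}) : pickle_inv i' = Some k -> i' = pickle k.
    by move=> h; have := @pickle_invK {ffun idx -> int} i'; rewrite h.
  rewrite /G; case Ei: (pickle_inv i) => [k|//]; case: ifP => // _ /= ak.
  case Ej: (pickle_inv j) => [k'|//]; case: ifP => // _ /= ak'.
  by move/eqP: ij; apply; rewrite (pi _ _ Ei) (pi _ _ Ej) -ak ak'.
rewrite !measure_semi_bigcup// -nneseriesZl//; apply: lee_nneseries => n _.
  by rewrite measure_ge0.
rewrite /G; case: (pickle_inv n) => [k|]; last by rewrite !measure0 mule0.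
by case: ifP => _; [exact: cell_le|rewrite !measure0 mule0].
Qed.

(** Approximation in the sum [m1 + m2] lets one dyadic set serve both measures. The error is paid
    once in [m1] and [C] times in [m2], hence the tolerance e / (1 + C). *)
Lemma cell_measure_le A : measurable A -> (m1 A <= C%:E * m2 A)%E.
Proof.
move=> mA; pose mu := measure_add m1 m2.
have muE B : mu B = (m1 B + m2 B)%E by rewrite /mu measure_addE.
have muoo : (mu setT < +oo)%E by rewrite muE lte_add_pinfty.
have [_ appr] := dyadic_approx_measurable muoo mA.
apply/lee_addgt0Pr => e e0.
have e1 : 0 < e / (1 + C) by rewrite divr_gt0// ltr_wpDr.
have [B [dB h1 h2]] := appr _ e1; have mB := measurable_dyadic dB.
have {}h1 : (m1 (A `\` B) + m2 (A `\` B) <= (e / (1 + C))%:E)%E by rewrite -muE; exact: h1.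
have {}h2 : (m1 (B `\` A) + m2 (B `\` A) <= (e / (1 + C))%:E)%E by rewrite -muE; exact: h2.
have hm1 : (m1 A <= m1 B + (e / (1 + C))%:E)%E.
  apply: (@le_trans _ _ (m1 (B `|` (A `\` B)))).
    apply: le_measure; rewrite ?inE//; first by apply: measurableU => //; exact: measurableD.
    by move=> a Aa; have [?|?] := pselect (B a); [left|right].
  apply: le_trans (measureU2 _ _ _) _ => //; first exact: measurableD.
  by rewrite leeD2l//; apply: le_trans h1; rewrite leeDl.
have hm2 : (m2 B <= m2 A + (e / (1 + C))%:E)%E.
  apply: (@le_trans _ _ (m2 (A `|` (B `\` A)))).
    apply: le_measure; rewrite ?inE//; first by apply: measurableU => //; exact: measurableD.
    by move=> a Aa; have [?|?] := pselect (A a); [left|right].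
  apply: le_trans (measureU2 _ _ _) _ => //; first exact: measurableD.
  by rewrite leeD2l//; apply: le_trans h2; rewrite leeDr.
apply: le_trans hm1 _.
apply: (@le_trans _ _ (C%:E * (m2 A + (e / (1 + C))%:E) + (e / (1 + C))%:E)%E).
  by rewrite leeD2r//; apply: le_trans (dyadic_le dB) _; rewrite lee_wpmul2l// lee_fin.
rewrite ge0_muleDr// ?lee_fin ?(ltW e1)// -addeA leeD2l// -EFinM -EFinD lee_fin.
have -> : C * (e / (1 + C)) + e / (1 + C) = e; last by [].
by field; rewrite gt_eqF// ltr_wpDr.
Qed.

End comparison.

End dyadic.
End VN_measurable.

(** * The law of the noise *)

Section normal_intervals.
Context {R : realType}.
Variable s : R.
Hypothesis s0 : s != 0.

Let lebesgue_ball (p r : R) : 0 <= r ->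
  lebesgue_measure `[p - r, p + r]%classic = (2 * r)%:E.
Proof.
move=> r0; rewrite lebesgue_measure_itv /= lte_fin.
case: ifPn => [_|]; first by rewrite -EFinB; congr EFin; ring.
by rewrite -leNgt => h; congr EFin; lra.
Qed.

Lemma normal_prob_ball_le (p r : R) : 0 <= r ->
  (normal_prob 0 s `[(p - r)%R, (p + r)%R] <= (2 * normal_peak s * r)%:E)%E.
Proof.
move=> r0; rewrite /normal_prob.
apply: (@le_trans _ _ (\int[lebesgue_measure]_(x in `[(p - r)%R, (p + r)%R]) (normal_peak s)%:E)%E).
  apply: ge0_le_integral => //.
  - by move=> x _; rewrite lee_fin normal_pdf_ge0.
  - by apply/measurable_EFinP; apply: measurable_funTS; exact: measurable_normal_pdf.
  - by move=> x _; rewrite lee_fin normal_pdf_ub.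
by rewrite integral_cst//= lebesgue_ball// -EFinM lee_fin mulrCA mulrA.
Qed.

(** The internal [c] is the density at distance [M + r0] from the mean, a lower bound for it on all
    the intervals considered. *)
Lemma normal_prob_ball_ge (M r0 : R) : exists2 c : R, 0 < c & forall p r,
  `|p| <= M -> 0 <= r <= r0 -> ((c * r)%:E <= normal_prob 0 s `[(p - r)%R, (p + r)%R])%E.
Proof.
pose c := normal_peak s * expR (- (M + r0) ^+ 2 / (s ^+ 2 *+ 2)).
have c0 : 0 < c by rewrite mulr_gt0 ?expR_gt0// normal_peak_gt0.
exists (2 * c); first by rewrite mulr_gt0.
move=> p r pM /andP[r_ge0 rr0]; rewrite /normal_prob.
apply: (@le_trans _ _ (\int[lebesgue_measure]_(x in `[(p - r)%R, (p + r)%R]) c%:E)%E).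
  have -> : 2 * c * r = c * (2 * r) by ring.
  by rewrite integral_cst//= lebesgue_ball// -EFinM lexx.
apply: ge0_le_integral => //.
- by move=> x _; rewrite lee_fin ltW.
- by apply/measurable_EFinP; apply: measurable_funTS; exact: measurable_normal_pdf.
- move=> x; rewrite /= in_itv /= => /andP[x1 x2].
  rewrite lee_fin normal_pdfE// /c /normal_fun ler_wpM2l ?normal_peak_ge0// ler_expR.
  rewrite ler_wpM2r ?invr_ge0 ?mulrn_wge0 ?sqr_ge0// lerN2 subr0.
  by move: pM; rewrite ler_norml => /andP[]; nra.
Qed.

End normal_intervals.

Section gaussian_noise.
Context {d : measure_display} {Omega : measurableType d} {R : realType}.
Variable P : probability Omega R.
Variables (F : R -> set (set Omega)) (W : nat * bool -> R -> {RV P >-> R}).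
Variables (eta : nat -> R) (tau : R) (N : nat).
Hypothesis bW : brownian_family F W.
Hypothesis eta_gt0 : forall m, (1 <= m)%N -> 0 < eta m.
Hypothesis tau_gt0 : 0 < tau.
Local Notation VN := (VN R N).
Local Notation idx := ('I_N * bool)%type.
Local Notation noise := (@noise R N d Omega P W eta tau).

Definition increment (k : nat) (j : nat * bool) (w : Omega) : R :=
  W j (k%:R * tau) w - W j (k.-1%:R * tau) w.

Lemma measurable_increment k j : measurable_fun setT (increment k j).
Proof. by apply: measurable_funB. Qed.

Lemma measurable_noise k : measurable_fun setT (noise k).
Proof.
apply: measurable_VN => j; under eq_fun do rewrite of_coordK.
by apply: measurable_funM => //; exact: measurable_increment.
Qed.

HB.instance Definition _ k := isMeasurableFun.Build _ _ _ _ (noise k) (measurable_noise k).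

Let scale (j : nat * bool) (x : R) : R := Num.sqrt (eta j.1.+1) * x.

Let measurable_scale j : measurable_fun setT (scale j).
Proof. exact: measurable_funM. Qed.

Definition coord_law (j : nat * bool) (B : set R) : \bar R :=
  normal_prob 0 (Num.sqrt tau) (scale j @^-1` B).

Lemma increment_law k j B : (0 < k)%N -> measurable B ->
  P (increment k j @^-1` B) = normal_prob 0 (Num.sqrt tau) B.
Proof.
case: k => // k _ mB.
have h := @brownian_increment _ _ _ _ _ _ _ bW j (k%:R * tau) (k.+1%:R * tau) B.
have -> : tau = k.+1%:R * tau - k%:R * tau by rewrite -mulrBl -natrB// subSnn mul1r.
by apply: h => //; rewrite ?mulr_ge0// ?ltW// ltr_pM2r// ltr_nat.
Qed.

Lemma generated_sigma_fun_measurable (I : Type) (D : set I) (X : I -> Omega -> R) i :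
  D i -> measurable_fun setT (X i : g_sigma_algebraType
    [set A | exists2 j, D j & exists2 B, measurable B & A = X j @^-1` B] -> R).
Proof.
move=> Di _ B mB; rewrite setTI; apply: sub_sigma_algebra.
by exists i => //; exists B.
Qed.

Lemma increment_generated k j B : measurable B -> (0 < k)%N ->
  generated_sigma [set t : R | 0 <= t] (fun t => W j t : Omega -> R) (increment k j @^-1` B).
Proof.
move=> mB k0.
have h (t : R) (t0 : 0 <= t) := @generated_sigma_fun_measurable R [set t : R | 0 <= t]
  (fun t => W j t : Omega -> R) t t0.
have hk (n : nat) : 0 <= n%:R * tau by rewrite mulr_ge0// ltW.
have := measurable_funB (h _ (hk k)) (h _ (hk k.-1)).
by move=> /(_ measurableT B mB); rewrite setTI.
Qed.

Lemma noise_box k (B : nat * bool -> set R) : (0 < k)%N ->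
  (forall j, measurable (B j)) ->
  P (noise k @^-1` box B) =
  (\prod_(j : idx) coord_law (nat_of_ord j.1, j.2) (B (nat_of_ord j.1, j.2)))%E.
Proof.
move=> k0 mB.
pose f (j : idx) : nat * bool := (nat_of_ord j.1, j.2).
have f_inj : injective f by move=> [i b] [i' b'] [/val_inj -> ->].
pose A (i : nat * bool) := increment k i @^-1` (scale i @^-1` B i).
have mS i : measurable (scale i @^-1` B i) by rewrite -[X in measurable X]setTI; exact: measurable_scale.
have -> : noise k @^-1` box B = \big[setI/setT]_(i <- map f (index_enum idx)) A i.
  rewrite big_map -bigcap_seq; apply/seteqP; split => [w h j _|w h j].
    by have := h j; rewrite of_coordK.
  by rewrite of_coordK; apply: (h j); rewrite /= mem_index_enum.
have := @brownian_independent _ _ _ _ _ _ _ bW (map f (index_enum idx)) A.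
rewrite map_inj_uniq// index_enum_uniq => -> //.
  by rewrite big_map; apply: eq_bigr => j _; rewrite /A increment_law.
by move=> i _; exact: increment_generated.
Qed.

Definition noise_law : probability VN R := distribution P (noise 1).

(** Box probabilities do not involve [k], and boxes determine the law. At [k = 0] the truncated
    predecessor would make the increment zero. *)
Lemma noise_lawE k A : (0 < k)%N -> measurable A -> P (noise k @^-1` A) = noise_law A.
Proof.
move=> k0 mA.
have := @VN_measure_ext R N (distribution P (noise k)) noise_law.
apply => //; first exact: probability_ltoo.
by move=> B mB; rewrite /noise_law /= /distribution /pushforward !noise_box.
Qed.

Definition cube (p : idx -> R) (r : R) : set VN :=
  [set a | forall j, p j - r <= coord a j <= p j + r].

Let cube_sides (p : idx -> R) (r : R) (i : nat * bool) : set R :=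
  if insub i.1 is Some m then `[p (m, i.2) - r, p (m, i.2) + r]%classic else setT.

Let cube_sidesE p r (j : idx) :
  cube_sides p r (nat_of_ord j.1, j.2) = `[p j - r, p j + r]%classic.
Proof. by case: j => m b; rewrite /cube_sides /= valK. Qed.

Let cube_box p r : cube p r = box (cube_sides p r).
Proof.
by apply/seteqP; split => a h j; have := h j; rewrite cube_sidesE /= in_itv.
Qed.

Let measurable_cube_sides p r i : measurable (cube_sides p r i).
Proof. by rewrite /cube_sides; case: (insub _) => // m; exact: measurable_itv. Qed.

Lemma measurable_cube p r : measurable (cube p r).
Proof. by rewrite cube_box; apply: measurable_box. Qed.

Lemma noise_law_cube p r : noise_law (cube p r) =
  (\prod_(j : idx) coord_law (nat_of_ord j.1, j.2) `[(p j - r)%R, (p j + r)%R])%E.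
Proof.
rewrite cube_box /noise_law /= /distribution /pushforward noise_box//.
by apply: eq_bigr => j _; rewrite cube_sidesE.
Qed.

Let sigma (j : nat * bool) : R := Num.sqrt (eta j.1.+1).

Let sigma_gt0 j : 0 < sigma j.
Proof. by rewrite sqrtr_gt0 eta_gt0. Qed.

Let stau0 : Num.sqrt tau != 0.
Proof. by rewrite gt_eqF// sqrtr_gt0. Qed.

Lemma coord_law_ball j (a r : R) : coord_law j `[(a - r)%R, (a + r)%R] =
  normal_prob 0 (Num.sqrt tau) `[(a / sigma j - r / sigma j)%R, (a / sigma j + r / sigma j)%R].
Proof.
congr (normal_prob _ _ _); apply/seteqP; split => x; rewrite /= !in_itv /= /scale -/(sigma j);
  by rewrite -mulrBl -mulrDl ler_pdivrMr// ler_pdivlMr// ![x * _]mulrC.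
Qed.

Lemma coord_law_fin j B : measurable B -> coord_law j B \is a fin_num.
Proof.
move=> mB; apply: (@fin_num_measure _ _ _ (normal_prob 0 (Num.sqrt tau))).
by rewrite -[X in measurable X]setTI; exact: measurable_scale.
Qed.

Lemma noise_law_cube_fine p r : noise_law (cube p r) =
  (\prod_(j : idx) fine (coord_law (nat_of_ord j.1, j.2) `[(p j - r)%R, (p j + r)%R]))%:E.
Proof.
rewrite noise_law_cube -prodEFin; apply: eq_bigr => j _.
by rewrite fineK//; apply: coord_law_fin; exact: measurable_itv.
Qed.

Lemma coord_law_le j : exists2 C : R, 0 < C & forall a r, 0 <= r ->
  (coord_law j `[(a - r)%R, (a + r)%R] <= (C * r)%:E)%E.
Proof.
exists (2 * normal_peak (Num.sqrt tau) / sigma j).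
  by rewrite divr_gt0// mulr_gt0// normal_peak_gt0.
move=> a r r0; rewrite coord_law_ball.
have r1 : 0 <= r / sigma j by rewrite divr_ge0// ltW.
apply: le_trans (normal_prob_ball_le stau0 _ r1) _.
by rewrite lee_fin le_eqVlt; apply/orP; left; apply/eqP; ring.
Qed.

Lemma coord_law_ge j (M : R) : exists2 c : R, 0 < c & forall a r, `|a| <= M -> 0 <= r <= 1 ->
  ((c * r)%:E <= coord_law j `[(a - r)%R, (a + r)%R])%E.
Proof.
have [c c0 cP] := normal_prob_ball_ge stau0 (M / sigma j) (1 / sigma j).
exists (c / sigma j); first by rewrite divr_gt0.
move=> a r aM /andP[r0 r1]; rewrite coord_law_ball.
apply: le_trans (cP _ _ _ _).
- by rewrite lee_fin le_eqVlt; apply/orP; left; apply/eqP; ring.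
- by rewrite normrM (@gtr0_norm _ (sigma j)^-1) ?invr_gt0// ler_pM2r ?invr_gt0.
- by rewrite divr_ge0 ?(ltW (sigma_gt0 j))//= ler_pM2r ?invr_gt0.
Qed.

(** A coordinate interval has mass at most [C * r] wherever it lies, and at least [c * r / L] when
    its centre is bounded. The radius cancels, leaving [C * L / c] per coordinate. *)
Lemma noise_law_cube_ratio (M L : R) : 1 <= L -> exists2 K : R, 0 < K &
  forall p p' r, (forall j, `|p' j| <= M) -> 0 <= r <= 1 ->
  (noise_law (cube p r) <= K%:E * noise_law (cube p' (r / L)))%E.
Proof.
move=> L1; have L0 : 0 < L by lra.
have /choice[C CP] : forall j : idx, exists C : R, 0 < C /\ forall a r, 0 <= r ->
    (coord_law (nat_of_ord j.1, j.2) `[(a - r)%R, (a + r)%R] <= (C * r)%:E)%E.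
  by move=> j; have [C C0 CP] := coord_law_le (nat_of_ord j.1, j.2); exists C.
have /choice[c cP] : forall j : idx, exists c : R, 0 < c /\ forall a r, `|a| <= M -> 0 <= r <= 1 ->
    ((c * r)%:E <= coord_law (nat_of_ord j.1, j.2) `[(a - r)%R, (a + r)%R])%E.
  by move=> j; have [c c0 cP] := coord_law_ge (nat_of_ord j.1, j.2) M; exists c.
exists (\prod_j (C j * L / c j)).
  by apply: prodr_gt0 => j _; rewrite divr_gt0 ?mulr_gt0//; [case: (CP j)|case: (cP j)].
move=> p p' r p'M /andP[r0 r1]; rewrite !noise_law_cube_fine.
have fin (j : idx) a b : coord_law (nat_of_ord j.1, j.2) `[a, b] \is a fin_num.
  by apply: coord_law_fin; exact: measurable_itv.
rewrite -EFinM lee_fin -big_split /=; apply: ler_prod => j _.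
rewrite fine_ge0/=; last first.
  by apply: integral_ge0 => x _; rewrite lee_fin normal_pdf_ge0.
have [C0 /(_ (p j) r r0) hC] := CP j.
have rL : 0 <= r / L <= 1.
  by rewrite divr_ge0 ?(ltW L0)//= ler_pdivrMr// mul1r (le_trans r1).
have [c0 /(_ _ _ (p'M j) rL) hc] := cP j.
rewrite -lee_fin EFinM !fineK//; apply: le_trans hC _.
apply: (@le_trans _ _ ((C j * L / c j)%:E * (c j * (r / L))%:E)%E).
  rewrite -EFinM lee_fin le_eqVlt; apply/orP; left; apply/eqP; field.
  by rewrite !gt_eqF.
by rewrite lee_wpmul2l// lee_fin divr_ge0 ?mulr_ge0 ?ltW.
Qed.

Lemma noise_law_cube_gt0 p r : 0 < r -> (0 < noise_law (cube p r))%E.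
Proof.
move=> r0; have r1 : 0 < Num.min r 1 by rewrite lt_min r0 ltr01.
apply: (@lt_le_trans _ _ (noise_law (cube p (Num.min r 1)))); last first.
  apply: le_measure; rewrite ?inE; try exact: measurable_cube.
  move=> a h j; have /andP[h1 h2] := h j.
  have : Num.min r 1 <= r by rewrite ge_min lexx.
  by move=> h3; apply/andP; split; lra.
have /choice[c cP] : forall j : idx, exists c : R, 0 < c /\
    (c%:E <= coord_law (nat_of_ord j.1, j.2) `[(p j - Num.min r 1)%R, (p j + Num.min r 1)%R])%E.
  move=> j; have [c c0 cP] := coord_law_ge (nat_of_ord j.1, j.2) `|p j|.
  exists (c * Num.min r 1); split; first exact: mulr_gt0.
  by apply: cP => //; rewrite (ltW r1) ge_min lexx orbT.
rewrite noise_law_cube_fine; apply: (@lt_le_trans _ _ (\prod_j (c j))%:E).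
  by rewrite lte_fin; apply: prodr_gt0 => j _; case: (cP j).
have fin (j : idx) a b : coord_law (nat_of_ord j.1, j.2) `[a, b] \is a fin_num.
  by apply: coord_law_fin; exact: measurable_itv.
rewrite lee_fin; apply: ler_prod => j _; have [c0 cj] := cP j.
by rewrite (ltW c0)/= -lee_fin fineK.
Qed.

Lemma adapted_noise_indep k (X : Omega -> VN) A B :
  (forall C, measurable C -> F (k%:R * tau) (X @^-1` C)) ->
  measurable A -> measurable B ->
  P (X @^-1` A `&` noise k.+1 @^-1` B) = (P (X @^-1` A) * noise_law B)%E.
Proof.
move=> FX mA mB; rewrite -(@noise_lawE k.+1)//.
have t0 : 0 <= k%:R * tau by rewrite mulr_ge0// ltW.
have tS : k%:R * tau <= k.+1%:R * tau by rewrite ler_pM2r// ler_nat.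
apply: (brownian_indep_past bW t0 tS).
  exact: FX.
pose G := g_sigma_algebraType [set A | exists2 j, setT j & exists2 B, measurable B &
  A = (fun w => W j (k.+1%:R * tau) w - W j (k%:R * tau) w) @^-1` B].
have mn : measurable_fun setT (noise k.+1 : G -> VN).
  apply: measurable_VN => j.
  have -> : (fun w : G => coord (noise k.+1 w) j) =
      (fun w => Num.sqrt (eta j.1.+1) * (W (nat_of_ord j.1, j.2) (k.+1%:R * tau) w -
                  W (nat_of_ord j.1, j.2) (k%:R * tau) w)).
    by apply/funext => w; rewrite /noise of_coordK.
  apply: measurable_funM => //.
  exact: (@generated_sigma_fun_measurable _ setT
    (fun j w => W j (k.+1%:R * tau) w - W j (k%:R * tau) w) (nat_of_ord j.1, j.2)).
by have := mn measurableT B mB; rewrite setTI.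
Qed.

(** The Markov property in integrated form: by independence the joint law of state and noise is a
    product, as rectangles show, and Tonelli integrates the noise with the state frozen. *)
Lemma adapted_noise_integral k (X : Omega -> VN) (h : VN * VN -> \bar R) :
  (forall C, measurable C -> F (k%:R * tau) (X @^-1` C)) ->
  measurable_fun setT h -> (forall a, 0 <= h a)%E ->
  (\int[P]_w h (X w, noise k.+1 w) = \int[P]_w \int[noise_law]_z h (X w, z))%E.
Proof.
move=> FX mh h0.
have Fm : F (k%:R * tau) `<=` measurable.
  have t0 : 0 <= k%:R * tau by rewrite mulr_ge0// ltW.
  by have [/(_ _ t0)[]] := brownian_filtration bW.
have mX : measurable_fun setT X by move=> _ C mC; rewrite setTI; apply: Fm; exact: FX.
pose Xf : {mfun Omega >-> VN} := mfun_Sub (mem_set mX).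
have mXY : measurable_fun setT (fun w => (X w, noise k.+1 w)).
  by apply: measurable_fun_pair => //; exact: measurable_noise.
pose XY : {mfun Omega >-> (VN * VN)%type} := mfun_Sub (mem_set mXY).
have E S : measurable S -> (distribution P Xf \x noise_law)%E S = distribution P XY S.
  move=> mS; apply: product_measure_unique => // A B mA mB.
  exact: (adapted_noise_indep FX mA mB).
transitivity (\int[distribution P XY]_a h a)%E.
  by rewrite ge0_integral_distribution.
rewrite (eq_measure_integral (distribution P Xf \x noise_law)%E); last first.
  by move=> S mS _; apply/esym; exact: E.
rewrite fubini_tonelli1//.
rewrite (@ge0_integral_distribution _ _ _ _ _ P Xf (fubini_F noise_law h)) //.
  by apply: measurable_fun_fubini_tonelli_F.
by move=> a; apply: integral_ge0 => z _.
Qed.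

End gaussian_noise.

(** * The solution map *)

Section flow.
Context {R : realType}.
Variable N : nat.
Variables (c tau lambda : R).
Local Notation VN := (VN R N).
Local Notation idx := ('I_N * bool)%type.
Local Notation psi := (@psi R N c tau lambda).
Hypothesis tau_gt0 : 0 < tau.
Hypothesis lambda1 : lambda = 1 \/ lambda = -1.
Hypothesis kappa_lt1 : tau * (N%:R * pi) ^+ 2 < 1.
Hypothesis psi_dense : forall v z r, 0 < r ->
  exists u, forall j, `|psi v u j - coord z j| <= r.

(** The added 1 ensures that dividing a radius by this constant never enlarges it, as the cube
    comparison requires. *)
Definition psi_lip : R := 1 + 8 * N%:R / (1 - tau * (N%:R * pi) ^+ 2).

Lemma psi_lip_ge1 : 1 <= psi_lip.
Proof. by rewrite lerDl divr_ge0 ?mulr_ge0// subr_ge0 ltW. Qed.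

Let L := psi_lip.
Let L0 : 0 < L.
Proof. by apply: lt_le_trans psi_lip_ge1. Qed.

Let two0 : 0 < 2 :> R. Proof. by []. Qed.

Lemma psi_lipP v u u' delta : (forall j, `|psi v u j - psi v u' j| <= delta) ->
  forall j, `|coord u j - coord u' j| <= L * delta.
Proof.
move=> h j; apply: le_trans (psi_inverse_lipschitz tau_gt0 lambda1 kappa_lt1 h j) _.
by rewrite ler_wpM2r ?lerDr// (le_trans _ (h j)).
Qed.

Lemma flow_exists v z : exists u, forall j, psi v u j = coord z j.
Proof.
have /choice[U UP] : forall n : nat, exists u, forall j, `|psi v u j - coord z j| <= n.+1%:R^-1.
  by move=> n; apply: psi_dense; rewrite invr_gt0.
have dU n m j : `|coord (U n) j - coord (U m) j| <= L * (n.+1%:R^-1 + m.+1%:R^-1).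
  apply: psi_lipP => i; apply: le_trans (ler_distD (coord z i) _ _) _.
  by apply: lerD => //; rewrite distrC.
have cU j : cvgn (fun n => coord (U n) j).
  apply: cauchy_cvg; apply: cauchy_exP => e e0.
  have [m _ mP] := near_infty_natSinv_lt (PosNum (divr_gt0 e0 (mulr_gt0 two0 L0))).
  exists (coord (U m) j); exists m => // n mn; rewrite /= /ball /=.
  apply: le_lt_trans (dU m n j) _; rewrite mulrC -ltr_pdivlMr//.
  have := mP m (leqnn m); have := mP n mn; rewrite /= => h1 h2.
  apply: lt_le_trans (ltrD h2 h1) _; rewrite invfM mulrA -mulrDl.
  by rewrite ler_pM2r ?invr_gt0//; lra.
pose u := of_coord (fun j => lim (coord (U n) j @[n --> \oo])); exists u => j.
have h1 : psi v (U n) j @[n --> \oo] --> psi v u j.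
  by apply: psi_cvg => i; rewrite of_coordK; exact: cU.
have h2 : psi v (U n) j @[n --> \oo] --> coord z j.
  apply/cvgrPdist_le => e e0; have [m _ mP] := near_infty_natSinv_lt (PosNum e0).
  exists m => // n mn; rewrite /= distrC; apply: le_trans (UP n j) _.
  by apply: ltW; exact: mP.
exact: cvg_unique h1 h2.
Qed.

Definition flow v z : VN := projT1 (cid (flow_exists v z)).

Lemma flowP v z j : psi v (flow v z) j = coord z j.
Proof. exact: (projT2 (cid (flow_exists v z))). Qed.

Lemma flow_unique v z u : (forall j, psi v u j = coord z j) -> u = flow v z.
Proof.
move=> uz; apply: coord_inj => j; apply/eqP; rewrite -subr_eq0 -normr_eq0 eq_le normr_ge0 andbT.
by rewrite -(mulr0 L); apply: (@psi_lipP v) => i; rewrite uz flowP subrr normr0.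
Qed.

Let rat_point (q : {ffun idx -> rat}) : VN := of_coord (fun j => ratr (q j)).

(** [flow] is obtained by choice, so measurability is read off the equation: its j-th coordinate
    exceeds [x] iff some rational point solves the equation up to 1/(n+1) and its j-th coordinate
    exceeds [x] by more than L/(n+1). The Lipschitz bound gives one direction, continuity of [psi]
    at the solution the other. *)
Lemma measurable_flow : measurable_fun setT (fun vz : VN * VN => flow vz.1 vz.2).
Proof.
apply: measurable_VN => j _; apply: (measurability _ (RGenOInfty.measurableE R)) => //.
move=> _ [_ [x ->] <-]; rewrite setTI.
pose S (q : {ffun idx -> rat} * nat) : set (VN * VN) :=
  if x < coord (rat_point q.1) j - L / q.2.+1%:R then
    \bigcap_(i : idx) [set vz | `|psi vz.1 (rat_point q.1) i - coord vz.2 i| <= q.2.+1%:R^-1]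
  else set0.
have -> : (fun vz : VN * VN => coord (flow vz.1 vz.2) j) @^-1` `]x, +oo[%classic = \bigcup_q S q.
  apply/seteqP; split => [[v z]|[v z] [[q n] _]]; rewrite /S /= in_itv /= andbT.
    move=> xf; pose e := coord (flow v z) j - x.
    have e0 : 0 < e by rewrite subr_gt0.
    (* 2 L / (n+1) < e: one L/(n+1) is the distance from the rational point to the solution, the
       other the margin demanded in [S]. *)
    have [n _ nP] := near_infty_natSinv_lt (PosNum (divr_gt0 e0 (mulr_gt0 two0 L0))).
    have /choice[Q QP] : forall k : nat, exists q : {ffun idx -> rat},
        forall i, `|coord (flow v z) i - ratr (q i)| < k.+1%:R^-1.
      move=> k; have /choice[q qP] : forall i : idx, exists a : rat,
          `|coord (flow v z) i - ratr a| < k.+1%:R^-1.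
        move=> i; have : coord (flow v z) i < coord (flow v z) i + k.+1%:R^-1 by rewrite ltrDl invr_gt0.
        move=> /rat_in_itvoo[a]; rewrite in_itv /= => /andP[a1 a2]; exists a.
        by rewrite distrC gtr0_norm ?subr_gt0// ltrBlDl.
      by exists [ffun i => q i] => i; rewrite ffunE.
    have cQ i : psi v (rat_point (Q k)) i @[k --> \oo] --> coord z i.
      rewrite -(flowP v z); apply: psi_cvg => {}i; apply/cvgrPdist_le => d d0.
      have [m _ mP] := near_infty_natSinv_lt (PosNum d0).
      exists m => // k mk; rewrite /= of_coordK; apply: ltW; apply: lt_trans (QP k i) _.
      exact: mP.
    have [k kP] : exists k, forall i, `|psi v (rat_point (Q k)) i - coord z i| <= n.+1%:R^-1.
      have : \forall k \near \oo, forall i, `|psi v (rat_point (Q k)) i - coord z i| <= n.+1%:R^-1.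
        apply: filter_forall => i; move/cvgrPdist_le: (cQ i) => /(_ n.+1%:R^-1).
        rewrite invr_gt0 ltr0Sn => /(_ isT); apply: filterS => k /=.
        by rewrite distrC.
      by case=> k _ kP; exists k; exact: (kP k (leqnn k)).
    exists (Q k, n) => //=; rewrite ifT; first by move=> i _; exact: kP.
    have : `|coord (rat_point (Q k)) j - coord (flow v z) j| <= L * n.+1%:R^-1.
      by apply: (@psi_lipP v) => i; rewrite flowP.
    have := nP n (leqnn n); rewrite /= ltr_pdivlMr ?mulr_gt0// => h1.
    rewrite ler_norml => /andP[h2 _]; move: h1; rewrite /e mulrCA [_^-1 * L]mulrC.
    move: (coord _ _) (coord _ _) (L / _) h2 => a b e'; lra.
  case: ifPn => // xq h.
  have : `|coord (rat_point q) j - coord (flow v z) j| <= L * n.+1%:R^-1.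
    by apply: (@psi_lipP v) => i; rewrite flowP; exact: h.
  by rewrite ler_norml => /andP[_]; move: (coord _ _) (coord _ _) (L / _) xq => a b e'; lra.
apply: countable_bigcupT_measurable; first exact: countableP.
move=> q; rewrite /S; case: ifPn => // _; apply: fin_bigcap_measurable => // i _; rewrite -[X in measurable X]setTI.
have mf : measurable_fun setT (fun vz : VN * VN => `|psi vz.1 (rat_point q.1) i - coord vz.2 i|).
  apply: measurableT_comp => //; apply: measurable_funB.
    apply: psi_measurable => k; last exact: measurable_cst.
    by apply: (measurableT_comp (@measurable_coord R N k)); exact: measurable_fst.
  by apply: (measurableT_comp (@measurable_coord R N i)); exact: measurable_snd.
have := mf measurableT _ (measurable_itv `]-oo, q.2.+1%:R^-1]).
by congr (measurable (_ `&` _)); apply/seteqP; split => vz /=; rewrite in_itv.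
Qed.

End flow.

(** * Minorization of the transition kernel *)

Section minorization.
Context {R : realType}.
Variable N : nat.
Variables (c tau lambda : R).
Local Notation VN := (VN R N).
Local Notation idx := ('I_N * bool)%type.
Local Notation psi := (@psi R N c tau lambda).
Local Notation L := (@psi_lip R N tau).
Hypothesis tau_gt0 : 0 < tau.
Hypothesis lambda1 : lambda = 1 \/ lambda = -1.
Hypothesis kappa_lt1 : tau * (N%:R * pi) ^+ 2 < 1.
Variable gamma : probability VN R.
Hypothesis gamma_gt0 : forall p r, 0 < r -> (0 < gamma (cube p r))%E.
Hypothesis gamma_ratio : forall M l : R, 1 <= l -> exists2 K : R, 0 < K &
  forall p p' r, (forall j, `|p' j| <= M) -> 0 <= r <= 1 ->
  (gamma (cube p r) <= K%:E * gamma (cube p' (r / l)))%E.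
Variable Phi : VN -> VN -> VN.
Hypothesis PhiP : forall v z j, psi v (Phi v z) j = coord z j.
Hypothesis mPhi : measurable_fun setT (fun vz : VN * VN => Phi vz.1 vz.2).

Lemma measurable_Phi v : measurable_fun setT (Phi v).
Proof. exact: measurableT_comp mPhi (measurable_pair1 v). Qed.

Definition step_kernel v : probability VN R :=
  distribution gamma (mfun_Sub (mem_set (measurable_Phi v)) : {mfun VN >-> VN}).

Lemma step_kernelE v A : step_kernel v A = gamma (Phi v @^-1` A).
Proof. by []. Qed.

Lemma measurable_step_kernel A : measurable A ->
  measurable_fun setT (fun v => step_kernel v A).
Proof.
move=> mA; have := measurable_fun_xsection gamma (mPhi measurableT mA).
by apply: eq_measurable_fun => v _; rewrite /= /xsection; congr (gamma _);
  apply/seteqP; split => z; rewrite /= ?inE setTI.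
Qed.

Lemma step_kernel_cube_ge v p r :
  (gamma (cube (psi v p) (r / L)) <= step_kernel v (cube (coord p) r))%E.
Proof.
have L0 : 0 < L by apply: lt_le_trans (psi_lip_ge1 kappa_lt1).
rewrite step_kernelE; apply: le_measure; rewrite ?inE; first exact: measurable_cube.
  rewrite -[X in measurable X]setTI; apply: measurable_Phi => //; exact: measurable_cube.
move=> z zp j; rewrite -ler_distl; have := @psi_lipP _ _ c tau lambda tau_gt0 lambda1 kappa_lt1 v (Phi v z) p (r / L).
rewrite mulrCA divff ?gt_eqF// mulr1; apply => i; rewrite PhiP ler_distl.
exact: zp.
Qed.

Lemma step_kernel_minor (r : R) : 0 <= r -> exists2 C : R, 0 < C &
  forall v A, (forall j, `|coord v j| <= r) -> measurable A ->
  (gamma (A `&` cube (fun=> 0%R) 1) <= C%:E * step_kernel v A)%E.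
Proof.
move=> r0; have r20 : 0 <= r + 2 by rewrite addr_ge0.
(* [r + 2] bounds both [v] and the centre of any cell that meets the unit cube, so [M] bounds the
   image of the centre. *)
have [M MP] := @psi_bounded R N c tau lambda _ r20.
have L1 : 1 <= L := psi_lip_ge1 kappa_lt1; have L0 : 0 < L by apply: lt_le_trans L1.
(* A cell of side [h] lies in the cube of radius [h] about its centre and contains that of radius
   [h / 4]; radius [h / 2] would touch the excluded faces. The factor [L] is the loss under the
   Lipschitz map. *)
have [C C0 CP] := @gamma_ratio M (4 * L) ltac:(lra).
exists C => // v A vr mA.
have foo : (mrestr gamma (measurable_cube (fun=> 0%R) 1) setT < +oo)%E.
  apply: le_lt_trans (probability_ltoo gamma); apply: le_measure; rewrite ?inE//.
  by apply: measurableI => //; exact: measurable_cube.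
suff cell_le m k : (0 <= m)%N -> (mrestr gamma (measurable_cube (fun=> 0%R) 1) (cell m @^-1` [set k]) <=
    C%:E * step_kernel v (cell m @^-1` [set k]))%E.
  exact: (cell_measure_le foo (probability_ltoo (step_kernel v)) (ltW C0) cell_le mA).
move=> _; rewrite /mrestr.
have h0 : 0 < 2 ^+ m :> R by rewrite exprn_gt0.
have h1 : (2 ^+ m)^-1 <= 1 :> R by rewrite invf_le1// exprn_ege1// ler1n.
set h := (2 ^+ m)^-1 in h1; have hh0 : 0 < h by rewrite invr_gt0.
have [e|/eqP/set0P[a [ak a1]]] :=
    pselect (cell m @^-1` [set k] `&` (cube (fun=> 0%R) 1 : set VN) = set0).
  by rewrite e measure0 mule_ge0// lee_fin ltW.
pose p : VN := of_coord (fun j => ((k j)%:~R + 2^-1) * h).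
have cellE b : cell m b = k -> forall j, (k j)%:~R * h <= coord b j < ((k j)%:~R + 1) * h.
  move=> /cellP bk j; have := bk j; rewrite intrD ![(2 ^+ m) * _]mulrC.
  by rewrite -ler_pdivrMr// -ltr_pdivlMr.
have p2 j : `|coord p j| <= r + 2.
  have := cellE a ak j; have := a1 j; rewrite of_coordK ler_norml.
  by move: (coord a j) => x; nra.
apply: (@le_trans _ _ (gamma (cube (coord p) h))).
  apply: le_measure; rewrite ?inE; last 1 first.
  - move=> b [/cellE bk _] j; have := bk j; rewrite of_coordK; move: (coord b j) => x; nra.
  - by apply: measurableI; [exact: measurable_cell1|exact: measurable_cube].
  - exact: measurable_cube.
apply: le_trans (CP _ (psi v p) h _ _) _.
- apply: MP => // j; apply: le_trans (vr j) _; by rewrite lerDl.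
- by rewrite (ltW hh0).
rewrite lee_pmul2l// ?lte_fin// invfM mulrA; apply: le_trans (step_kernel_cube_ge _ _ _) _.
apply: le_measure; rewrite ?inE; [exact: measurable_cube|exact: measurable_cell1|].
move=> b bp; apply/cellP => j; have := bp j; rewrite of_coordK intrD => bpj.
rewrite ![(2 ^+ m) * _]mulrC -ler_pdivrMr// -ltr_pdivlMr// -/h.
by move: (coord b j) bpj => x; lra.
Qed.

Lemma step_kernel_recurrent : exists2 r : R, 0 <= r &
  forall v, (gamma (cube (fun=> 0%R) 1) <= step_kernel v (cube (fun=> 0%R) r))%E.
Proof.
(* The bound of [psi_preimage_bounded] for noise in the unit cube, that is with [M = 1]. *)
exists (1 + 2 / tau * (1 + 1 + 1 * N%:R + (2 * tau)^-1)).
  rewrite addr_ge0// mulr_ge0 ?divr_ge0 ?(ltW tau_gt0)// !addr_ge0 ?mulr_ge0// invr_ge0.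
  by rewrite mulr_ge0// ltW.
move=> v; rewrite step_kernelE; apply: le_measure; rewrite ?inE; first exact: measurable_cube.
  rewrite -[X in measurable X]setTI; apply: measurable_Phi => //; exact: measurable_cube.
move=> z z1 j; rewrite -ler_distl subr0.
apply: (psi_preimage_bounded (c := c) tau_gt0 lambda1 kappa_lt1 ler01 (v := v)) => i.
by rewrite PhiP; have := z1 i; rewrite sub0r add0r -ler_norml.
Qed.

Lemma step_kernel_doeblin : exists (eta : {measure set VN -> \bar R}) (e : R),
  [/\ eta setT = e%:E, 0 < e & forall f x, bddm f -> (forall y, 0 <= f y) ->
     \int[eta]_y f y <= iter 2 (markov_op step_kernel) f x].
Proof.
have [r r0 rP] := step_kernel_recurrent; have [C C0 CP] := step_kernel_minor r0.
pose g := fine (gamma (cube (fun=> 0%R) 1)).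
have gE : gamma (cube (fun=> 0%R) 1) = g%:E by rewrite fineK// fin_num_measure//; exact: measurable_cube.
have g0 : 0 < g by rewrite -lte_fin -gE gamma_gt0.
have gC0 : 0 <= g / C by rewrite divr_ge0 ?ltW.
(* The first step reaches the bounded cube with probability at least [g], the second charges the
   unit cube with at least [gamma / C]; the product has total mass [g / C * g]. *)
pose eta := mscale (NngNum gC0) (mrestr gamma (measurable_cube (fun=> 0%R) 1)).
exists eta, (g / C * g); split.
- have mT : mrestr gamma (measurable_cube (fun=> 0%R) 1) setT = g%:E by rewrite /mrestr setTI gE.
  exact: (congr1 (fun t => ((g / C)%:E * t)%E) mT).
- by rewrite mulr_gt0// divr_gt0.
have mop := markov_op_bddm measurable_step_kernel.
move=> f x bf f0; have [mf [D fD]] := bf.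
pose I := \int[mrestr gamma (measurable_cube (fun=> 0%R) 1)]_y f y.
have foo : (mrestr gamma (measurable_cube (fun=> 0%R) 1) setT < +oo)%E.
  by rewrite /mrestr setTI gE ltry.
have mfE : measurable_fun setT (EFin \o f) by apply/measurable_EFinP.
have fE0 y : setT y -> (0 <= (EFin \o f) y)%E by move=> _; rewrite lee_fin.
have I0 : 0 <= I by apply: Rintegral_ge0.
have etaE : \int[eta]_y f y = g / C * I.
  by rewrite /I /Rintegral (ge0_integral_mscale _ _ _ mfE fE0)// -(bddm_fine foo bf).
have opf v : (forall j, `|coord v j| <= r) -> I / C <= markov_op step_kernel f v.
  move=> vr; rewrite ler_pdivrMr// mulrC -lee_fin EFinM.
  rewrite (bddm_fine foo bf) /markov_op (bddm_fine (probability_ltoo (step_kernel v)) bf).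
  have -> : (C%:E * \int[step_kernel v]_x0 (f x0)%:E =
     \int[mscale (NngNum (ltW C0)) (step_kernel v)]_x0 (f x0)%:E)%E.
    by rewrite (ge0_integral_mscale _ _ _ mfE fE0).
  apply: (ge0_le_measure_integral _ measurableT (fun y => fE0 y Logic.I) mfE) => S mS.
  exact: CP.
have mB : measurable (cube (fun=> 0%R) r : set VN) by exact: measurable_cube.
rewrite etaE; apply: (@le_trans _ _ (markov_op step_kernel (fun v => I / C * \1_(cube (fun=> 0%R) r) v) x)).
  rewrite markov_opZ; last exact: bddm_indic.
  rewrite [leLHS]mulrAC [g * I]mulrC mulrAC ler_wpM2l ?divr_ge0 ?(ltW C0)//.
  rewrite -lee_fin /markov_op bddm_fine; [|exact: probability_ltoo|exact: bddm_indic].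
  by rewrite integral_indic// setIT -gE; exact: rP.
apply: markov_op_le; [exact/bddmZ/bddm_indic|exact: mop|] => v.
rewrite indicE; case: (boolP (v \in _)) => [/set_mem vr|_].
  by rewrite mulr1; apply: opf => j; have := vr j; rewrite sub0r add0r -ler_norml.
by rewrite mulr0; apply: Rintegral_ge0.
Qed.

End minorization.

(** * The Markov chain of the scheme *)

Section scheme_chain.
Context {d : measure_display} {Omega : measurableType d} {R : realType}.
Variable P : probability Omega R.
Variables (F : R -> set (set Omega)) (W : nat * bool -> R -> {RV P >-> R}).
Variables (eta : nat -> R) (alpha lambda tau : R) (N : nat).
Hypothesis bW : brownian_family F W.
Hypothesis eta_gt0 : forall m, (1 <= m)%N -> 0 < eta m.
Hypothesis tau_gt0 : 0 < tau.
Hypothesis lambda1 : lambda = 1 \/ lambda = -1.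
Hypothesis kappa_lt1 : tau * (N%:R * pi) ^+ 2 < 1.
Local Notation VN := (VN R N).
Local Notation idx := ('I_N * bool)%type.
Local Notation noise := (@noise R N d Omega P W eta tau).
Let c := expR (- (alpha * tau)).
Local Notation psi := (@psi R N c tau lambda).
Variable U : (R -> R[i]) -> nat -> Omega -> VN.
Hypothesis HU : forall u0, square_integrable u0 ->
  scheme_solution F W eta alpha lambda tau u0 (U u0).

Let chain (y : VN) k : Omega -> VN := U (VN_fun y) k.
Let gamma := noise_law W eta tau N.

Lemma chain_adapted y k C : measurable C -> F (k%:R * tau) (chain y k @^-1` C).
Proof. by have [+ _ _] := HU (square_integrable_VN_fun y); apply. Qed.

Lemma measurable_chain y k : measurable_fun setT (chain y k).
Proof.
move=> _ C mC; rewrite setTI.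
have t0 : 0 <= k%:R * tau by rewrite mulr_ge0// ltW.
have [/(_ _ t0)[_ Fm] _] := brownian_filtration bW; apply: Fm; exact: chain_adapted.
Qed.

Lemma chain_start y : {ae P, forall w, chain y 0 w = y}.
Proof.
have [_ + _] := HU (square_integrable_VN_fun y); apply: filterS => w h.
by apply: VN_fun_inj => x x01; rewrite h// projection_VN_fun.
Qed.

Lemma chain_step y k : {ae P, forall w, forall j,
  psi (chain y k w) (chain y k.+1 w) j = coord (noise k.+1 w) j}.
Proof.
have [_ _ /(_ k.+1 isT)] := HU (square_integrable_VN_fun y); apply: filterS => w h.
exact: scheme_step_psi h.
Qed.

(* Any cube has positive noise probability, so it meets the almost sure event
   on which the first step of the chain solves the implicit equation. *)
Lemma scheme_psi_dense v z r : 0 < r -> exists u, forall j, `|psi v u j - coord z j| <= r.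
Proof.
move=> r0; apply: contrapT => nex.
have : (0 < P (noise 1 @^-1` cube (coord z) r))%E.
  exact: (noise_law_cube_gt0 bW eta_gt0 tau_gt0 (coord z) r0).
have : P.-negligible (noise 1 @^-1` cube (coord z) r).
  have : {ae P, forall w, ~ (noise 1 @^-1` cube (coord z) r) w}.
    apply: filterS2 (chain_start v) (chain_step v 0) => w cv cs zw; apply: nex.
    by exists (chain v 1 w) => j; rewrite -{1}cv cs ler_distl; exact: zw.
  by apply: negligibleS => w zw; exact.
have mn : measurable (noise 1 @^-1` cube (coord z) r).
  by rewrite -[X in measurable X]setTI; apply: measurable_noise => //; exact: measurable_cube.
by move/negligibleP => /(_ mn) ->; rewrite ltxx.
Qed.

Let Phi := flow tau_gt0 lambda1 kappa_lt1 scheme_psi_dense.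

Let mPhi : measurable_fun setT (fun vz : VN * VN => Phi vz.1 vz.2).
Proof. exact: measurable_flow. Qed.

Let K := step_kernel gamma mPhi.

Let mK := measurable_step_kernel gamma mPhi.

Definition chain_law k y : probability VN R :=
  distribution P (mfun_Sub (mem_set (measurable_chain y k)) : {mfun Omega >-> VN}).

Lemma ge0_chain_law k y (f : VN -> \bar R) : measurable_fun setT f -> (forall v, 0 <= f v)%E ->
  (\int[chain_law k y]_v f v = \int[P]_w f (chain y k w))%E.
Proof. by move=> mf f0; rewrite ge0_integral_distribution. Qed.

Lemma chain_law0 y (f : VN -> \bar R) : measurable_fun setT f -> (forall v, 0 <= f v)%E ->
  (\int[chain_law 0 y]_v f v = f y)%E.
Proof.
move=> mf f0; rewrite ge0_chain_law//.
transitivity (\int[P]_w cst (f y) w)%E.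
  apply: ae_eq_integral => //.
  - exact: measurableT_comp mf (measurable_chain y 0).
  - by have := chain_start y; apply: filterS => w -> _.
by rewrite integral_cst//= (probability_setT P) mule1.
Qed.

(** By uniqueness the new state is almost surely [Phi] of the old state and the fresh noise, which
    is independent of the past. *)
Lemma chain_lawS k y (f : VN -> \bar R) : measurable_fun setT f -> (forall v, 0 <= f v)%E ->
  (\int[chain_law k.+1 y]_v f v = \int[chain_law k y]_v \int[K v]_u f u)%E.
Proof.
move=> mf f0; rewrite ge0_chain_law//.
pose h (vz : VN * VN) := f (Phi vz.1 vz.2).
have mh : measurable_fun setT h by exact: measurableT_comp mf mPhi.
transitivity (\int[P]_w h (chain y k w, noise k.+1 w))%E.
  apply: ae_eq_integral => //.
  - exact: measurableT_comp mf (measurable_chain y k.+1).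
  - apply: measurableT_comp mh _; apply: measurable_fun_pair; first exact: measurable_chain.
    exact: measurable_noise.
  - have := chain_step y k; apply: filterS => w h1 _; rewrite /h /=.
    by congr f; apply: flow_unique.
rewrite (adapted_noise_integral eta bW tau_gt0 (@chain_adapted y k) mh) => [|a]; last exact: f0.
have E v : (\int[gamma]_z h (v, z) = \int[K v]_u f u)%E.
  by apply/esym; exact: ge0_integral_distribution.
rewrite ge0_chain_law//; last by move=> v; apply: integral_ge0 => u _.
  by apply: eq_integral => w _; rewrite E.
apply: measurable_fun_integral_kernel => //.
Qed.

Let op := markov_op K.

(** Shifting by a constant reduces identities on bounded functions to nonnegative ones, for which
    change of variables and Tonelli need no integrability. *)
Lemma eq_bddm_functional (S T : (VN -> R) -> R) :
  (forall f C, bddm f -> S (f \+ cst C) = S f + C) ->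
  (forall f C, bddm f -> T (f \+ cst C) = T f + C) ->
  (forall f, bddm f -> (forall v, 0 <= f v) -> S f = T f) ->
  forall f, bddm f -> S f = T f.
Proof.
move=> SD TD ST f bf; have [_ [C fC]] := bf.
apply: (@addIr _ C); rewrite -SD// -TD//; apply: ST.
  by apply: bddmD => //; exact: bddm_cst.
by move=> v /=; rewrite -lerBlDr sub0r; have := fC v; rewrite ler_norml => /andP[].
Qed.

Let markov_op_shift (Q : VN -> probability VN R) y f C : bddm f ->
  markov_op Q (f \+ cst C) y = markov_op Q f y + C.
Proof. by move=> bf; rewrite markov_opD ?markov_op_cst//; exact: bddm_cst. Qed.

Let bddm_op f : bddm f -> bddm (op f).
Proof. exact: markov_op_bddm. Qed.

Lemma markov_op_chain_lawS k f y : bddm f ->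
  markov_op (chain_law k.+1) f y = markov_op (chain_law k) (op f) y.
Proof.
move: f; apply: (@eq_bddm_functional (markov_op (chain_law k.+1) ^~ y)
  (fun f => markov_op (chain_law k) (op f) y)) => [f C bf|f C bf|f bf f0].
- exact: markov_op_shift.
- rewrite -markov_op_shift; last exact: bddm_op.
  by congr (markov_op _ _ _); apply/funext => v; exact: markov_op_shift.
- have mf : measurable_fun setT (EFin \o f) by apply/measurable_EFinP; case: bf.
  have fE0 v : (0 <= (EFin \o f) v)%E by rewrite lee_fin.
  suff : (markov_op (chain_law k.+1) f y)%:E = (markov_op (chain_law k) (op f) y)%:E by case.
  rewrite [LHS](bddm_fine (probability_ltoo _) bf).
  rewrite [RHS](bddm_fine (probability_ltoo _) (bddm_op bf)).
  rewrite [LHS](chain_lawS k y mf fE0); apply: eq_integral => v _.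
  by rewrite [RHS](bddm_fine (probability_ltoo _) bf).
Qed.

(** The last step is peeled off, not the first: restarting [U] from a random state would need
    measurability of [U] in the initial value. *)
Lemma chain_law_iter k f y : bddm f -> \int[chain_law k y]_v f v = iter k op f y.
Proof.
elim: k f => [|k ih] f bf.
  move: f bf; apply: (@eq_bddm_functional (markov_op (chain_law 0) ^~ y) (fun f => f y)).
  - by move=> f C bf; exact: markov_op_shift.
  - by [].
  - move=> f bf f0.
    have mf : measurable_fun setT (EFin \o f) by apply/measurable_EFinP; case: bf.
    have fE0 v : (0 <= (EFin \o f) v)%E by rewrite lee_fin.
    suff : (markov_op (chain_law 0) f y)%:E = (f y)%:E by case.
    by rewrite [LHS](bddm_fine (probability_ltoo _) bf) [LHS](chain_law0 y mf fE0).
rewrite iterSr -ih; first exact: markov_op_chain_lawS.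
exact: markov_op_bddm.
Qed.

(** Dependence on [y] is controlled only here, through the iterates of the kernel. *)
Lemma measurable_chain_law k A : measurable A -> measurable_fun setT (fun y => chain_law k y A).
Proof.
move=> mA; have bA := bddm_indic R mA.
have -> : (fun y => chain_law k y A) = EFin \o iter k op \1_A.
  apply/funext => y; rewrite /= -chain_law_iter// bddm_fine ?probability_ltoo//.
  by rewrite integral_indic// setIT.
apply/measurable_EFinP.
by case: (iter_markov_op_bddm mK k bA).
Qed.

Lemma transition_chain_law k phi y : measurable_fun setT phi ->
  transition P U k phi y = \int[chain_law k y]_z phi z.
Proof.
move=> mphi; rewrite /transition unlock /Rintegral; congr fine.
have mE : measurable_fun setT (EFin \o phi) by apply/measurable_EFinP.
rewrite [LHS]integralE [RHS]integralE.
have pE := ge0_chain_law k y (measurable_funepos mE) (funepos_ge0 (EFin \o phi)).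
have nE := ge0_chain_law k y (measurable_funeneg mE) (funeneg_ge0 (EFin \o phi)).
congr (_ - _)%E; apply/esym.
  by rewrite [LHS]pE; apply: eq_integral => w _; rewrite !funeposE.
by rewrite [LHS]nE; apply: eq_integral => w _; rewrite !funenegE.
Qed.

Theorem scheme_ergodic : exists mu : probability VN R,
  [/\ invariant_measure P U mu,
      forall nu : probability VN R, invariant_measure P U nu ->
        forall A, measurable A -> nu A = mu A &
      ergodic P U mu].
Proof.
have [rho [e [rho_e e0 rhoP]]] : exists (rho : {measure set VN -> \bar R}) (e : R),
  [/\ rho setT = e%:E, 0 < e & forall f x, bddm f -> (forall y, 0 <= f y) ->
     \int[rho]_y f y <= iter 2 op f x].
  apply: (step_kernel_doeblin tau_gt0 lambda1 kappa_lt1 (c := c)).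
  - by move=> p r r0; exact: (noise_law_cube_gt0 bW eta_gt0 tau_gt0 p r0).
  - by move=> M l l1; exact: (noise_law_cube_ratio N bW eta_gt0 tau_gt0 M l1).
  - by move=> v z j; exact: flowP.
pose y0 : VN := of_coord (fun=> 0).
have [mu [mu_rate mu_op]] := doeblin_invariant mK rho_e e0 rhoP y0.
have rate_cvg : doeblin_rate e k @[k --> \oo] --> 0.
  exact: (doeblin_rate_cvg rho_e e0 rhoP y0).
have mu_iter k f : bddm f -> \int[mu]_y iter k op f y = \int[mu]_y f y.
  move=> bf; elim: k => //= k ih; rewrite mu_op ?ih//; exact: iter_markov_op_bddm.
have transE k f : bddm f -> transition P U k f = iter k op f.
  by move=> bf; apply/funext => y; rewrite transition_chain_law ?chain_law_iter//; case: bf.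
exists mu; split.
- move=> k phi mphi bphi; have bf : bddm phi by [].
  rewrite transE// -!bddm_fine ?probability_ltoo ?mu_iter//; exact: iter_markov_op_bddm.
- move=> nu nu_inv A mA; have bA := bddm_indic R mA; have [m1 b1] := bA.
  have nuE k : \int[nu]_y iter k op \1_A y = \int[nu]_y \1_A y.
    suff : (\int[nu]_y iter k op \1_A y)%:E = (\int[nu]_y \1_A y)%:E by case.
    have := nu_inv k \1_A m1 b1; rewrite transE// => h.
    by rewrite !bddm_fine ?probability_ltoo//; exact: iter_markov_op_bddm.
  have lawE (p : probability VN R) : p A = (\int[p]_y \1_A y)%:E.
    by rewrite bddm_fine ?probability_ltoo// integral_indic// setIT.
  rewrite !lawE; congr EFin.
  have [D AD] : exists D : R, osc_le (\1_A : VN -> R) D.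
    by have [C AC] := b1; exists (C + C); exact: osc_le_norm.
  (* Invariance of [nu] allows replacing the indicator by its k-th iterate, which is uniformly close
     to its [mu]-integral. *)
  have close k : `|\int[nu]_y \1_A y - \int[mu]_y \1_A y| <= doeblin_rate e k * D.
    have bk := iter_markov_op_bddm mK k bA.
    have -> : \int[nu]_y \1_A y - \int[mu]_y \1_A y =
        \int[nu]_x (iter k op \1_A x + cst (- \int[mu]_y \1_A y) x).
      rewrite RintegralD//.
      + by rewrite nuE Rintegral_probability_cst.
      + exact: bddm_integrable (probability_ltoo nu) bk.
      + exact: bddm_integrable (probability_ltoo nu) (bddm_cst _ _).
    apply: Rintegral_norm_le => [|x]; last exact: mu_rate.
    by apply: measurable_funD => //; case: bk.
  have : doeblin_rate e k * D @[k --> \oo] --> 0.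
    by rewrite -(mul0r D); apply: cvgMl; exact: rate_cvg.
  move=> lim0; apply/eqP; rewrite -subr_eq0 -normr_le0.
  rewrite -(cvg_lim _ lim0)//; apply: limr_ge; first by apply/cvg_ex; exists 0.
  exact: nearW.
- move=> phi phi2 dev.
  have mphi : measurable_fun setT phi by move: (sub_Lfun_mfun phi2); rewrite inE.
  have -> : dev = fun M y => M%:R^-1 * (\sum_(k < M) \int[chain_law k y]_z phi z) - \int[mu]_z phi z.
    apply/funext => M; apply/funext => y; rewrite /dev; congr (_ * _ - _).
    by apply: eq_bigr => k _; rewrite transition_chain_law.
  apply: (cesaro_L2 measurable_chain_law _ _ rate_cvg mphi).
  + move=> k f bf; rewrite -(mu_iter k f bf); apply: eq_Rintegral => y _.
    exact: chain_law_iter.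
  + by move=> f D k y bf fD; rewrite chain_law_iter//; exact: mu_rate.
  + have /integrableP[_] := Lfun2_integrable_sqr phi2.
    by under eq_integral => x _ do rewrite /= ger0_norm ?sqr_ge0//.
Qed.

End scheme_chain.

Theorem theorem4p2 (R : realType) (d : measure_display)
    (Omega : measurableType d) (P : probability Omega R)
    (F : R -> set (set Omega)) (W : nat * bool -> R -> {RV P >-> R})
    (eta : nat -> R) (alpha lambda : R) (N : nat) :
  brownian_family F W ->
  (forall m, (1 <= m)%N -> 0 < eta m) ->
  (\sum_(1 <= m <oo) (eta m)%:E < +oo)%E ->
  0 < alpha ->
  lambda = 1 \/ lambda = -1 ->
  (1 <= N)%N ->
  exists2 tau0 : R, 0 < tau0 &
    forall tau : R, 0 < tau -> tau < tau0 -> alpha * tau <= 1 ->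
    forall U : (R -> R[i]) -> nat -> Omega -> VN R N,
      (forall u0, square_integrable u0 ->
         scheme_solution F W eta alpha lambda tau u0 (U u0)) ->
      exists mu : probability (VN R N) R,
        [/\ invariant_measure P U mu,
            forall nu : probability (VN R N) R, invariant_measure P U nu ->
              forall A, measurable A -> nu A = mu A &
            ergodic P U mu].
Proof.
move=> bW eta_gt0 _ _ lambda1 N1.
have f0 : 0 < (N%:R * pi : R) ^+ 2 by rewrite exprn_gt0// mulr_gt0 ?ltr0n ?pi_gt0.
(* Inverse of the largest eigenvalue of -Delta on V_N, so that tau below this threshold is exactly
   the smallness condition of the estimates. *)
exists ((N%:R * pi) ^+ 2)^-1; first by rewrite invr_gt0.
move=> tau tau_gt0 tau_lt _ U HU.
have kappa_lt1 : tau * (N%:R * pi) ^+ 2 < 1 by rewrite -ltr_pdivlMr// div1r.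
exact: (scheme_ergodic bW eta_gt0 tau_gt0 lambda1 kappa_lt1 HU).
Qed.
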